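(* Fix $p\in[\tfrac23,1)$ and let $\mu_p=\tfrac12(2-p)^d$. Conditionally on a realization of $Q_{d,p}$: - let $\mathsf{UniformSampler}$ be the uniform distribution on independent sets of $Q_{d,p}$; - let $\mathsf{DefectSize}$ be the law of $\min(|S\cap\mathsf{Even}|,|S\cap\mathsf{Odd}|)$ for $S\sim\mathsf{UniformSampler}$. Then, as $d\to\infty$, \[ \big\|\mathsf{DefectSize}-\mathrm{Poisson}(\mu_p)\big\|_{TV}\xrightarrow{\mathbb P}0 . \] That is, for every $\varepsilon>0$, the probability (over the percolation) that this total variation distance exceeds $\varepsilon$ tends to $0$.
   Context: Setup: - $Q_d=\{0,1\}^d$ is the hypercube graph, with edges between strings differing in exactly one coordinate. - $\mathsf{Even}$ and $\mathsf{Odd}$ are the sets of vertices of even and odd Hamming weight, respectively. - For fixed $p\in(0,1)$, $Q_{d,p}$ is obtained by retaining each edge of $Q_d$ independently with probability $p$. - Independent sets of $Q_{d,p}$ include the empty set. - $\|\cdot\|_{TV}$ is total variation distance. *)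

(* Defs.v *)
From HB Require Import structures.
From mathcomp Require Import all_boot all_order all_algebra.
From mathcomp Require Import all_classical all_reals all_analysis.
Set Implicit Arguments. Unset Strict Implicit. Unset Printing Implicit Defensive.
Import Order.TTheory GRing.Theory Num.Theory.
Local Open Scope ring_scope.

Definition cube (d : nat) := {ffun 'I_d -> bool}.

Definition hamming d (x y : cube d) : nat := #|[set i | x i != y i]|.

Definition Qedges d : {set {set cube d}} :=
  [set [set x; y] | x in [set: cube d], y in [set z : cube d | hamming x z == 1%N]].

Definition Even d : {set cube d} := [set x : cube d | ~~ odd #|[set i | x i]|].
Definition Odd d : {set cube d} := [set x : cube d | odd #|[set i | x i]|].

Definition indep d (w : {set {set cube d}}) (S : {set cube d}) : bool :=
  [forall x in S, forall y in S, [set x; y] \notin w].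

Definition perc_weight (R : realType) (p : R) d (w : {set {set cube d}}) : R :=
  p ^+ #|w| * (1 - p) ^+ (#|Qedges d| - #|w|).

Definition defect_size (R : realType) d (w : {set {set cube d}}) (k : nat) : R :=
  #|[set S : {set cube d} | indep w S &&
       (minn #|S :&: Even d| #|S :&: Odd d| == k)]|%:R /
  #|[set S : {set cube d} | indep w S]|%:R.

Definition poisson_pmf (R : realType) (mu : R) (k : nat) : R :=
  expR (- mu) * mu ^+ k / (k`!)%:R.

Definition tv_nat (R : realType) (P Q : nat -> R) : \bar R :=
  ((2%:R)^-1)%:E * (\esum_(k in [set: nat]) (`| P k - Q k |)%:E)%E.

Definition mu_p (R : realType) (p : R) (d : nat) : R := 2^-1 * (2 - p) ^+ d.

Definition bad_prob (R : realType) (p eps : R) (d : nat) : R :=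
  \sum_(w in powerset (Qedges d) |
        (eps%:E < tv_nat (defect_size R w) (poisson_pmf (mu_p p d)))%E)
     perc_weight p w.

(* Main.v *)
(* Put x = 1 - p <= 1/3 and N = 2^(d-1).  Averaged over the percolation, the number of independent
   sets is the partition function of the measure giving S the weight x^e(S), where e(S) is the number
   of cube edges inside S.
   (1) Phases.  Under this measure the minority side of S has at most s^d elements, s < 2, outside an
   exponentially small event.  For a vertex v let T_v say whether v has a neighbour in S, and let f be
   the probability that the number of neighbours lies in [1, 2d/5].  Along an edge, T fails to alternate
   with probability O(f) up to exponentially small terms.  Conversely, Gibbs' inequality against a
   sequential kernel that copies T over distance 4, normalised through a Finner-type product
   inequality, bounds f in terms of that failure probability; together they make f exponentially small.
   (2) Clusters.  Edge isoperimetry, greedy covers and counting of walks bound the total weight of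
   the clusters (sets connected through common neighbours) with at least two elements, so that the
   sets whose intersections with both sides contain such a cluster have negligible weight.
   (3) Quenched count.  If the elements of O have disjoint neighbourhoods, then the number of E on the
   other side with O u E independent is 2^N prod_(u in O) phi_u, where phi_u = 2^(-deg u).  The
   phi_u of one side are independent, sum phi_u has mean mu_p and, since p >= 2/3, bounded
   variance, and sum phi_u^2 is bounded in mean.  Hence defects follow the normalised elementary
   symmetric polynomials of the phi_u, and Newton-type recursions for these give the Poisson law. *)
Require Import Defs.
From HB Require Import structures.
From mathcomp Require Import all_boot all_order all_algebra.
From mathcomp Require Import all_classical all_reals all_analysis.
From mathcomp Require Import ring lra zify.
(* Required again so that the set-theoretic names refer to finite sets. *)
From mathcomp Require Import fintype finset.
Set Implicit Arguments. Unset Strict Implicit. Unset Printing Implicit Defensive.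
Import Order.TTheory GRing.Theory Num.Theory.
Local Open Scope ring_scope.

(** * The hypercube *)

(** The two bounds between [f] and the failure of alternation look circular; a free constant closes
    the circle. In the reference kernel a failed copy has probability exp(-lam d), so it costs lam d
    in entropy, while the tilt of the low degrees rewards every bad vertex by at least d / 200. A
    failure at one step has probability at most 408 f plus a small term and a copy takes four steps,
    so the reward wins, uniformly in d, as soon as 4 * 408 * lam is below 1 / 200. Copies must join
    vertices of the same parity, and 4 is the least even distance at which neighbourhoods are
    disjoint. Phase concentration is needed with s strictly below 2: edge isoperimetry then makes
    the vertices strongly seen by the cover of a cluster outnumber the undetermined elements of that
    cluster by a constant factor, and this pays for choosing the cluster. In the quenched count, sum
    phi_u stays within O(1) of mu_p with high probability, which is negligible against the Poisson
    width sqrt(mu_p); hence one parameter mu_p serves both sides. *)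

Section Cube.
Variable d : nat.
Implicit Types (u v t : cube d) (i j : 'I_d) (S T A B O E : {set cube d}) (b : bool).

Definition flip u i : cube d := [ffun j => u j (+) (j == i)].
Definition xorc u t : cube d := [ffun j => u j (+) t j].
Definition par u : bool := odd #|[set i | u i]|.
Definition side b : {set cube d} := [set u | par u == b].
Definition nb u : {set cube d} := [set flip u i | i : 'I_d].
Definition kk S u : nat := #|[set i : 'I_d | flip u i \in S]|.
(** The number of cube edges inside [S], each counted at its end on side [b]. *)
Definition es b S : nat := (\sum_(u in S :&: side b) kk S u)%N.
Definition xshift t S : {set cube d} := [set u | xorc u t \in S].

Lemma parE u : par u = \big[addb/false]_i u i.
Proof.
rewrite /par -sum1_card (big_morph odd oddD (erefl : odd 0 = false)).
rewrite big_mkcond; apply: eq_bigr => i _; rewrite inE.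
by case: (u i).
Qed.

Lemma flip_xorc u t i : xorc (flip u i) t = flip (xorc u t) i.
Proof. by apply/ffunP => j; rewrite !ffunE addbAC. Qed.

Lemma par_flip u i : par (flip u i) = ~~ par u.
Proof.
rewrite !parE (bigD1 i) //= [in RHS](bigD1 i) //= ffunE eqxx addbT -addNb.
congr (_ (+) _); apply: eq_bigr => j /negPf ji.
by rewrite ffunE ji addbF.
Qed.

Lemma flipK i : involutive (flip ^~ i).
Proof. by move=> u; apply/ffunP => j; rewrite !ffunE -addbA addbb addbF. Qed.

Lemma flip_inj u : injective (flip u).
Proof.
move=> i j /ffunP /(_ i); rewrite !ffunE eqxx => /addbI; by case: eqP.
Qed.

Lemma flipC u i j : flip (flip u i) j = flip (flip u j) i.
Proof. by apply/ffunP => l; rewrite !ffunE addbAC. Qed.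

Lemma xorcK t : involutive (xorc ^~ t).
Proof. by move=> u; apply/ffunP => j; rewrite !ffunE -addbA addbb addbF. Qed.

Lemma in_side u b : (u \in side b) = (par u == b).
Proof. by rewrite inE. Qed.

Lemma flip_side u i b : (flip u i \in side b) = (u \in side (~~ b)).
Proof. by rewrite !in_side par_flip; case: (par u) b => [] []. Qed.

Lemma Even_side : Even d = side false.
Proof. by apply/setP => u; rewrite !inE /par eqbF_neg. Qed.

Lemma Odd_side : Odd d = side true.
Proof. by apply/setP => u; rewrite !inE /par eqb_id. Qed.

Lemma sideC b : ~: side b = side (~~ b).
Proof. by apply/setP => u; rewrite !inE; case: (par u) b => [] []. Qed.

Lemma side_disj b : [disjoint side b & side (~~ b)].
Proof. by rewrite -sideC -subsets_disjoint. Qed.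

Lemma card_cube : #|[set: cube d]| = (2 ^ d)%N.
Proof. by rewrite cardsT card_ffun card_bool card_ord. Qed.

Lemma card_sideN b : (0 < d)%N -> #|side (~~ b)| = #|side b|.
Proof.
move=> d0; pose i0 := Ordinal d0.
rewrite -(card_imset _ (inv_inj (@flipK i0))); apply: eq_card => u.
apply/imsetP/idP => [[v vs ->]|us]; first by rewrite flip_side.
by exists (flip u i0); rewrite ?flip_side ?negbK ?flipK.
Qed.

Lemma card_side b : (0 < d)%N -> #|side b| = (2 ^ d.-1)%N.
Proof.
move=> d0; have := cardsC (side b).
rewrite sideC card_sideN // -cardsT card_cube.
by rewrite -[in (2 ^ d)%N](prednK d0) expnS mul2n addnn => /double_inj.
Qed.

Lemma kkE S u : kk S u = (\sum_(i < d) (flip u i \in S))%N.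
Proof.
by rewrite /kk -sum1_card big_mkcond; apply: eq_bigr => i _; rewrite inE; case: ifP.
Qed.

Lemma kk_le S u : (kk S u <= d)%N.
Proof. by rewrite /kk -[X in (_ <= X)%N]card_ord max_card. Qed.

Lemma kk_sub S T u : S \subset T -> (kk S u <= kk T u)%N.
Proof.
move=> /subsetP ST; apply/subset_leq_card/subsetP => i; rewrite !inE; exact: ST.
Qed.

Lemma kk0 u : kk set0 u = 0%N.
Proof. by rewrite kkE big1 // => i _; rewrite inE. Qed.

Lemma kkU S T u : [disjoint S & T] -> kk (S :|: T) u = (kk S u + kk T u)%N.
Proof.
move=> dST; rewrite !kkE -big_split; apply: eq_bigr => i _; rewrite in_setU.
case: (boolP (_ \in S)) => // /(disjointFr dST) -> //.
Qed.

Lemma nb_sym u v : (u \in nb v) = (v \in nb u).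
Proof. by apply/imsetP/imsetP => [] [i _ ->]; exists i; rewrite ?flipK. Qed.

Lemma card_nb u : #|nb u| = d.
Proof. by rewrite card_imset ?card_ord //; exact: flip_inj. Qed.

Lemma kk_sideI b S u : u \in side b -> kk S u = kk (S :&: side (~~ b)) u.
Proof.
by move=> ub; apply: eq_card => i; rewrite !inE -in_side flip_side negbK ub andbT.
Qed.

Lemma kk_xshift t S u : kk (xshift t S) u = kk S (xorc u t).
Proof. by apply: eq_card => i; rewrite !inE flip_xorc. Qed.

Lemma xshiftK t : involutive (xshift t).
Proof. by move=> S; apply/setP => u; rewrite !inE xorcK. Qed.

(** Every edge inside [S] has one end on each side, and flipping its coordinate exchanges the two
    ends. *)
Lemma es_side b S : es (~~ b) S = es b S.
Proof.
rewrite /es.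
have exch c : (\sum_(u in S :&: side c) kk S u
    = \sum_(i < d) \sum_u ((u \in S) && (u \in side c) && (flip u i \in S)))%N.
  rewrite exchange_big big_mkcond; apply: eq_bigr => u _; rewrite in_setI.
  case: ifP => [_|_]; first by rewrite kkE; apply: eq_bigr.
  by rewrite big1.
rewrite !exch; apply: eq_bigr => i _.
rewrite (reindex_inj (inv_inj (@flipK i))) /=; apply: eq_bigr => u _.
by rewrite flipK flip_side negbK; case: (u \in S); case: (_ \in S); case: (u \in side b).
Qed.

Lemma es_double b S : (es b S).*2 = (\sum_(u in S) kk S u)%N.
Proof.
have -> : es b S = es false S by case: b => //; rewrite -[RHS]es_side.
rewrite -addnn -{1}es_side /es [RHS](bigID (mem (side true))) /=.
by congr addn; apply: eq_bigl => u; rewrite !inE; case: (par u).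
Qed.

Lemma es_xshift t S : es false (xshift t S) = es false S.
Proof.
apply: double_inj; rewrite !es_double.
rewrite (reindex_inj (inv_inj (@xorcK t))) /=; apply: eq_big => u.
  by rewrite inE xorcK.
by rewrite kk_xshift xorcK.
Qed.

End Cube.

Lemma big_side (R : Type) (idx : R) (op : Monoid.com_law idx) d b (F : {set cube d} -> R) :
  \big[op/idx]_S F S =
  \big[op/idx]_(E in powerset (side d b)) \big[op/idx]_(O in powerset (side d (~~ b))) F (E :|: O).
Proof.
rewrite pair_big_dep /=.
rewrite (reindex_onto (fun p : {set cube d} * {set cube d} => p.1 :|: p.2)
   (fun S => (S :&: side d b, S :&: side d (~~ b)))) /=; last first.
  by move=> S _; rewrite -setIUr -sideC setUCr setIT.
apply: eq_bigl => -[E O] /=; rewrite !powersetE.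
apply/eqP/andP => [[<- <-]|[Eb Ob]]; first by rewrite !subsetIr.
rewrite !setIUl (setIidPl Eb) (setIidPl Ob); congr pair.
  apply/setUidPl; rewrite (subset_trans (setSI _ Ob)) //.
  by rewrite setIC (disjoint_setI0 (side_disj _ _)) sub0set.
apply/setUidPr; rewrite (subset_trans (setSI _ Eb)) //.
by rewrite (disjoint_setI0 (side_disj _ _)) sub0set.
Qed.

Section Powerset.
Variables (R : realType) (T : finType).
Implicit Types (D : {set T}) (z : T -> R).

Lemma sum_powerset_prod D z :
  \sum_(O in powerset D) \prod_(w in O) z w = \prod_(w in D) (1 + z w).
Proof.
rewrite [RHS]big_mkcond /=.
under [RHS]eq_bigr => w _ do rewrite [X in if _ then X else _]addrC.
transitivity (\prod_w ((if w \in D then z w else 0) + 1)).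
  rewrite bigA_distr big_mkcond /=; apply: eq_bigr => J _.
  rewrite powersetE; case: (boolP (J \subset D)) => [/subsetP JD|].
    rewrite [LHS]big_mkcond; apply: eq_bigr => w _.
    by case: ifP => // /JD ->.
  move=> /subsetPn[w wJ wD]; rewrite (bigD1 w) //= wJ (negPf wD) mul0r //.
by apply: eq_bigr => w _; case: ifP => //; rewrite add0r.
Qed.

Lemma big_powersetD1 D v (F : {set T} -> R) : v \in D ->
  \sum_(E in powerset D) F E = \sum_(E in powerset (D :\ v)) (F E + F (v |: E)).
Proof.
move=> vD; rewrite big_split /= (bigID (fun E : {set T} => v \in E)) /= addrC; congr +%R.
  apply: eq_bigl => E; rewrite !powersetE subsetD1; by [].
rewrite (reindex_onto (fun E => v |: E) (fun E => E :\ v)) /=; last first.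
  by move=> E /andP[_ vE]; rewrite setD1K.
apply: eq_bigl => E; rewrite !powersetE setU11 andbT subsetD1 subUset sub1set vD /=.
case: (boolP (v \in E)) => vE; last by rewrite setU1K // eqxx andbT.
rewrite andbF; apply/andP => -[_ /eqP h]; have := setD11 v (v |: E).
by rewrite h vE.
Qed.
End Powerset.

(** * Phase concentration for the annealed measure *)

Section Gibbs.
Variables (R : realType) (x : R) (d : nat).
Hypotheses (x_gt0 : 0 < x) (x_le : x <= 3^-1).
Implicit Types (f g : {set cube d} -> R) (Q : {set cube d} -> bool) (u v t w : cube d) (i j m : 'I_d) (S A B O E : {set cube d}) (b : bool).

Definition wt S : R := x ^+ es false S.
Definition Zpart : R := \sum_S wt S.
Definition Ex (f : {set cube d} -> R) : R := (\sum_S wt S * f S) / Zpart.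
Definition Pr (Q : {set cube d} -> bool) : R := Ex (fun S => (Q S)%:R).

Lemma wt_gt0 S : 0 < wt S. Proof. exact: exprn_gt0. Qed.
Lemma wt_ge0 S : 0 <= wt S. Proof. exact: ltW (wt_gt0 S). Qed.

Lemma Zpart_gt0 : 0 < Zpart.
Proof.
rewrite /Zpart (bigD1 set0) //= ltr_pwDl ?wt_gt0 // sumr_ge0 // => S _; exact: wt_ge0.
Qed.

Lemma Ex_le f g : (forall S, f S <= g S) -> Ex f <= Ex g.
Proof.
move=> fg; apply: ler_wpM2r; first by rewrite invr_ge0 ltW ?Zpart_gt0.
by apply: ler_sum => S _; rewrite ler_wpM2l ?wt_ge0.
Qed.

Lemma ExD f g : Ex (fun S => f S + g S) = Ex f + Ex g.
Proof. by rewrite /Ex -mulrDl -big_split; congr (_ / _); apply: eq_bigr => S _; rewrite mulrDr. Qed.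

Lemma ExZ c f : Ex (fun S => c * f S) = c * Ex f.
Proof. by rewrite /Ex mulrA mulr_sumr; congr (_ / _); apply: eq_bigr => S _; rewrite mulrCA. Qed.

Lemma Ex_sum (I : Type) (r : seq I) (P : pred I) (F : I -> {set cube d} -> R) :
  Ex (fun S => \sum_(i <- r | P i) F i S) = \sum_(i <- r | P i) Ex (F i).
Proof.
rewrite /Ex -mulr_suml exchange_big; congr (_ / _).
by apply: eq_bigr => S _; rewrite mulr_sumr.
Qed.

Lemma eq_Ex f g : f =1 g -> Ex f = Ex g.
Proof. by move=> fg; rewrite /Ex; congr (_ / _); apply: eq_bigr => S _; rewrite fg. Qed.

Lemma Ex1 c : Ex (fun=> c) = c.
Proof. by rewrite /Ex -mulr_suml mulrAC divff ?mul1r // gt_eqF ?Zpart_gt0. Qed.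

Lemma Pr_ge0 Q : 0 <= Pr Q.
Proof. by rewrite -[0](Ex1 0); apply: Ex_le. Qed.

Lemma Pr_le Q Q' : (forall S, Q S -> Q' S) -> Pr Q <= Pr Q'.
Proof. by move=> h; apply: Ex_le => S; rewrite ler_nat; case: (Q S) (h S) => // ->. Qed.

Lemma Pr_le1 Q : Pr Q <= 1.
Proof. by rewrite -[leRHS](Ex1 1); apply: Ex_le => S; case: (Q S). Qed.

Lemma Pr_le2 Q Q1 Q2 : (forall S, Q S -> Q1 S || Q2 S) -> Pr Q <= Pr Q1 + Pr Q2.
Proof.
move=> h; rewrite /Pr -ExD; apply: Ex_le => S; rewrite -natrD ler_nat.
by case: (Q S) (h S) => // /(_ isT); case: (Q1 S); case: (Q2 S).
Qed.

(** Translations are automorphisms of the cube, so estimates at one vertex hold at all of them. *)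
Lemma Ex_xshift t f : Ex (fun S => f (xshift t S)) = Ex f.
Proof.
rewrite /Ex; congr (_ / _); rewrite [RHS](reindex_inj (inv_inj (@xshiftK d t))) /=.
by apply: eq_bigr => S _; rewrite /wt es_xshift.
Qed.

Lemma Pr_xshift t Q : Pr (fun S => Q (xshift t S)) = Pr Q.
Proof. exact: (Ex_xshift t (fun S => (Q S)%:R)). Qed.

Lemma Pr_markov f c Q : 0 < c -> (forall S, 0 <= f S) -> (forall S, Q S -> c <= f S) ->
  c * Pr Q <= Ex f.
Proof.
move=> c0 f0 h; rewrite /Pr -ExZ; apply: Ex_le => S.
by case: (Q S) (h S) => [/(_ isT)|_]; rewrite ?mulr1 ?mulr0.
Qed.

Lemma es_union b E O : E \subset side d b -> O \subset side d (~~ b) ->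
  es false (E :|: O) = (\sum_(w in O) kk E w)%N.
Proof.
move=> Eb Ob.
have -> : es false (E :|: O) = es (~~ b) (E :|: O) by case: b {Eb Ob} => //=; rewrite -[RHS]es_side.
rewrite /es.
have -> : (E :|: O) :&: side d (~~ b) = O.
  rewrite setIUl (setIidPl Ob); apply/setUidPr.
  by rewrite (subset_trans (setSI _ Eb)) // (disjoint_setI0 (side_disj _ _)) sub0set.
apply: eq_bigr => w wO.
have wb : w \in side d (~~ b) by exact: (subsetP Ob).
rewrite (kk_sideI _ wb) negbK setIUl (setIidPl Eb); congr kk; apply/setUidPl.
rewrite (subset_trans (setSI _ Ob)) //.
by rewrite setIC (disjoint_setI0 (side_disj _ _)) sub0set.
Qed.

Lemma wt_union b E O : E \subset side d b -> O \subset side d (~~ b) ->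
  wt (E :|: O) = \prod_(w in O) x ^+ kk E w.
Proof. by move=> Eb Ob; rewrite /wt (es_union Eb Ob) expr_sum. Qed.

Lemma kk_union b E O v : E \subset side d b -> O \subset side d (~~ b) -> v \in side d b ->
  kk (E :|: O) v = kk O v.
Proof.
move=> Eb Ob vb; rewrite (kk_sideI _ vb) setIUl (setIidPl Ob); congr kk.
apply/setUidPr; rewrite (subset_trans (setSI _ Eb)) //.
by rewrite (disjoint_setI0 (side_disj _ _)) sub0set.
Qed.

Lemma expr_kk (y : R) O v : y ^+ kk O v = \prod_(w in O) (if w \in nb v then y else 1).
Proof.
rewrite -big_mkcondr /= prodr_const; congr (_ ^+ _).
rewrite /kk -(card_imset _ (@flip_inj d v)); apply: eq_card => w.
rewrite [RHS]unfold_in; apply/imsetP/andP => [[i]|[wO /imsetP[i _ wE]]].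
  by rewrite !inE => fiO ->; rewrite imset_f.
by exists i => //; rewrite inE -wE.
Qed.

(** Given the part [E] on side [b], the vertices of the other side are occupied independently, [w]
    with odds [x ^+ kk E w]; the factor [y] makes this a generating function of the number of
    occupied neighbours of [v]. *)
Lemma sum_wt_side b E v (y : R) : E \subset side d b -> v \in side d b ->
  \sum_(O in powerset (side d (~~ b))) wt (E :|: O) * y ^+ kk (E :|: O) v =
  \prod_(w in side d (~~ b)) (1 + x ^+ kk E w * (if w \in nb v then y else 1)).
Proof.
move=> Eb vb; rewrite -sum_powerset_prod; apply: eq_bigr => O.
rewrite powersetE => Ob; rewrite (wt_union Eb Ob) (kk_union Eb Ob vb) expr_kk.
by rewrite -big_split.
Qed.

Lemma sum_wt_side1 b E : E \subset side d b ->
  \sum_(O in powerset (side d (~~ b))) wt (E :|: O) =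
  \prod_(w in side d (~~ b)) (1 + x ^+ kk E w).
Proof.
move=> Eb; rewrite -sum_powerset_prod; apply: eq_bigr => O.
by rewrite powersetE => Ob; rewrite (wt_union Eb Ob).
Qed.

Lemma nb_side b v : v \in side d b -> nb v \subset side d (~~ b).
Proof.
by move=> vb; apply/subsetP => _ /imsetP[i _ ->]; rewrite flip_side negbK.
Qed.

(** The variable [y] enters only through the neighbours of [v], so the conditional moment can be
    bounded one neighbour at a time. *)
Lemma sum_wt_ratio b E v (y : R) (c : 'I_d -> R) : E \subset side d b -> v \in side d b ->
  0 <= y -> (forall i, 1 + x ^+ kk E (flip v i) * y <= c i * (1 + x ^+ kk E (flip v i))) ->
  \sum_(O in powerset (side d (~~ b))) wt (E :|: O) * y ^+ kk (E :|: O) v <=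
  (\prod_i c i) * \sum_(O in powerset (side d (~~ b))) wt (E :|: O).
Proof.
move=> Eb vb y0 hc; rewrite sum_wt_side // sum_wt_side1 //.
have nbs := nb_side vb.
have pos w : 0 < 1 + x ^+ kk E w by rewrite ltr_pwDl // exprn_ge0 // ltW.
rewrite (big_setID (nb v)) [in leRHS](big_setID (nb v)) /= !(setIidPr nbs) mulrA.
rewrite [X in _ * X <= _](eq_bigr (fun w => 1 + x ^+ kk E w)); last first.
  by move=> w; rewrite inE => /andP[/negPf-> _]; rewrite mulr1.
rewrite ler_wpM2r //; first by apply: prodr_ge0 => w _; exact: ltW.
rewrite !big_imset /=; try by move=> i j _ _; exact: flip_inj.
rewrite -big_split /=; apply: ler_prod => i _; rewrite imset_f //.
by rewrite hc andbT addr_ge0 // mulr_ge0 // exprn_ge0 // ltW.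
Qed.

(** Integrates a conditional inequality, given side [b], over an event that is decided by that
    side. *)
Lemma Ex_cond b (psi : {set cube d} -> bool) (f g : {set cube d} -> R) (c : R) :
  (forall S, psi S = psi (S :&: side d b)) ->
  (forall E, E \subset side d b -> psi E ->
    \sum_(O in powerset (side d (~~ b))) wt (E :|: O) * f (E :|: O) <=
    c * \sum_(O in powerset (side d (~~ b))) wt (E :|: O) * g (E :|: O)) ->
  Ex (fun S => (psi S)%:R * f S) <= c * Ex (fun S => (psi S)%:R * g S).
Proof.
move=> psiE h; rewrite /Ex mulrA; apply: ler_wpM2r; first by rewrite invr_ge0 ltW ?Zpart_gt0.
rewrite (big_side _ b) [in leRHS](big_side _ b) /= mulr_sumr; apply: ler_sum => E.
rewrite powersetE => Eb.
have psiEO O : O \in powerset (side d (~~ b)) -> psi (E :|: O) = psi E.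
  rewrite powersetE => Ob; rewrite psiE setIUl (setIidPl Eb); congr psi; apply/setUidPl.
  rewrite (subset_trans (setSI _ Ob)) //.
  by rewrite setIC (disjoint_setI0 (side_disj _ _)) sub0set.
case: (boolP (psi E)) => pE.
  have e k : \sum_(O in powerset (side d (~~ b))) wt (E :|: O) * ((psi (E :|: O))%:R * k (E :|: O)) =
     \sum_(O in powerset (side d (~~ b))) wt (E :|: O) * k (E :|: O).
    by apply: eq_bigr => O /psiEO ->; rewrite pE mul1r.
  by rewrite !e h.
by rewrite !big1 ?mulr0 // => O /psiEO ->; rewrite (negPf pE) mul0r mulr0.
Qed.

End Gibbs.

(** * Local estimates: alternation of occupied neighbourhoods along edges *)

Lemma prod_if (R : realType) (I : finType) (P : pred I) (c : R) :
  \prod_i (if P i then c else 1) = c ^+ #|[set i | P i]|.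
Proof.
rewrite -big_mkcond /= prodr_const; congr (_ ^+ _); apply: eq_card => i.
by rewrite inE unfold_in.
Qed.

(** Common rate of the exponential errors, locked so that only [rhoE] reveals its value. *)
Definition rho (R : realType) : R := locked (99 / 100).

Lemma rhoE (R : realType) : rho R = 99 / 100.
Proof. by rewrite /rho -lock. Qed.

Lemma rho_gt0 (R : realType) : 0 < rho R.
Proof. by rewrite rhoE; lra. Qed.

Lemma rho_lt1 (R : realType) : rho R < 1.
Proof. by rewrite rhoE; lra. Qed.

(** Constants of the exponential moment in [cond_large], whose parameter is y = u^5; fifth powers
    turn the fractions 2/5 and 3/5 of d into integer exponents. A neighbour that sees nothing
    contributes s^5 (at most 3d/5 of them), a bad one y <= g^50 (at most d/50), and each one a
    further e. The last inequality compares the product with the threshold value u^(2d). *)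
Lemma moment_constants (R : realType) : exists u s g e : R,
  [/\ [/\ 1 <= u, 1 <= s, 1 <= g, 1 <= e & e = 1 + 10^-1 ^+ 4],
      1 + u ^+ 5 <= s ^+ 5 * 2, u <= g ^+ 10, u ^+ 5 <= 3 &
      s ^+ 3 * g * e <= rho R * u ^+ 2].
Proof.
exists (23 / 20), (1086 / 1000), (1015 / 1000), (1 + 10^-1 ^+ 4).
by rewrite rhoE; split; [split => //; lra | lra | lra | lra | lra].
Qed.

Lemma third_expr11 (R : realType) : 3^-1 ^+ 11 <= 10^-1 ^+ 5 * 2 :> R.
Proof. by lra. Qed.

Lemma small_factor (R : realType) (z : R) : 0 <= z -> z <= 10^-1 ^+ 5 * 2 ->
  z * 3 <= z + 10^-1 ^+ 4 * (1 + z).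
Proof. by move=> z0 zs; nra. Qed.

Section Local.
Variables (R : realType) (x : R) (d : nat).
Hypotheses (x_gt0 : 0 < x) (x_le : x <= 3^-1) (d_ge : (25 <= d)%N).
Implicit Types (f g : {set cube d} -> R) (Q : {set cube d} -> bool) (u v t w : cube d) (i j m : 'I_d) (S A B O E : {set cube d}) (b : bool).
Local Notation Ex := (Ex x).
Local Notation Pr := (Pr x).
Local Notation wt := (wt x).

Definition bad S u : bool := (0 < kk S u)%N && (5 * kk S u <= 2 * d)%N.
(** The neighbours of [v] that see nothing in [S]: given the side of [v], each of them is occupied
    with probability 1/2. *)
Definition na S v : nat := #|[set i | kk S (flip v i) == 0%N]|.
Definition nbad S v : nat := #|[set i | bad S (flip v i)]|.
Local Notation rho := (rho R).

(** Chernoff bound: at most 3d/5 neighbours are free, about half of these get occupied, few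
    neighbours are bad, and the remaining ones see so many elements that they are almost surely
    empty. More than 2d/5 occupied neighbours is then a large deviation. *)
Lemma cond_large b E v : E \subset side d b -> v \in side d b ->
  (5 * na E v <= 3 * d)%N -> (50 * nbad E v <= d)%N ->
  \sum_(O in powerset (side d (~~ b))) wt (E :|: O) * (2 * d < 5 * kk (E :|: O) v)%N%:R <=
  rho ^+ d * \sum_(O in powerset (side d (~~ b))) wt (E :|: O).
Proof.
move=> Eb vb ha hb.
have [u0 [s0 [g0 [e0 [[u01 s1 g1 e1 e2] ys yg y3 hall]]]]] := moment_constants R.
have x1 : x < 1 by rewrite (le_lt_trans x_le) // invf_lt1 // ltr1n.
pose y := u0 ^+ 5.
have y1 : 1 <= y by rewrite exprn_ege1.
have {}yg : y <= g0 ^+ 50.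
  have -> : 50%N = (10 * 5)%N by [].
  by rewrite /y exprM lerXn2r ?nnegrE ?exprn_ge0 ?(le_trans ler01).
rewrite -/y in ys y3.
pose c i : R := (if kk E (flip v i) == 0%N then s0 ^+ 5 else 1) *
   (if bad E (flip v i) then y else 1) * e0.
have hc i : 1 + x ^+ kk E (flip v i) * y <= c i * (1 + x ^+ kk E (flip v i)).
  rewrite /c /bad; set k := kk _ _.
  have xk0 : 0 <= x ^+ k by rewrite exprn_ge0 // ltW.
  case: eqP => [->|/eqP k0] /=.
    rewrite expr0 mul1r mulr1.
    have s50 : 0 <= s0 ^+ 5 by rewrite exprn_ge0 // (le_trans ler01).
    by rewrite (le_trans ys) // -mulrA ler_wpM2l // ler_peMl.
  rewrite lt0n k0 /= mul1r; case: leqP => kd.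
    have ye : 1 <= y * e0 by rewrite mulr_ege1.
    rewrite mulrDr mulr1 lerD // mulrC ler_wpM2r // ler_peMr //.
    by rewrite (le_trans ler01).
  (* From 5k > 2d >= 50. *)
  have k11 : (11 <= k)%N by move: kd d_ge; clear; lia.
  have xs : x ^+ k <= 10^-1 ^+ 5 * 2.
    rewrite (le_trans (_ : _ <= x ^+ 11)) //.
      by rewrite ler_wiXn2l // ltW.
    apply: (le_trans (y := 3^-1 ^+ 11)); last exact: third_expr11.
    by rewrite lerXn2r // nnegrE ?invr_ge0 // ltW.
  rewrite mul1r e2 mulrDl mul1r -addrA lerD2l.
  apply: (le_trans (y := x ^+ k * 3)); first by rewrite ler_wpM2l.
  exact: small_factor.
have pc : \prod_i c i <= s0 ^+ (3 * d) * g0 ^+ d * e0 ^+ d.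
  rewrite /c !big_split /= !prod_if prodr_const card_ord.
  rewrite ler_wpM2r ?exprn_ge0 ?(le_trans ler01) //.
  apply: ler_pM; rewrite ?exprn_ge0 // ?(le_trans ler01) // ?exprn_ge0 ?(le_trans ler01) //.
    by rewrite -exprM ler_weXn2l.
  rewrite (le_trans (_ : _ <= g0 ^+ 50 ^+ (nbad E v))) //.
    by rewrite lerXn2r // nnegrE ?exprn_ge0 // (le_trans ler01).
  by rewrite -exprM ler_weXn2l.
have y0 : 0 <= y by rewrite (le_trans ler01).
have := sum_wt_ratio x_gt0 Eb vb y0 hc.
set A := \sum_(O in _) _ => hA; set B := \sum_(O in _) wt (E :|: O) in hA *.
have B0 : 0 <= B by apply: sumr_ge0 => O _; exact: wt_ge0.
have u2 : 0 < u0 ^+ (2 * d) by rewrite exprn_gt0 // (lt_le_trans ltr01).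
rewrite -(ler_pM2l u2).
apply: (le_trans (y := A)).
  rewrite mulr_sumr; apply: ler_sum => O _; rewrite mulrCA ler_wpM2l ?wt_ge0 //.
  case: ltnP => [kd|_]; last by rewrite mulr0 exprn_ge0.
  by rewrite mulr1 /y -exprM ler_weXn2l // ltnW.
apply: (le_trans hA); rewrite mulrA ler_wpM2r //; apply: (le_trans pc).
have rho0 : 0 <= rho := ltW (rho_gt0 R).
have pos z : 1 <= z -> 0 <= z by apply: le_trans; exact: ler01.
rewrite !exprM -!exprMn; apply: lerXn2r; rewrite ?nnegrE.
- by rewrite !mulr_ge0 // ?exprn_ge0 // pos.
- by rewrite mulr_ge0 // exprn_ge0 // pos.
- by rewrite [leRHS]mulrC.
Qed.


Lemma na_side b S v : v \in side d b -> na S v = na (S :&: side d b) v.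
Proof.
move=> vb; apply: eq_card => i; rewrite !inE; congr (_ == _).
have wb : flip v i \in side d (~~ b) by rewrite flip_side negbK.
by rewrite (kk_sideI _ wb) negbK.
Qed.

Lemma nbad_side b S v : v \in side d b -> nbad S v = nbad (S :&: side d b) v.
Proof.
move=> vb; apply: eq_card => i; rewrite !inE /bad.
have wb : flip v i \in side d (~~ b) by rewrite flip_side negbK.
by rewrite (kk_sideI _ wb) negbK.
Qed.

(** The moment at y = 0: each free neighbour of [v] is empty with probability 1/2, independently. *)
Lemma cond_zero b E v : E \subset side d b -> v \in side d b ->
  \sum_(O in powerset (side d (~~ b))) wt (E :|: O) * (kk (E :|: O) v == 0%N)%:R <=
  2^-1 ^+ na E v * \sum_(O in powerset (side d (~~ b))) wt (E :|: O).
Proof.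
move=> Eb vb.
have := @sum_wt_ratio R x d x_gt0 b E v 0 (fun i => if kk E (flip v i) == 0%N then 2^-1 else 1)
  Eb vb (lexx _).
rewrite prod_if => h.
under eq_bigr => O _ do rewrite -expr0n.
apply: h => i; rewrite mulr0 addr0; case: eqP => [->|_].
  by rewrite expr0; lra.
by rewrite mul1r lerDl exprn_ge0 // ltW.
Qed.

Definition orig : cube d := [ffun => false].
(** The quantity [f] of the overview. *)
Definition pbad : R := Pr (fun S => bad S orig).

Lemma orig_xorc u : xorc orig u = u.
Proof. by apply/ffunP => i; rewrite !ffunE. Qed.

Lemma bad_xshift t S u : bad (xshift t S) u = bad S (xorc u t).
Proof. by rewrite /bad kk_xshift. Qed.

Lemma Pr_bad u : Pr (fun S => bad S u) = pbad.
Proof.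
rewrite /pbad -(Pr_xshift x u (fun S => bad S orig)).
by apply: eq_Ex => S; rewrite bad_xshift orig_xorc.
Qed.

Lemma pbad_ge0 : 0 <= pbad. Proof. exact: Pr_ge0. Qed.

Lemma Pr_nbad v : Pr (fun S => (d < 50 * nbad S v)%N) <= 50 * pbad.
Proof.
have d0 : 0 < d%:R :> R by rewrite ltr0n (leq_trans _ d_ge).
rewrite -(ler_pM2l d0).
apply: (le_trans (Pr_markov (f := fun S => 50 * (nbad S v)%:R) x_gt0 d0 _ _)).
- by move=> S; rewrite mulr_ge0.
- by move=> S h; rewrite -natrM ler_nat ltnW.
rewrite ExZ [leRHS]mulrCA; apply: ler_wpM2l => //.
rewrite (eq_Ex x (g := fun S => \sum_(i < d) (bad S (flip v i))%:R)); last first.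
  move=> S; rewrite /nbad -sum1_card natr_sum big_mkcond /=.
  by apply: eq_bigr => i _; rewrite inE; case: bad.
rewrite Ex_sum (eq_bigr (fun=> pbad)); last by move=> i _; exact: Pr_bad.
by rewrite sumr_const card_ord mulr_natl.
Qed.

Lemma par_orig : orig \in side d false.
Proof. by rewrite in_side parE big1 // => i _; rewrite ffunE. Qed.

Definition typical S v : bool := (5 * na S v <= 3 * d)%N && (50 * nbad S v <= d)%N.

Lemma typical_side b S v : v \in side d b -> typical S v = typical (S :&: side d b) v.
Proof. by move=> vb; rewrite /typical (na_side _ vb) (nbad_side _ vb). Qed.

Lemma Pr_typical_large v : Pr (fun S => typical S v && (2 * d < 5 * kk S v)%N) <= rho ^+ d.
Proof.
have vb : v \in side d (par v) by rewrite in_side.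
rewrite /Pr (eq_Ex x (g := fun S => (typical S v)%:R * (2 * d < 5 * kk S v)%N%:R)); last first.
  by move=> S; rewrite -natrM mulnb.
apply: (le_trans (Ex_cond (b := par v) (g := fun=> 1) (c := rho ^+ d) x_gt0 _ _)).
- by move=> S; exact: typical_side.
- move=> E Eb /andP[h1 h2]; under [in leRHS]eq_bigr => O _ do rewrite mulr1.
  exact: cond_large.
rewrite ler_piMr ?exprn_ge0 ?(ltW (rho_gt0 R)) // (eq_Ex x (g := fun S => (typical S v)%:R)).
  exact: Pr_le1.
by move=> S; rewrite mulr1.
Qed.

(** A free neighbour is occupied with probability 1/2, so given the side of [v] the absence of
    occupied neighbours has probability at most 1/2, hence at most that of its complement. *)
Lemma Pr_zero_typical v :
  Pr (fun S => [&& (0 < na S v)%N, typical S v & kk S v == 0%N]) <=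
  Pr (fun S => [&& (0 < na S v)%N, typical S v & (0 < kk S v)%N]).
Proof.
have vb : v \in side d (par v) by rewrite in_side.
pose psi S := (0 < na S v)%N && typical S v.
have e (Q : {set cube d} -> bool) :
    Pr (fun S => [&& (0 < na S v)%N, typical S v & Q S]) = Ex (fun S => (psi S)%:R * (Q S)%:R).
  by apply: eq_Ex => S; rewrite -natrM mulnb andbA.
rewrite !e -[leRHS]mul1r; apply: (Ex_cond (b := par v) x_gt0).
  by move=> S; rewrite /psi (typical_side _ vb) (na_side _ vb).
move=> E Eb /andP[n0 _]; rewrite mul1r.
have h := cond_zero Eb vb.
have h2 : \sum_(O in powerset (side d (~~ par v))) wt (E :|: O) =
   \sum_(O in powerset (side d (~~ par v))) wt (E :|: O) * (kk (E :|: O) v == 0%N)%:R +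
   \sum_(O in powerset (side d (~~ par v))) wt (E :|: O) * (0 < kk (E :|: O) v)%N%:R.
  rewrite -big_split; apply: eq_bigr => O _; rewrite /= -mulrDr -natrD lt0n.
  by case: eqP; rewrite mulr1.
have h0 : 0 <= \sum_(O in powerset (side d (~~ par v))) wt (E :|: O).
  by apply: sumr_ge0 => O _; exact: wt_ge0.
have h3 : 2^-1 ^+ na E v * \sum_(O in powerset (side d (~~ par v))) wt (E :|: O) <=
   2^-1 * \sum_(O in powerset (side d (~~ par v))) wt (E :|: O).
  rewrite ler_wpM2r // -[leRHS]expr1 ler_wiXn2l // ?invr_ge0 // invf_le1 // ler1n //.
rewrite h2 in h h3; move: (le_trans h h3); clear.
set a := \sum_(_ in _) _; set c := \sum_(_ in _) _; lra.
Qed.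

Lemma Pr_zero_many v :
  Pr (fun S => (3 * d < 5 * na S v)%N && (kk S v == 0%N)) <= rho ^+ d.
Proof.
have vb : v \in side d (par v) by rewrite in_side.
rewrite /Pr (eq_Ex x (g := fun S => (3 * d < 5 * na S v)%N%:R * (kk S v == 0%N)%:R)); last first.
  by move=> S; rewrite -natrM mulnb.
apply: (le_trans (Ex_cond (b := par v) (g := fun=> 1) (c := rho ^+ d) x_gt0 _ _)).
- by move=> S; rewrite (na_side _ vb).
- move=> E Eb h; under [in leRHS]eq_bigr => O _ do rewrite mulr1.
  apply: (le_trans (cond_zero Eb vb)); rewrite ler_wpM2r //.
    by apply: sumr_ge0 => O _; exact: wt_ge0.
  have r0 : 0 <= rho := ltW (rho_gt0 R).
  rewrite -(@ler_pXn2r _ 5) ?nnegrE ?exprn_ge0 ?invr_ge0 // -!exprM.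
  apply: (le_trans (y := 2^-1 ^+ (3 * d))).
    rewrite ler_wiXn2l ?invr_ge0 ?invf_le1 ?ler1n //; first by lia.
  rewrite [(d * 5)%N]mulnC !exprM lerXn2r ?nnegrE ?exprn_ge0 ?invr_ge0 //.
  by rewrite rhoE; lra.
rewrite ler_piMr ?exprn_ge0 ?(ltW (rho_gt0 R)) // (eq_Ex x (g := fun S => (3 * d < 5 * na S v)%N%:R)).
  exact: Pr_le1.
by move=> S; rewrite mulr1.
Qed.

Definition p00 m : R := Pr (fun S => (kk S orig == 0%N) && (kk S (flip orig m) == 0%N)).

Lemma Pr00 u m : Pr (fun S => (kk S u == 0%N) && (kk S (flip u m) == 0%N)) = p00 m.
Proof.
rewrite /p00 -(Pr_xshift x u (fun S => (kk S orig == 0%N) && (kk S (flip orig m) == 0%N))); apply: eq_Ex => S.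
by rewrite !kk_xshift flip_xorc orig_xorc.
Qed.

(** If both ends see nothing, then [orig] has a free neighbour. In the typical case
    [Pr_zero_typical] trades seeing nothing for seeing something, and that means being bad or having
    many occupied neighbours. The atypical case has too many bad neighbours (Markov) or too many
    free ones. *)
Lemma p00_le m : p00 m <= 51 * pbad + 2 * rho ^+ d.
Proof.
apply: (le_trans (y := Pr (fun S => [&& (0 < na S orig)%N, typical S orig & kk S orig == 0%N]) +
  (Pr (fun S => (d < 50 * nbad S orig)%N) +
   Pr (fun S => (3 * d < 5 * na S orig)%N && (kk S orig == 0%N))))).
  apply: (le_trans (Pr_le2 (Q1 := fun S => [&& (0 < na S orig)%N, typical S orig & kk S orig == 0%N])
     (Q2 := fun S => (d < 50 * nbad S orig)%N || ((3 * d < 5 * na S orig)%N && (kk S orig == 0%N))) x_gt0 _)).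
    move=> S /andP[k0 k1].
    have -> : (0 < na S orig)%N by apply/card_gt0P; exists m; rewrite inE.
    rewrite k0 /typical !andbT /=.
    by case: (leqP (5 * _)) => //= _; case: leqP.
  rewrite lerD2l; exact: Pr_le2.
have h1 := Pr_zero_typical orig.
have h2 : Pr (fun S => [&& (0 < na S orig)%N, typical S orig & (0 < kk S orig)%N]) <=
   pbad + rho ^+ d.
  apply: (le_trans (Pr_le2 (Q1 := fun S => bad S orig)
     (Q2 := fun S => typical S orig && (2 * d < 5 * kk S orig)%N) x_gt0 _)).
    by move=> S /and3P[_ -> k0]; rewrite /bad k0 /=; case: leqP.
  by rewrite lerD2l; exact: Pr_typical_large.
have h3 := Pr_nbad orig; have h4 := Pr_zero_many orig.
move: h1 h2 h3 h4; set a := Pr _; set c := Pr _; set e := Pr _; set f := Pr _.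
by move: pbad (rho ^+ d) => y z; lra.
Qed.

Lemma Pr_pos_few v : Pr (fun S => (0 < kk S v)%N && (5 * na S v <= 3 * d)%N) <=
  51 * pbad + rho ^+ d.
Proof.
apply: (le_trans (y := Pr (fun S => bad S v) +
  (Pr (fun S => (d < 50 * nbad S v)%N) + Pr (fun S => typical S v && (2 * d < 5 * kk S v)%N)))).
  apply: (le_trans (Pr_le2 (Q1 := fun S => bad S v)
     (Q2 := fun S => (d < 50 * nbad S v)%N || (typical S v && (2 * d < 5 * kk S v)%N)) x_gt0 _)).
    move=> S /andP[k0 k1]; rewrite /bad /typical k0 k1 /=.
    by case: (leqP (5 * kk S v)) => //= _; case: leqP.
  rewrite lerD2l; exact: Pr_le2.
have h1 := Pr_typical_large v; have h2 := Pr_nbad v.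
move: h1 h2; rewrite Pr_bad; set a := Pr _; set c := Pr _.
by move: pbad (rho ^+ d) => y z; lra.
Qed.

Definition pflat m : R := Pr (fun S => (0 < kk S orig)%N == (0 < kk S (flip orig m))%N).

Lemma Pr_flat u m : Pr (fun S => (0 < kk S u)%N == (0 < kk S (flip u m))%N) = pflat m.
Proof.
rewrite /pflat -(Pr_xshift x u (fun S => (0 < kk S orig)%N == (0 < kk S (flip orig m))%N)); apply: eq_Ex => S.
by rewrite !kk_xshift flip_xorc orig_xorc.
Qed.

(** If both ends see something, each probably has more than 3d/5 free neighbours. Two such sets of
    directions share at least d/5 of them, and each shared direction gives a parallel edge both of
    whose ends see nothing; Markov's inequality reduces this to [p00]. *)
Lemma p11_le m : Pr (fun S => (0 < kk S orig)%N && (0 < kk S (flip orig m))%N) <=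
  2 * (51 * pbad + rho ^+ d) + 5 * p00 m.
Proof.
pose v := orig; pose w := flip orig m.
pose c S := #|[set i | (kk S (flip v i) == 0%N) && (kk S (flip (flip v i) m) == 0%N)]|.
apply: (le_trans (y := Pr (fun S => (0 < kk S v)%N && (5 * na S v <= 3 * d)%N) +
  (Pr (fun S => (0 < kk S w)%N && (5 * na S w <= 3 * d)%N) + Pr (fun S => (d <= 5 * c S)%N)))).
  apply: (le_trans (Pr_le2 (Q1 := fun S => (0 < kk S v)%N && (5 * na S v <= 3 * d)%N)
     (Q2 := fun S => ((0 < kk S w)%N && (5 * na S w <= 3 * d)%N) || (d <= 5 * c S)%N) x_gt0 _)).
    move=> S /andP[k0 k1]; rewrite k0 /w k1 /= -/w.
    case: leqP => //= av; case: leqP => //= aw.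
    pose A1 := [set i | kk S (flip v i) == 0%N]; pose A2 := [set i | kk S (flip w i) == 0%N].
    have -> : c S = #|A1 :&: A2|.
      by apply: eq_card => i; rewrite !inE /w flipC.
    have := cardsUI A1 A2; have : (#|A1 :|: A2| <= d)%N.
      by rewrite -[leqRHS]card_ord max_card.
    rewrite -/(na S v) in av; move: av aw; rewrite /na -/A1 -/A2; lia.
  rewrite lerD2l; exact: Pr_le2.
have h1 := Pr_pos_few v; have h2 := Pr_pos_few w.
have h3 : Pr (fun S => (d <= 5 * c S)%N) <= 5 * p00 m.
  have d0 : 0 < d%:R :> R by rewrite ltr0n (leq_trans _ d_ge).
  rewrite -(ler_pM2l d0).
  apply: (le_trans (Pr_markov (f := fun S => 5 * (c S)%:R) x_gt0 d0 _ _)).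
  - by move=> S; rewrite mulr_ge0.
  - by move=> S h; rewrite -natrM ler_nat.
  rewrite ExZ [leRHS]mulrCA; apply: ler_wpM2l => //.
  rewrite (eq_Ex x (g := fun S => \sum_(i < d) ((kk S (flip v i) == 0%N) && (kk S (flip (flip v i) m) == 0%N))%:R)); last first.
    move=> S; rewrite /c -sum1_card natr_sum big_mkcond /=.
    by apply: eq_bigr => i _; rewrite inE; case: andb.
  rewrite Ex_sum (eq_bigr (fun=> p00 m)); last by move=> i _; exact: Pr00.
  by rewrite sumr_const card_ord mulr_natl.
move: h1 h2 h3; set a := Pr _; set e := Pr _; set f := Pr _; set q := p00 m.
by move: pbad (rho ^+ d) => y z; lra.
Qed.

Lemma pflat_le m : pflat m <= 408 * pbad + 14 * rho ^+ d.
Proof.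
apply: (le_trans (Pr_le2 (Q1 := fun S => (kk S orig == 0%N) && (kk S (flip orig m) == 0%N))
  (Q2 := fun S => (0 < kk S orig)%N && (0 < kk S (flip orig m))%N) x_gt0 _)).
  by move=> S; case: (kk S orig) => [|?]; case: (kk S (flip _ _)).
rewrite -/(p00 m); have h1 := p11_le m; have h2 := p00_le m.
move: h1 h2; set a := Pr _; set q := p00 m.
by move: pbad (rho ^+ d) => y z; lra.
Qed.

End Local.

(** * A Finner-type product inequality for the sequential kernel *)

Section GeometricMean.
Variables (R : realType) (I : finType) (A : {set I}).
Implicit Types a b y : I -> R.
Hypothesis A_gt0 : (0 < #|A|)%N.
Local Notation n := (#|A|%:R : R).

Lemma geometric_le_arithmetic y : (forall i, 0 < y i) ->
  expR (n^-1 * \sum_(i in A) ln (y i)) <= n^-1 * \sum_(i in A) y i.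
Proof.
move=> y0; have n0 : 0 < n by rewrite ltr0n.
set M := (X in _ <= X).
have M0 : 0 < M.
  rewrite mulr_gt0 ?invr_gt0 //; have /card_gt0P[i iA] := A_gt0.
  by rewrite (bigD1 i) //=; apply: ltr_pwDl => //; apply: sumr_ge0 => j _; exact: ltW.
rewrite -[leRHS]lnK ?posrE // ler_expR.
have h i : ln (y i) <= ln M + (M^-1 * y i - 1).
  have yM : 0 < M^-1 * y i by rewrite mulr_gt0 ?invr_gt0.
  have : ln (M^-1 * y i) <= M^-1 * y i - 1.
    by have := @le_ln1Dx R (M^-1 * y i - 1); rewrite [1 + _]addrC subrK; apply; rewrite ltrBrDr addNr.
  by rewrite lnM ?posrE ?invr_gt0 // lnV ?posrE //; lra.
rewrite mulrC ler_pdivrMr //; apply: (le_trans (ler_sum _ (fun i _ => h i))).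
rewrite big_split /= sumrB -mulr_sumr !sumr_const.
have -> : \sum_(i in A) y i = n * M by rewrite /M mulrA divff ?mul1r ?gt_eqF.
by rewrite mulrCA mulVf ?gt_eqF // mulr1 subrr addr0 mulr_natr.
Qed.

(** Mahler's inequality: apply the arithmetic-geometric inequality to a/(a+b) and to b/(a+b), whose
    arithmetic means add up to 1. *)
Lemma geometric_superadditive a b : (forall i, 0 < a i) -> (forall i, 0 < b i) ->
  expR (n^-1 * \sum_(i in A) ln (a i)) + expR (n^-1 * \sum_(i in A) ln (b i)) <=
  expR (n^-1 * \sum_(i in A) ln (a i + b i)).
Proof.
move=> a0 b0; have n0 : 0 < n by rewrite ltr0n.
have ab0 i : 0 < a i + b i by rewrite addr_gt0.
have frac y : (forall i, 0 < y i) ->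
    expR (n^-1 * \sum_(i in A) ln (y i)) <= expR (n^-1 * \sum_(i in A) ln (a i + b i)) *
      (n^-1 * \sum_(i in A) (y i / (a i + b i))).
  move=> y0; have := @geometric_le_arithmetic (fun i => y i / (a i + b i)).
  move=> /(_ (fun i => divr_gt0 (y0 i) (ab0 i))).
  rewrite -(ler_pM2l (expR_gt0 (n^-1 * \sum_(i in A) ln (a i + b i)))) -expRD -mulrDr.
  rewrite -big_split /= => h; apply: le_trans h; rewrite le_eqVlt; apply/orP; left.
  apply/eqP; congr (expR (_ * _)); apply: eq_bigr => i _.
  by rewrite -lnM ?posrE ?divr_gt0 // mulrCA divff ?mulr1 ?gt_eqF.
apply: (le_trans (lerD (frac _ a0) (frac _ b0))).
have s1 : \sum_(i in A) (a i / (a i + b i) + b i / (a i + b i)) = n.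
  rewrite (eq_bigr (fun=> 1)) ?sumr_const // => i _.
  by rewrite -mulrDl divff // gt_eqF.
by rewrite -mulrDr -mulrDr -big_split /= s1 mulVf ?mulr1 // gt_eqF.
Qed.

End GeometricMean.

Section Chain.
Variables (R : realType) (d : nat) (e : R) (rk : nat -> R).
Hypotheses (d_gt0 : (0 < d)%N) (e_gt0 : 0 < e) (e_lt1 : e < 1).
Hypotheses (rk0 : rk 0%N = 1) (rk_gt0 : forall k, 0 < rk k).
Hypothesis rk_sum : \sum_(I : {set 'I_d} | I != finset.set0) rk #|I| = 1.
Implicit Types (u v t w : cube d) (i j m : 'I_d) (S A B O E D : {set cube d}) (b : bool).

Definition hw v : nat := #|[set i | v i]|.
Definition low w : cube d := if [pick i | w i] is Some i then flip w i else w.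
Definition prevv w := low (low (low (low w))).

(* [nbker w] is a conditional law for [S :&: nb w] given whether [prevv w], four levels below, has a
   neighbour in [S]: the indicator is copied with probability [1 - e], then the neighbours are drawn
   from [rk]. It is the reference law to which Gibbs' inequality is applied. *)
Definition cpl w S : R :=
  if (4 <= hw w)%N then (if (0 < kk S w)%N == (0 < kk S (prevv w))%N then 1 - e else e)
  else 2^-1.
Definition nbker w S : R := cpl w S * rk (kk S w).
(** The kernel at [w] once the vertices outside [D] are summed out; [E] is the configuration left on
    [D]. *)
Definition mass D w E : R := \sum_(B in powerset (nb w :\: D)) nbker w (E :|: B).

Lemma cpl_gt0 w S : 0 < cpl w S.
Proof. by rewrite /cpl; do 2 case: ifP => // _; rewrite ?subr_gt0 // invr_gt0. Qed.

Lemma nbker_gt0 w S : 0 < nbker w S.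
Proof. by rewrite mulr_gt0 ?cpl_gt0. Qed.

Lemma mass_gt0 D w E : 0 < mass D w E.
Proof.
rewrite /mass (bigD1 finset.set0) ?powersetE ?sub0set //= ltr_pwDl ?nbker_gt0 //.
by apply: sumr_ge0 => B _; exact/ltW/nbker_gt0.
Qed.

Lemma hw_flip_true w i : w i -> hw w = (hw (flip w i)).+1.
Proof.
move=> wi; rewrite /hw (cardsD1 i) inE wi add1n; congr S; apply: eq_card => j.
by rewrite !inE ffunE; case: eqP => [->|_]; rewrite ?wi // addbF.
Qed.

Lemma hw_flip_false w i : ~~ w i -> hw (flip w i) = (hw w).+1.
Proof.
by move=> wi; rewrite (@hw_flip_true (flip w i) i) ?flipK // ffunE eqxx addbT.
Qed.

Lemma hw_flip_le w i : (hw (flip w i) <= (hw w).+1)%N.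
Proof. by case: (boolP (w i)) => [/hw_flip_true|/hw_flip_false] ->; lia. Qed.

Lemma hw_flip_ge w i : (hw w <= (hw (flip w i)).+1)%N.
Proof. by rewrite -{1}(flipK i w) hw_flip_le. Qed.

Lemma hw_low w : hw (low w) = (hw w).-1.
Proof.
rewrite /low; case: pickP => [i wi|w0]; first by rewrite (hw_flip_true wi).
have -> : hw w = 0%N by apply: eq_card0 => i; rewrite inE w0.
by [].
Qed.

Lemma hw_prevv w : hw (prevv w) = (hw w - 4)%N.
Proof. by rewrite /prevv !hw_low; lia. Qed.

Lemma hw_nb w u : u \in nb w -> (hw u <= (hw w).+1)%N /\ (hw w <= (hw u).+1)%N.
Proof. by case/imsetP => i _ ->; split; [exact: hw_flip_le | exact: hw_flip_ge]. Qed.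

Lemma kk_card_nb S w : kk S w = #|nb w :&: S|.
Proof.
rewrite /kk -(card_imset _ (@flip_inj d w)); apply: eq_card => u; rewrite in_setI.
apply/imsetP/andP => [[i]|[/imsetP[i _ ->] iS]]; last by exists i; rewrite ?inE.
by rewrite inE => iS ->; rewrite imset_f.
Qed.

Lemma kk_eq S T w : nb w :&: S = nb w :&: T -> kk S w = kk T w.
Proof. by move=> h; rewrite !kk_card_nb h. Qed.

Lemma sum_powerset_nb w (G : nat -> R) :
  \sum_(B in powerset (nb w)) G #|B| = \sum_(I : {set 'I_d}) G #|I|.
Proof.
rewrite (reindex_onto (fun I : {set 'I_d} => flip w @: I) (fun B => [set i | flip w i \in B])) /=.
  apply: eq_big => I.
    have -> : flip w @: I \in powerset (nb w).
      by rewrite powersetE; apply/subsetP => _ /imsetP[i _ ->]; rewrite imset_f.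
    rewrite /=; apply/eqP/setP => i; rewrite inE; apply/imsetP/idP => [[j jI /flip_inj ->] //|iI].
    by exists i.
  by move=> _; rewrite card_imset //; exact: flip_inj.
move=> B; rewrite powersetE => /subsetP sB; apply/setP => u; apply/imsetP/idP => [[i]|uB].
  by rewrite inE => iB ->.
by have /imsetP[i _ uE] := sB u uB; exists i; rewrite ?inE -?uE.
Qed.

(** Neighbours of [prevv w] lie strictly below those of [w], so the bit to be copied is already
    fixed by [E]; both values of the new bit then have total mass one under [rk]. *)
Lemma sum_nbker_nb w E : E :&: nb w = finset.set0 ->
  \sum_(B in powerset (nb w)) nbker w (E :|: B) = 1.
Proof.
move=> EN.
have kB B : B \in powerset (nb w) -> kk (E :|: B) w = #|B|.
  rewrite powersetE => sB; rewrite kk_card_nb setIUr [nb w :&: E]setIC EN set0U.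
  by rewrite (setIidPr sB).
have e1 (G : nat -> R) : G 0%N * rk 0%N + \sum_(I : {set 'I_d} | I != finset.set0) G 1%N * rk #|I| =
    G 0%N + G 1%N by rewrite rk0 mulr1 -mulr_sumr rk_sum mulr1.
pose H (G : nat -> R) (k : nat) := (if k == 0%N then G 0%N else G 1%N) * rk k.
have e2 (G : nat -> R) : \sum_(B in powerset (nb w)) H G #|B| = G 0%N + G 1%N.
  rewrite sum_powerset_nb -e1 (bigD1 finset.set0) //= cards0 {1}/H eqxx; congr +%R.
  by apply: eq_bigr => I I0; rewrite /H cards_eq0 (negPf I0).
case: (leqP 4 (hw w)) => hw4.
  pose tau := (0 < kk E (prevv w))%N.
  transitivity (\sum_(B in powerset (nb w))
     H (fun k => if (0 < k)%N == tau then 1 - e else e) #|B|).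
    apply: eq_bigr => B sB; rewrite /nbker /H /cpl hw4 (kB B sB).
    have -> : kk (E :|: B) (prevv w) = kk E (prevv w).
      apply: kk_eq; rewrite setIUr; apply/setUidPl.
      apply: (subset_trans _ (sub0set _)).
      apply/subsetP => u; rewrite in_setI => /andP[/hw_nb[h1 _] uB].
      move: sB; rewrite powersetE => /subsetP /(_ u uB) /hw_nb[_ h2].
      by move: h1 h2; rewrite hw_prevv; lia.
    by rewrite -/tau; case: #|B|.
  rewrite e2 /=; case: tau => /=; lra.
transitivity (\sum_(B in powerset (nb w)) H (fun=> 2^-1) #|B|).
  by apply: eq_bigr => B sB; rewrite /nbker /H /cpl leqNgt hw4 (kB B sB) if_same.
by rewrite e2; lra.
Qed.

Lemma mass_insert D v w E : v \in D -> E \subset D :\ v -> v \in nb w ->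
  mass (D :\ v) w E = mass D w E + mass D w (v |: E).
Proof.
move=> vD ED vw; rewrite /mass.
have vN : v \in nb w :\: (D :\ v) by rewrite !inE eqxx vw.
have -> : nb w :\: D = (nb w :\: (D :\ v)) :\ v.
  by apply/setP => u; rewrite !inE; case: eqP => [->|_]; rewrite ?vD.
rewrite (big_powersetD1 _ vN) -big_split /=; apply: eq_bigr => B _.
by congr (_ + nbker w _); rewrite setUCA setUA.
Qed.

(** If [v] is a neighbour of [prevv w], maximality of its weight leaves no neighbour of [w] in [D],
    and all the masses equal 1. Otherwise the kernel at [w] does not look at [v]. *)
Lemma mass_stable D v w E : v \in D -> E \subset D :\ v -> v \notin nb w ->
  (forall u, u \in D -> (hw u <= hw v)%N) ->
  mass D w (v |: E) = mass D w E /\ mass (D :\ v) w E = mass D w E.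
Proof.
move=> vD ED vw vmax.
have ND : nb w :\: (D :\ v) = nb w :\: D.
  apply/setP => u; rewrite !inE; case: eqP => [->|//].
  by rewrite (negPf vw) !andbF.
split; last by rewrite /mass ND.
have kw B : kk ((v |: E) :|: B) w = kk (E :|: B) w.
  apply: kk_eq; rewrite -setUA [LHS]setIUr; apply/setUidPr; apply: (subset_trans _ (sub0set _)).
  by apply/subsetP => u; rewrite !inE andbC => /andP[/eqP-> h]; rewrite h in vw.
case: (boolP ((4 <= hw w)%N && (v \in nb (prevv w)))) => [/andP[h4 vp]|h].
  have NwD : nb w :&: D = finset.set0.
    apply/eqP; rewrite -subset0; apply/subsetP => u; rewrite in_setI => /andP[/hw_nb[_ h1] /vmax h2].
    by have [h3 _] := hw_nb vp; move: h1 h2 h3; rewrite hw_prevv; lia.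
  have NE A : A \subset D -> A :&: nb w = finset.set0.
    by move=> sA; apply/eqP; rewrite -subset0 -NwD setIC setIS.
  have -> : mass D w = fun A => \sum_(B in powerset (nb w)) nbker w (A :|: B).
    by rewrite /mass -[nb w :\: D]/(nb w :\: D) setDE; congr (fun _ => _);
       rewrite (_ : nb w :&: ~: D = nb w) //; apply/setIidPl; rewrite -disjoints_subset -setI_eq0 NwD.
  have sE : E \subset D by apply: subset_trans ED (subsetDl _ _).
  by rewrite !sum_nbker_nb // NE // subUset sub1set vD.
apply: eq_bigr => B _; rewrite /nbker /cpl kw; case: (boolP (4 <= hw w)%N) h => //= _ vp.
congr (_ * _); congr (if _ == (0 < _)%N then _ else _).
apply: kk_eq; rewrite -setUA [LHS]setIUr; apply/setUidPr; apply: (subset_trans _ (sub0set _)).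
by apply/subsetP => u; rewrite !inE andbC => /andP[/eqP-> h]; rewrite h in vp.
Qed.

(* Summing out the vertices by decreasing Hamming weight guarantees that once a vertex of
   [nb (prevv w)] is reached, all of [nb w] has been summed, so [mass D w] is already 1. *)
Lemma chain_le1 D : D \subset side d false ->
  \sum_(E in powerset D) expR (d%:R^-1 * \sum_(w in side d true) ln (mass D w E)) <= 1.
Proof.
have [n] := ubnP #|D|; elim: n D => // n IH D; rewrite ltnS => cD DE.
have [->|/set0Pn[v0 v0D]] := eqVneq D finset.set0.
  rewrite powerset0 big_set1 big1 ?mulr0 ?expR0 // => w _.
  rewrite /mass setD0 (eq_bigr (fun B => nbker w (finset.set0 :|: B))) //.
  by rewrite sum_nbker_nb ?ln1 // set0I.
pose v := [arg max_(u > v0 in D) hw u].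
have [vD vmax] : v \in D /\ forall u, u \in D -> (hw u <= hw v)%N.
  by rewrite /v; case: arg_maxnP.
have vs : v \in side d false by exact: (subsetP DE).
have nbs : nb v \subset side d true by exact: (nb_side vs).
apply: le_trans (IH (D :\ v) _ _); last 2 first.
- by move: cD; rewrite (cardsD1 v D) vD.
- exact: subset_trans (subsetDl _ _) DE.
rewrite (big_powersetD1 _ vD); apply: ler_sum => E; rewrite powersetE => ED.
have split_sum A C : \sum_(w in side d true) ln (mass A w C) =
    \sum_(w in nb v) ln (mass A w C) + \sum_(w in side d true :\: nb v) ln (mass A w C).
  by rewrite (big_setID (nb v)) /= (setIidPr nbs).
have st w : w \in side d true :\: nb v ->
    mass D w (v |: E) = mass D w E /\ mass (D :\ v) w E = mass D w E.
  rewrite inE nb_sym => /andP[vw _]; exact: mass_stable.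
rewrite !split_sum !mulrDr !expRD.
rewrite [X in _ + _ * expR (_ * X) <= _](eq_bigr (fun w => ln (mass D w E))); last first.
  by move=> w /st[-> _].
rewrite [X in _ <= _ * expR (_ * X)](eq_bigr (fun w => ln (mass D w E))); last first.
  by move=> w /st[_ ->].
rewrite -mulrDl ler_pM2r ?expR_gt0 //.
rewrite [X in _ <= expR (_ * X)](eq_bigr (fun w => ln (mass D w E + mass D w (v |: E)))); last first.
  by move=> w; rewrite nb_sym => vw; rewrite mass_insert.
(* Finner's condition: [v] matters to exactly d factors, each raised to the power 1/d. *)
have := @geometric_superadditive R _ (nb v) _ (fun w => mass D w E) (fun w => mass D w (v |: E)).
by rewrite card_nb; apply => // w; exact: mass_gt0.
Qed.

Lemma sum_nbker_le1 :
  \sum_(E in powerset (side d false))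
     expR (d%:R^-1 * \sum_(w in side d true) ln (nbker w E)) <= 1.
Proof.
apply: le_trans (chain_le1 (subxx _)); rewrite le_eqVlt; apply/orP; left; apply/eqP.
apply: eq_bigr => E _; congr (expR (_ * _)); apply: eq_bigr => w ws.
rewrite /mass (_ : nb w :\: _ = finset.set0) ?powerset0 ?big_set1 ?setU0 //.
by apply/eqP; rewrite setD_eq0; exact: (nb_side ws).
Qed.

End Chain.

(** * Gibbs' inequality against the reference kernel *)

Lemma ln_prod (R : realType) (I : Type) (r : seq I) (P : pred I) (F : I -> R) :
  (forall i, 0 < F i) -> ln (\prod_(i <- r | P i) F i) = \sum_(i <- r | P i) ln (F i).
Proof.
move=> F0; have [] : 0 < \prod_(i <- r | P i) F i /\
    ln (\prod_(i <- r | P i) F i) = \sum_(i <- r | P i) ln (F i); last by [].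
elim/big_rec2: _ => [|i y1 y2 _ [y0 <-]]; first by rewrite ln1.
by rewrite mulr_gt0 // lnM ?posrE.
Qed.

Section Entropy.
Variables (R : realType) (x e : R) (rk : nat -> R) (d : nat).
Hypotheses (x_gt0 : 0 < x) (x_le : x <= 3^-1) (d_gt0 : (0 < d)%N) (e_gt0 : 0 < e) (e_lt1 : e < 1).
Hypotheses (rk0 : rk 0%N = 1) (rk_gt0 : forall k, 0 < rk k).
Hypothesis rk_sum : \sum_(I : {set 'I_d} | I != finset.set0) rk #|I| = 1.
Implicit Types (u v t w : cube d) (i j m : 'I_d) (S A B O E D : {set cube d}) (b : bool).
Local Notation nbker := (@nbker R d e rk).
Local Notation Ex := (@Ex R x d).
Local Notation Pr := (@Pr R x d).

Lemma par_low w : (0 < hw w)%N -> par (low w) = ~~ par w.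
Proof.
rewrite /low; case: pickP => [i _ _|w0]; first exact: par_flip.
by rewrite /hw (eq_card0 (A := [set i | w i])) // => i; rewrite inE w0.
Qed.

Lemma par_prevv w : (4 <= hw w)%N -> par (prevv w) = par w.
Proof. by move=> h; rewrite /prevv !par_low ?hw_low ?negbK //; lia. Qed.

Lemma nbker_union w E O : E \subset side d false -> O \subset side d true ->
  w \in side d true -> nbker w (E :|: O) = nbker w E.
Proof.
move=> Es Os ws; have ke u : u \in side d true -> kk (E :|: O) u = kk E u.
  by move=> us; rewrite setUC (kk_union (b := true)).
rewrite /nbker /cpl (ke w ws); case: ifP => // h.
by rewrite ke // in_side par_prevv // -in_side.
Qed.

(** The even part of [S] has law Om / Z, and q, the product of the kernels to the power 1/d, has
    total mass at most 1 by [sum_nbker_le1]. Nonnegativity of the relative entropy of Om / Z to q is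
    the claim. *)
Lemma gibbs_bound : ln (Zpart x d) <=
  Ex (fun S => \sum_(w in side d true) (ln (1 + x ^+ kk S w) - d%:R^-1 * ln (nbker w S))).
Proof.
pose Om E := \prod_(w in side d true) (1 + x ^+ kk E w).
pose f E := \sum_(w in side d true) (ln (1 + x ^+ kk E w) - d%:R^-1 * ln (nbker w E)).
pose q E := expR (d%:R^-1 * \sum_(w in side d true) ln (nbker w E)).
have Z0 := Zpart_gt0 d x_gt0.
have pos E w : 0 < 1 + x ^+ kk E w by rewrite ltr_pwDl // exprn_ge0 // ltW.
have Om0 E : 0 < Om E by apply: prodr_gt0.
have fU E O : E \subset side d false -> O \subset side d true -> f (E :|: O) = f E.
  move=> Es Os; apply: eq_bigr => w ws.
  by rewrite nbker_union // setUC (kk_union (b := true)).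
have ZE : Zpart x d = \sum_(E in powerset (side d false)) Om E.
  rewrite /Zpart (big_side _ false) /=; apply: eq_bigr => E; rewrite powersetE => Es.
  exact: (sum_wt_side1 x Es).
have ExE : Ex f = \sum_(E in powerset (side d false)) Om E / Zpart x d * f E.
  rewrite /Ex (big_side _ false) /= mulr_suml; apply: eq_bigr => E; rewrite powersetE => Es.
  rewrite [RHS]mulrAC; congr (_ / _).
  rewrite /Om -(sum_wt_side1 x Es) mulr_suml; apply: eq_bigr => O.
  by rewrite powersetE => Os; rewrite fU.
rewrite -/(f _) -/f ExE.
have fE E : f E = ln (Om E) - ln (q E).
  rewrite /q expRK /f sumrB -mulr_sumr; congr (_ - _); rewrite /Om.
  by rewrite ln_prod.
(* Pointwise form P ln(q/P) <= q - P, summed over [E] below. *)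
have h E : Om E / Zpart x d * ln (Zpart x d) - Om E / Zpart x d * f E <= q E - Om E / Zpart x d.
  have P0 : 0 < Om E / Zpart x d by rewrite divr_gt0.
  have q0 : 0 < q E by exact: expR_gt0.
  have y0 : 0 < q E / (Om E / Zpart x d) by rewrite divr_gt0.
  have l1 : ln (q E / (Om E / Zpart x d)) <= q E / (Om E / Zpart x d) - 1.
    have := @le_ln1Dx R (q E / (Om E / Zpart x d) - 1); rewrite [1 + _]addrC subrK; apply.
    by rewrite ltrBrDr addNr.
  have l2 : ln (q E / (Om E / Zpart x d)) = ln (Zpart x d) - f E.
    rewrite lnM ?posrE ?invr_gt0 // lnV ?posrE // lnM ?posrE ?invr_gt0 // lnV ?posrE //.
    by rewrite fE; lra.
  rewrite -mulrBr -l2; apply: (le_trans (ler_wpM2l (ltW P0) l1)).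
  by rewrite mulrBr mulr1 mulrCA divff ?mulr1 // gt_eqF.
have hs := ler_sum (P := fun E => E \in powerset (side d false)) (index_enum _) (fun E _ => h E).
rewrite -subr_le0; move: hs; rewrite !sumrB -!mulr_suml -ZE divff ?gt_eqF // mul1r => hs.
apply: (le_trans hs); rewrite subr_le0.
exact: (@sum_nbker_le1 R d e rk d_gt0 e_gt0 e_lt1 rk0 rk_gt0 rk_sum).
Qed.

End Entropy.

(** * The reference law of the number of occupied neighbours *)

Lemma chernoff_low (R : realType) (I : finType) (y : R) (a b : nat) : 0 < y -> y <= 1 ->
  (#|[set B : {set I} | (a * #|B| <= b)%N]|)%:R * y ^+ b <= (1 + y ^+ a) ^+ #|I|.
Proof.
move=> y0 y1.
have -> : (1 + y ^+ a) ^+ #|I| = \sum_(B : {set I}) (y ^+ a) ^+ #|B|.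
  have := @sum_powerset_prod R I [set: I] (fun=> y ^+ a).
  rewrite prodr_const cardsT => <-; apply: eq_big => [B|B _]; first by rewrite powersetE finset.subsetT.
  by rewrite prodr_const.
rewrite mulr_natl -sumr_const [leRHS](bigID (mem [set B : {set I} | (a * #|B| <= b)%N])) /=.
rewrite -[leLHS]addr0; apply: lerD; last first.
  by apply: sumr_ge0 => B _; rewrite !exprn_ge0 // ltW.
apply: ler_sum => B; rewrite inE => aB; rewrite -exprM; apply: ler_wiXn2l => //; exact: ltW.
Qed.

(** Equal to 1 / (1 - 1/200), so that ln(1 + t) <= t at t = -1/200 yields a gain of 1/200 per
    coordinate, yet so close to 1 that the tilted sets remain negligible in [Zref]. *)
Definition tiltc (R : realType) : R := locked (200 / 199).

Lemma tiltc_ge1 (R : realType) : 1 <= tiltc R.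
Proof. by rewrite /tiltc -lock; lra. Qed.

(** Here y1 and y2 are Chernoff parameters for subsets with at most 2d/5 and at most d/10 elements.
    For sizes k >= 11 the base 1 + x^k is at most c, and always at most 4/3; the last two lines make
    each tilted class at most (2 rho)^d. *)
Lemma reference_constants (R : realType) : exists y1 y2 c : R,
  [/\ [/\ 0 < y1, y1 <= 1, 0 < y2, y2 <= 1 & 0 <= c],
      1 + 3^-1 ^+ 11 <= c,
      tiltc R * c * (1 + y1 ^+ 5) <= 2 * rho R * y1 ^+ 2 &
      tiltc R * (4 / 3) * (1 + y2 ^+ 10) <= 2 * rho R * y2].
Proof.
exists (922 / 1000), (8 / 10), (1 + 10^-1 ^+ 4).
rewrite /tiltc -lock rhoE; split; [split; lra | | lra | lra].
by rewrite lerD2l; lra.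
Qed.

Section Reference.
Variables (R : realType) (x : R) (d : nat).
Hypotheses (x_gt0 : 0 < x) (x_le : x <= 3^-1) (d_ge : (100 <= d)%N).
Implicit Types (u v t w : cube d) (i j m : 'I_d) (S A B O E D : {set cube d}) (b : bool) (I : {set 'I_d}).
Local Notation Ex := (@Ex R x d).
Local Notation Pr := (@Pr R x d).

(* The tilt of [few] degrees is what makes the entropy bound charge every vertex that is [bad]. *)
Definition tilt : R := tiltc R ^+ d.
Definition few (k : nat) : bool := (0 < k)%N && (5 * k <= 2 * d)%N.
(** In [gibbs_bound] the logarithm of the kernel carries the coefficient 1/d, so the power d makes
    this weight cancel ln(1 + x^k) exactly. *)
Definition refw (k : nat) : R := (1 + x ^+ k) ^+ d * (if few k then tilt else 1).
Definition Zref : R := \sum_(I : {set 'I_d} | I != finset.set0) refw #|I|.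
Definition refk (k : nat) : R := if k == 0%N then 1 else refw k / Zref.
Definition etar : R := d%:R * (13 / 20) ^+ d + 2 * rho R ^+ d.

Lemma tilt_ge1 : 1 <= tilt.
Proof. by rewrite /tilt exprn_ege1 // tiltc_ge1. Qed.

Lemma tilt_gt0 : 0 < tilt. Proof. exact: lt_le_trans tilt_ge1. Qed.

Lemma refw_gt0 k : 0 < refw k.
Proof.
rewrite /refw mulr_gt0 ?exprn_gt0 ?ltr_pwDl ?exprn_ge0 ?(ltW x_gt0) //.
by case: ifP => _; rewrite ?tilt_gt0.
Qed.

Lemma d_gt0 : (0 < d)%N. Proof. exact: leq_trans d_ge. Qed.

Lemma Zref_gt0 : 0 < Zref.
Proof.
pose I0 : {set 'I_d} := [set Ordinal d_gt0].
rewrite /Zref (bigD1 I0) /=; last by apply/set0Pn; exists (Ordinal d_gt0); rewrite !inE.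
by apply: ltr_pwDl; rewrite ?refw_gt0 // sumr_ge0 // => I _; exact/ltW/refw_gt0.
Qed.

Lemma refk0 : refk 0 = 1. Proof. by []. Qed.

Lemma refk_gt0 k : 0 < refk k.
Proof. by rewrite /refk; case: ifP => // _; rewrite divr_gt0 ?refw_gt0 ?Zref_gt0. Qed.

Lemma refk_sum : \sum_(I : {set 'I_d} | I != finset.set0) refk #|I| = 1.
Proof.
rewrite (eq_bigr (fun I : {set 'I_d} => refw #|I| / Zref)); last first.
  by move=> I I0; rewrite /refk cards_eq0 (negPf I0).
by rewrite -mulr_suml divff // gt_eqF // Zref_gt0.
Qed.

Lemma expr_many k : (2 * d < 5 * k)%N -> x ^+ k <= (13 / 20) ^+ d.
Proof.
move=> kd; have x0 := ltW x_gt0.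
have r0 : 0 <= 13 / 20 :> R by lra.
rewrite -(@ler_pXn2r _ 5) ?nnegrE ?exprn_ge0 // -!exprM.
apply: (le_trans (y := x ^+ (2 * d))).
  by rewrite ler_wiXn2l //; [rewrite (le_trans x_le) //; lra | lia].
rewrite [(d * 5)%N]mulnC !exprM lerXn2r ?nnegrE ?exprn_ge0 //.
by apply: (le_trans (y := 3^-1 ^+ 2)); [rewrite lerXn2r // nnegrE; lra | lra].
Qed.

(** Sets with more than 2d/5 elements have weight close to 1 each, which gives 2^d. Smaller sets
    weigh more, and more still when tilted, but they are exponentially rarer; those below d/10 need
    the cruder base 4/3. *)
Lemma Zref_le : ln Zref <= d%:R * ln 2 + etar.
Proof.
have [y1 [y2 [c [[y10 y11 y20 y21 c0] hc h1 h2]]]] := reference_constants R.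
have u0 : 0 <= tiltc R := le_trans ler01 (tiltc_ge1 R).
have x0 := ltW x_gt0; have x1 : x <= 1 by rewrite (le_trans x_le) //; lra.
pose z : R := (13 / 20) ^+ d.
have z0 : 0 <= z by rewrite exprn_ge0 //; lra.
pose N1 := #|[set B : {set 'I_d} | (5 * #|B| <= 2 * d)%N]|.
pose N2 := #|[set B : {set 'I_d} | (10 * #|B| <= d)%N]|.
have t0 := tilt_gt0.
have b1 : Zref <= 2 ^+ d * expR (d%:R * z) + (tilt * c ^+ d) * N1%:R + (tilt * (4 / 3) ^+ d) * N2%:R.
  have e1 (I0 : {set 'I_d}) : I0 != finset.set0 -> refw #|I0| <= expR (d%:R * z) +
     (if (5 * #|I0| <= 2 * d)%N then tilt * c ^+ d else 0) +
     (if (10 * #|I0| <= d)%N then tilt * (4 / 3) ^+ d else 0).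
    rewrite -card_gt0 => k0; rewrite /refw /few k0 /=; set k := #|I0| in k0 *.
    have xk0 : 0 <= x ^+ k by rewrite exprn_ge0.
    have T1 : 0 <= tilt * c ^+ d by rewrite mulr_ge0 ?exprn_ge0 // ltW.
    have T2 : 0 <= tilt * (4 / 3) ^+ d by rewrite mulr_ge0 ?exprn_ge0 // ?ltW //; lra.
    have T3 : 0 <= expR (d%:R * z) by exact: expR_ge0.
    case: (leqP (5 * k) (2 * d)) => k5; last first.
      have -> : (10 * k <= d)%N = false by apply/negbTE; move: k5; clear; lia.
      rewrite mulr1 !addr0 expRM_natl lerXn2r ?nnegrE ?addr_ge0 ?expR_ge0 //.
      rewrite (le_trans _ (expR_ge1Dx _)) // lerD2l; exact: expr_many.
    case: (leqP (10 * k) d) => k10.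
      rewrite -[leLHS]add0r; apply: lerD; first exact: addr_ge0.
      rewrite mulrC ler_wpM2l ?(ltW t0) // lerXn2r ?nnegrE ?addr_ge0 //.
      have : x ^+ k <= x by rewrite -[leRHS]expr1 ler_wiXn2l.
      by move: x_le; lra.
    rewrite addr0 -[leLHS]add0r; apply: lerD => //.
    rewrite mulrC ler_wpM2l ?(ltW t0) // lerXn2r ?nnegrE ?addr_ge0 //.
    apply: le_trans hc; rewrite lerD2l.
    apply: (le_trans (y := x ^+ 11)); last by rewrite lerXn2r // nnegrE; lra.
    by rewrite ler_wiXn2l //; move: k10 d_ge; clear; lia.
  have e2 (P : {set 'I_d} -> bool) (a : R) :
      \sum_(I : {set 'I_d}) (if P I then a else 0) = a * #|[set I | P I]|%:R.
    rewrite -big_mkcond /= sumr_const mulr_natr; congr (_ *+ _).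
    by apply: eq_card => I; rewrite inE unfold_in.
  rewrite -!e2.
  have -> : 2 ^+ d * expR (d%:R * z) = \sum_(I : {set 'I_d}) expR (d%:R * z).
    have cs : #|{: {set 'I_d}}| = (2 ^ d)%N.
      by rewrite -cardsT -powersetT card_powerset cardsT card_ord.
    by rewrite sumr_const cs mulrC -natrX mulr_natr.
  rewrite -!big_split /= /Zref big_mkcond /=; apply: ler_sum => I _.
  case: ifP => [/e1 //|_].
  by rewrite !addr_ge0 ?expR_ge0 //; case: ifP => // _; rewrite mulr_ge0 ?exprn_ge0 // ?ltW //; lra.
have rho0 : 0 <= rho R := ltW (rho_gt0 R).
have b2 : tilt * c ^+ d * N1%:R <= 2 ^+ d * rho R ^+ d.
  have y2d : 0 < y1 ^+ (2 * d) by rewrite exprn_gt0.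
  rewrite -(ler_pM2r y2d) -[leLHS]mulrA.
  have := @chernoff_low R 'I_d y1 5 (2 * d) y10 y11; rewrite card_ord -/N1 => h.
  apply: (le_trans (y := tilt * c ^+ d * (1 + y1 ^+ 5) ^+ d)).
    by apply: ler_wpM2l => //; rewrite mulr_ge0 ?exprn_ge0 // ltW.
  rewrite /tilt exprM -!exprMn lerXn2r ?nnegrE ?mulr_ge0 ?addr_ge0 ?exprn_ge0 ?(ltW y10) //.
have b3 : tilt * (4 / 3) ^+ d * N2%:R <= 2 ^+ d * rho R ^+ d.
  have y2d : 0 < y2 ^+ d by rewrite exprn_gt0.
  rewrite -(ler_pM2r y2d) -[leLHS]mulrA.
  have := @chernoff_low R 'I_d y2 10 d y20 y21; rewrite card_ord -/N2 => h.
  apply: (le_trans (y := tilt * (4 / 3) ^+ d * (1 + y2 ^+ 10) ^+ d)).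
    by apply: ler_wpM2l => //; rewrite mulr_ge0 ?exprn_ge0 // ?(ltW t0) //; lra.
  rewrite /tilt -!exprMn lerXn2r ?nnegrE ?mulr_ge0 ?addr_ge0 ?exprn_ge0 ?(ltW y20) //.
have b4 : Zref <= 2 ^+ d * expR (etar).
  apply: (le_trans b1).
  apply: (le_trans (y := 2 ^+ d * (expR (d%:R * z) * (1 + 2 * rho R ^+ d)))).
    have E1 : 1 <= expR (d%:R * z) by rewrite -expR0 ler_expR mulr_ge0.
    have r0 : 0 <= 2 ^+ d * rho R ^+ d by rewrite mulr_ge0 ?exprn_ge0.
    have := ler_wpM2l r0 E1; move: b2 b3; rewrite mulrDr mulr1 mulrDr.
    set p := 2 ^+ d; set q := expR _; set s := rho R ^+ d; move: (_ * N1%:R) (_ * N2%:R) => a1 a2.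
    by move=> *; lra.
  rewrite ler_wpM2l ?exprn_ge0 // /etar expRD ler_wpM2l ?expR_ge0 //; exact: expR_ge1Dx.
have l1 : ln (2 ^+ d * expR etar) = d%:R * ln 2 + etar.
  by rewrite lnM ?posrE ?exprn_gt0 ?expR_gt0 // expRK lnXn // mulr_natl.
by rewrite -l1 ler_ln ?posrE ?Zref_gt0 ?mulr_gt0 ?exprn_gt0 ?expR_gt0.
Qed.

End Reference.

(** * The entropy bound on the probability of bad vertices *)

Section Phase.
Variables (R : realType) (x : R) (d : nat).
Hypotheses (x_gt0 : 0 < x) (x_le : x <= 3^-1) (d_ge : (100 <= d)%N).
Implicit Types (u v t w : cube d) (i j m : 'I_d) (S A B O E D : {set cube d}) (b : bool).
Local Notation Ex := (@Ex R x d).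
Local Notation Pr := (@Pr R x d).
Local Notation pbad := (@pbad R x d).
Local Notation rho := (rho R).

Definition pihat : R := 408 * pbad + 14 * rho ^+ d.

Let d25 : (25 <= d)%N. Proof. exact: leq_trans d_ge. Qed.

Lemma pihat_ge0 : 0 <= pihat.
Proof.
have r0 : 0 <= rho := ltW (rho_gt0 R); have p0 : 0 <= pbad by exact: pbad_ge0.
exact: addr_ge0 (mulr_ge0 (ler0n _ _) p0) (mulr_ge0 (ler0n _ _) (exprn_ge0 _ r0)).
Qed.

Lemma Pr_flat_le u m : Pr (fun S => (0 < kk S u)%N == (0 < kk S (flip u m))%N) <= pihat.
Proof. by rewrite Pr_flat; exact: pflat_le. Qed.

Lemma Pr_low_le w : (0 < hw w)%N ->
  Pr (fun S => (0 < kk S w)%N == (0 < kk S (low w))%N) <= pihat.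
Proof.
rewrite /low; case: pickP => [i _ _|w0]; first exact: Pr_flat_le.
by rewrite /hw (eq_card0 (A := [set i | w i])) // => i; rewrite inE w0.
Qed.

(** Four alternating steps restore the initial value, so a discrepancy forces a step without
    alternation. *)
Lemma Pr_chain4 (a0 a1 a2 a3 a4 : {set cube d} -> bool) :
  Pr (fun S => a0 S != a4 S) <= Pr (fun S => a0 S == a1 S) + (Pr (fun S => a1 S == a2 S) +
    (Pr (fun S => a2 S == a3 S) + Pr (fun S => a3 S == a4 S))).
Proof.
apply: (le_trans (Pr_le2 (Q1 := fun S => a0 S == a1 S) (Q2 := fun S =>
  (a1 S == a2 S) || ((a2 S == a3 S) || (a3 S == a4 S))) x_gt0 _)).
  by move=> S; case: (a0 S); case: (a1 S); case: (a2 S); case: (a3 S); case: (a4 S).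
rewrite lerD2l; apply: (le_trans (Pr_le2 (Q1 := fun S => a1 S == a2 S) (Q2 := fun S =>
  (a2 S == a3 S) || (a3 S == a4 S)) x_gt0 _)); first by [].
by rewrite lerD2l; apply: Pr_le2.
Qed.

Lemma Pr_prevv_le w : (4 <= hw w)%N ->
  Pr (fun S => (0 < kk S w)%N != (0 < kk S (prevv w))%N) <= 4 * pihat.
Proof.
move=> h4; pose T v S := (0 < kk S v)%N.
apply: (le_trans (Pr_chain4 (T w) (T (low w)) (T (low (low w))) (T (low (low (low w)))) _)).
have p1 := @Pr_low_le w; have p2 := @Pr_low_le (low w).
have p3 := @Pr_low_le (low (low w)); have p4 := @Pr_low_le (low (low (low w))).
rewrite !hw_low in p2 p3 p4.
have h1 : (0 < hw w)%N by lia.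
have h2 : (0 < (hw w).-1)%N by lia.
have h3 : (0 < (hw w).-2)%N by lia.
have h5 : (0 < (hw w).-1.-2)%N by lia.
move: (p1 h1) (p2 h2) (p3 h3) (p4 h5); rewrite /T -/(prevv w).
do 4 (move: (Pr _) => ?); lra.
Qed.

Section Bound.
Variables (lam : R).
Hypotheses (lam_gt0 : 0 < lam) (lam_d : 1 <= lam * d%:R).
Let e : R := expR (- (lam * d%:R)).

Lemma e_le : e <= 2^-1.
Proof.
rewrite /e expRN lef_pV2 ?posrE ?expR_gt0 //.
by rewrite (le_trans _ (expR_ge1Dx _)) // -[2]/(1 + 1) lerD2l.
Qed.

Lemma e_gt0 : 0 < e. Proof. exact: expR_gt0. Qed.

(** A miscopy costs ln(1/e) = lam d, and a correct copy at most 2e. Vertices of weight below 4 have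
    nothing to copy and cost ln 2 <= 1. *)
Lemma Ex_cpl w : Ex (fun S => - ln (cpl e w S)) <=
  if (4 <= hw w)%N then 4 * (lam * d%:R) * pihat + 2 * e else 1.
Proof.
have e0 := e_gt0; have e2 := e_le.
rewrite /cpl; case: ifP => h4; last first.
  rewrite Ex1 // lnV ?posrE // opprK.
  have := @le_ln1Dx R 1; rewrite -[1 + 1]/2; apply; lra.
have l1 : - ln (1 - e) <= 2 * e.
  have p : 0 < 1 - e by lra.
  rewrite -lnV ?posrE //.
  have : ln (1 - e)^-1 <= (1 - e)^-1 - 1.
    have := @le_ln1Dx R ((1 - e)^-1 - 1); rewrite [1 + ((1 - e)^-1 - 1)]addrCA subrr addr0; apply.
    by rewrite ltrBrDr addNr invr_gt0.
  move=> h; apply: (le_trans h); rewrite lerBlDr -[leLHS]mul1r ler_pdivrMr //.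
  by nra.
have l2 : - ln e = lam * d%:R by rewrite /e expRK opprK.
apply: (le_trans (y := Ex (fun S => (lam * d%:R) *
   ((0 < kk S w)%N != (0 < kk S (prevv w))%N)%:R + 2 * e))).
  apply: Ex_le => // S; case: eqP => _ /=; first by rewrite mulr0 add0r.
  by rewrite mulr1 l2 lerDl mulr_ge0 // ltW.
rewrite ExD Ex1 // ExZ lerD2r.
have -> : 4 * (lam * d%:R) * pihat = lam * d%:R * (4 * pihat) by ring.
apply: ler_wpM2l; last exact: Pr_prevv_le.
exact: le_trans ler01 lam_d.
Qed.


Definition fl (o : option 'I_d) v : cube d := if o is Some i then flip v i else v.

(** Such a vertex is reached from the origin by three optional flips. *)
Lemma card_hw_lt4 : (#|[set w : cube d | (hw w < 4)%N]| <= d.+1 ^ 3)%N.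
Proof.
have cE : #|{: option 'I_d * option 'I_d * option 'I_d}| = (d.+1 ^ 3)%N.
  by rewrite !card_prod card_option card_ord; lia.
have lowE w : exists o, w = fl o (low w).
  rewrite /low; case: pickP => [i _|_]; first by exists (Some i); rewrite /= flipK.
  by exists None.
have hw0 w : hw w = 0%N -> w = orig d.
  move=> h; apply/ffunP => i; rewrite !ffunE; apply/negbTE/negP => wi.
  by have := hw_flip_true wi; rewrite h.
pose f (t : option 'I_d * option 'I_d * option 'I_d) := fl t.1.1 (fl t.1.2 (fl t.2 (orig d))).
rewrite -cE; apply: leq_trans (leq_imset_card f _); apply: subset_leq_card.
apply/subsetP => w; rewrite inE => hww.
have [j1 e1] := lowE w; have [j2 e2] := lowE (low w); have [j3 e3] := lowE (low (low w)).
apply/imsetP; exists (j1, j2, j3) => //.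
rewrite e1 /f /= [in LHS]e2 [in LHS]e3; congr (fl _ (fl _ (fl _ _))).
by apply: hw0; rewrite !hw_low; lia.
Qed.

Lemma Zpart_ge : 2 ^+ #|side d true| <= Zpart x d.
Proof.
rewrite /Zpart (big_side _ false) (bigD1 finset.set0) ?powersetE ?sub0set //=.
have h := sum_wt_side1 x (sub0set (side d false)); rewrite /= in h; rewrite h.
rewrite -[leLHS]addr0; apply: lerD.
  rewrite (eq_bigr (fun=> 2)) ?prodr_const // => w _.
  by rewrite kk0 expr0.
by apply: sumr_ge0 => E _; apply: sumr_ge0 => O _; exact: wt_ge0.
Qed.

Lemma ln_Zpart_ge : #|side d true|%:R * ln 2 <= ln (Zpart x d).
Proof.
rewrite mulr_natl -lnXn // ler_ln ?posrE ?Zpart_gt0 ?exprn_gt0 //.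
exact: Zpart_ge.
Qed.

Lemma ln_tilt_ge : d%:R / 200 <= ln (tilt R d).
Proof.
rewrite /tilt lnXn ?(lt_le_trans ltr01 (tiltc_ge1 R)) // -[leRHS]mulr_natl.
apply: ler_wpM2l => //.
have q0 : (200 / 199 : R) \is Num.pos by rewrite posrE; lra.
rewrite /tiltc -lock; have := @le_ln1Dx R (- 200^-1).
have -> : 1 + - 200^-1 = (200 / 199)^-1 :> R by field.
rewrite lnV; last exact: q0.
move=> h; rewrite -lerN2; apply: h; lra.
Qed.

(** Sets lying in one side alone give ln Z >= N ln 2, while [gibbs_bound] gives ln 2 per vertex,
    plus the costs, minus the tilt earned when the vertex is bad. The main terms cancel, so the
    expected gain is bounded by the costs. *)
Lemma pbad_main :
  pbad * ln (tilt R d) <= etar R d + 4 * (lam * d%:R) * pihat + 2 * e +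
     (d.+1 ^ 3)%N%:R / #|side d true|%:R.
Proof.
have d0 : (0 < d)%N by exact: leq_trans d_ge.
have e0 := e_gt0; have e2 := e_le.
have e1 : e < 1 by lra.
pose rk := refk x d.
have rkp k : 0 < rk k by exact: refk_gt0.
have rks : \sum_(I : {set 'I_d} | I != finset.set0) rk #|I| = 1 by exact: refk_sum.
have dR : 0 < d%:R :> R by rewrite ltr0n.
have G := @gibbs_bound R x e rk d x_gt0 x_le d0 e0 e1 (refk0 x d) rkp rks.
pose N : R := #|side d true|%:R.
have N0 : 0 < N by rewrite ltr0n card_side // expn_gt0.
have term w : w \in side d true ->
    Ex (fun S => ln (1 + x ^+ kk S w) - d%:R^-1 * ln (nbker e rk w S)) <=
    ln 2 + d%:R^-1 * (etar R d - ln (tilt R d) * pbad +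
      (4 * (lam * d%:R) * pihat + 2 * e) + (if (hw w < 4)%N then 1 else 0)).
  move=> ws.
  have pt S : ln (1 + x ^+ kk S w) - d%:R^-1 * ln (nbker e rk w S) <=
      ln 2 + d%:R^-1 * (etar R d - ln (tilt R d) * (bad S w)%:R + - ln (cpl e w S)).
    rewrite /nbker lnM ?posrE ?cpl_gt0 //.
    rewrite -(ler_pM2l dR) mulrBr mulrA divff ?gt_eqF // mul1r mulrDr mulrA divff ?gt_eqF // mul1r.
    have eta0 : 0 <= etar R d.
      have z0 : 0 <= (13 / 20 : R) by lra.
      by apply: addr_ge0; apply: mulr_ge0; rewrite ?exprn_ge0 ?(ltW (rho_gt0 R)).
    (* A vertex seeing nothing yields ln(1 + 1) = ln 2 directly; for the others [refw] cancels the
       energy and ln 2 comes from [Zref]. *)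
    rewrite /rk /refk /bad; case: (kk S w) => [|k] /=.
      have two : 1 + 1 = 2 :> R by [].
      by rewrite expr0 two ln1 mulr0 subr0; move: eta0; lra.
    set K := k.+1; have Kp : (0 < K)%N by [].
    have p1 : 0 < 1 + x ^+ K by rewrite ltr_pwDl // exprn_ge0 // ltW.
    have Zl := Zref_le x_gt0 x_le d_ge; have Z0 := Zref_gt0 x_gt0 d_ge.
    have t0 := tilt_gt0 R d.
    rewrite ln_div ?posrE ?refw_gt0 // /refw lnM ?posrE ?exprn_gt0 //; last by case: ifP.
    rewrite lnXn // mulr_natl /few /=.
    by case: ifP => _; rewrite ?ln1 ?mulr0 ?mulr1; lra.
  apply: (le_trans (Ex_le x_gt0 pt)).
  rewrite ExD Ex1 // ExZ lerD2l; apply: ler_wpM2l; first by rewrite invr_ge0 ltW.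
  rewrite ExD; have -> : Ex (fun S => etar R d - ln (tilt R d) * (bad S w)%:R) =
      etar R d - ln (tilt R d) * pbad.
    rewrite (eq_Ex x (g := fun S => etar R d + (- ln (tilt R d)) * (bad S w)%:R)); last first.
      by move=> S; rewrite mulNr.
    by rewrite ExD Ex1 // ExZ mulNr -(Pr_bad x w).
  rewrite -[leRHS]addrA lerD2l; apply: (le_trans (Ex_cpl w)).
  have p0 := pihat_ge0; case: (leqP 4 (hw w)) => _; first by rewrite addr0.
  rewrite lerDr.
  rewrite addr_ge0 ?mulr_ge0 ?(ltW lam_gt0) ?(ltW e0) //.
have {G} := le_trans ln_Zpart_ge G.
rewrite Ex_sum => /le_trans /(_ (ler_sum _ term)).
rewrite big_split /= sumr_const -mulr_sumr big_split /= sumr_const -[ln 2 *+ _]mulr_natl lerDl.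
rewrite pmulr_rge0 ?invr_gt0 // -[_ *+ #|_|]mulr_natl -/N.
have c4 : \sum_(w in side d true) (if (hw w < 4)%N then 1 else 0) <= (d.+1 ^ 3)%N%:R :> R.
  rewrite -big_mkcondr /= sumr_const ler_nat; apply: leq_trans card_hw_lt4.
  apply: subset_leq_card; apply/subsetP => w; rewrite inE unfold_in => /andP[_ ->] //.
move=> h; have {h} h : 0 <= N * (etar R d - ln (tilt R d) * pbad + (4 * (lam * d%:R) * pihat + 2 * e)) + (d.+1 ^ 3)%N%:R.
  by apply: le_trans h _; rewrite lerD2l.
have : 0 <= (N * (etar R d - ln (tilt R d) * pbad + (4 * (lam * d%:R) * pihat + 2 * e)) + (d.+1 ^ 3)%N%:R) / N.
  by rewrite divr_ge0 // ltW.
rewrite mulrDl mulrAC divff ?gt_eqF // mul1r.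
by move: (_%:R / N) => q; lra.
Qed.

End Bound.
End Phase.

(** * Exponentially small sequences *)

Section ExpSmall.
Variable R : realType.
Implicit Types f g : nat -> R.

Definition esmall f := exists C r : R, [/\ 0 <= C, 0 < r, r < 1 &
  exists n0, forall n, (n0 <= n)%N -> f n <= C * r ^+ n].

Lemma esmall_le f g n0 : (forall n, (n0 <= n)%N -> f n <= g n) -> esmall g -> esmall f.
Proof.
move=> fg [C [r [C0 r0 r1 [m h]]]]; exists C, r; split=> //; exists (maxn n0 m) => n.
by rewrite geq_max => /andP[/fg h1 /h]; exact: le_trans.
Qed.

Lemma esmallD f g : esmall f -> esmall g -> esmall (fun n => f n + g n).
Proof.
move=> [C [r [C0 r0 r1 [m h]]]] [C' [r' [C'0 r'0 r'1 [m' h']]]].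
exists (C + C'), (Num.max r r'); split; rewrite ?addr_ge0 ?lt_max ?r0 ?gt_max ?r1 //.
exists (maxn m m') => n; rewrite geq_max => /andP[mn m'n].
have p1 : r ^+ n <= Num.max r r' ^+ n.
  by rewrite lerXn2r ?nnegrE ?le_max ?lexx ?(ltW r0).
have p2 : r' ^+ n <= Num.max r r' ^+ n.
  by rewrite lerXn2r ?nnegrE ?le_max ?lexx ?orbT ?(ltW r0) ?(ltW r'0).
rewrite mulrDl; apply: lerD; first by apply: le_trans (h _ mn) _; apply: ler_wpM2l.
by apply: le_trans (h' _ m'n) _; apply: ler_wpM2l.
Qed.

Lemma esmallZ (c : R) f : 0 <= c -> esmall f -> esmall (fun n => c * f n).
Proof.
move=> c0 [C [r [C0 r0 r1 [m h]]]]; exists (c * C), r; split=> //; first exact: mulr_ge0.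
by exists m => n /h hn; rewrite -mulrA; apply: ler_wpM2l.
Qed.

Lemma esmall_expr (r : R) : 0 < r -> r < 1 -> esmall (fun n => r ^+ n).
Proof. by move=> r0 r1; exists 1, r; split=> //; exists 0%N => n _; rewrite mul1r. Qed.

(* [n * s^n] is at most the geometric series [sum_i s^i <= 1 / (1 - s)]. *)
Lemma natr_expr_le (s : R) n : 0 <= s -> s < 1 -> n%:R * s ^+ n <= (1 - s)^-1.
Proof.
move=> s0 s1; have p : 0 < 1 - s by rewrite subr_gt0.
rewrite -[leRHS]mul1r ler_pdivlMr //.
apply: (le_trans (y := (\sum_(i < n) s ^+ i) * (1 - s))).
  rewrite ler_wpM2r // ?(ltW p) //.
  rewrite -[n in n%:R]card_ord mulr_natl -sumr_const; apply: ler_sum => i _.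
  by rewrite ler_wiXn2l ?(ltW s1) // ltnW.
by have := subrX1 s n; rewrite mulrC => h; have := exprn_ge0 n s0; lra.
Qed.

(** Splitting r^n as sqrt(r)^n sqrt(r)^n, one half absorbs the factor n. *)
Lemma esmall_natr f : esmall f -> esmall (fun n => n%:R * f n).
Proof.
move=> [C [r [C0 r0 r1 [m h]]]].
pose q := Num.sqrt r.
have q0 : 0 < q by rewrite sqrtr_gt0.
have q1 : q < 1 by rewrite -sqrtr1 ltr_sqrt.
have qq : q * q = r by rewrite -expr2 sqr_sqrtr // ltW.
exists (C * (1 - q)^-1), q; split=> //.
  by rewrite mulr_ge0 // invr_ge0 subr_ge0 ltW.
exists m => n /h hn; apply: (le_trans (ler_wpM2l (ler0n _ _) hn)).
rewrite -qq exprMn mulrCA -mulrA; apply: ler_wpM2l => //; rewrite mulrA.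
by rewrite ler_pM2r ?exprn_gt0 //; apply: natr_expr_le; rewrite // ltW.
Qed.

End ExpSmall.

(** * Phase concentration *)

Section Phase.
Variables (R : realType) (x : R).
Hypotheses (x_gt0 : 0 < x) (x_le : x <= 3^-1).

Lemma esmall_pbad : esmall (fun d => pbad x d).
Proof.
(* Makes 4 * 408 * lam = 1/400, so the miscopy term costs only half of the gain 1/200 per
   coordinate. *)
pose lam : R := (400 * (4 * 408))^-1.
have lam0 : 0 < lam by rewrite invr_gt0; lra.
pose g d : R := d%:R * (13 / 20) ^+ d + 2 * rho R ^+ d + (4 * lam * 14) * (d%:R * rho R ^+ d) +
  2 * expR (- lam) ^+ d + d.+1%:R * (d.+1%:R * (d.+1%:R * (2^-1 ^+ d * 2))).
have eg : esmall (fun d => 400 * g d).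
  have r0 := rho_gt0 R; have r1 := rho_lt1 R.
  apply: esmallZ; first exact: ler0n.
  rewrite /g; apply: esmallD; last first.
    have h := @esmall_expr R 2^-1 ltac:(lra) ltac:(lra).
    have h2 : esmall (fun n => 8 * (2 * (n%:R * (n%:R * (n%:R * 2^-1 ^+ n)))) : R).
      by do 2 (apply: esmallZ => //); do 3 apply: esmall_natr.
    apply: (esmall_le (n0 := 1)) h2 => n n1.
    have nR : 1 <= n%:R :> R by rewrite ler1n.
    have -> : n.+1%:R = n%:R + 1 :> R by rewrite -natr1.
    have t0 : 0 <= 2^-1 ^+ n :> R by rewrite exprn_ge0.
    move: (n%:R : R) (2^-1 ^+ n : R) nR t0 => a t a1 t0.
    have h3 : (a + 1) * ((a + 1) * (a + 1)) <= 8 * (a * (a * a)).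
      have a2 : a + 1 <= 2 * a by lra.
      have p1 : (a + 1) * (a + 1) <= (2 * a) * (2 * a) by apply: ler_pM => //; lra.
      apply: (le_trans (y := (2 * a) * ((2 * a) * (2 * a)))); last by lra.
      by apply: ler_pM => //; [lra | apply: mulr_ge0; lra].
    have := ler_wpM2r t0 h3; lra.
  apply: esmallD; last first.
    apply: esmallZ => //; apply: esmall_expr; first exact: expR_gt0.
    by rewrite expR_lt1 oppr_lt0.
  apply: esmallD; last first.
    apply: esmallZ; last by apply: esmall_natr; exact: esmall_expr.
    by rewrite !mulr_ge0 // ltW.
  apply: esmallD; last by apply: esmallZ => //; exact: esmall_expr.
  by apply: esmall_natr; apply: esmall_expr; lra.
pose n1 := Num.bound lam^-1.
have n1P : lam^-1 < n1%:R by have := archi_boundP (ltW (_ : 0 < lam^-1)); apply; rewrite invr_gt0.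
apply: (esmall_le (n0 := maxn 100 n1)) eg => d; rewrite geq_max => /andP[d100 dn1].
have d0 : (0 < d)%N by exact: leq_trans d100.
have lamd : 1 <= lam * d%:R.
  rewrite mulrC -ler_pdivrMr // mul1r; apply: (le_trans (ltW n1P)); by rewrite ler_nat.
have H := pbad_main x_gt0 x_le d100 lam0 lamd.
have p0 : 0 <= pbad x d by exact: pbad_ge0.
have dR : 1 <= d%:R :> R by rewrite ler1n.
have t1 := ler_wpM2l p0 (ln_tilt_ge R d).
have e1 : expR (- (lam * d%:R)) = expR (- lam) ^+ d.
  by rewrite -expRM_natr mulNr.
have e2 : (d.+1 ^ 3)%N%:R / #|side d true|%:R = d.+1%:R * (d.+1%:R * (d.+1%:R * (2^-1 ^+ d * 2))) :> R.
  have hd : (2 : R) ^+ d = 2 * 2 ^+ d.-1 by rewrite -exprS prednK.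
  have h0 : (2 : R) ^+ d.-1 != 0 by rewrite expf_neq0.
  by rewrite card_side // natrX natrX exprVn hd; move: (d.+1%:R : R) => a; field.
have e3 : 4 * (lam * d%:R) * pihat x d = d%:R * pbad x d / 400 + (4 * lam * 14) * (d%:R * rho R ^+ d).
  have hl : lam * (4 * 408) = 400^-1.
    have n0 : (4 * 408 : R) != 0 by rewrite mulf_neq0 ?pnatr_eq0.
    by rewrite /lam invfM mulfVK.
  have -> : 4 * (lam * d%:R) * pihat x d = lam * (4 * 408) * (d%:R * pbad x d) +
    (4 * lam * 14) * (d%:R * rho R ^+ d) by rewrite /pihat; ring.
  by rewrite hl mulrC.
rewrite e1 e2 e3 /etar in H.
have h1 : d%:R * pbad x d / 400 <= g d.
  move: t1 H; rewrite /g; set q := d.+1%:R * _.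
  have -> : pbad x d * (d%:R / 200) = d%:R * pbad x d / 400 + d%:R * pbad x d / 400 by field.
  move: (pbad x d * ln _) (d%:R * pbad x d / 400) => a b; lra.
have h2 : pbad x d <= d%:R * pbad x d by rewrite ler_peMl.
move: h1 h2; move: (d%:R * pbad x d) (g d) => a b; lra.
Qed.

Lemma esmall_pihat : esmall (fun d => pihat x d).
Proof.
apply: esmallD; apply: esmallZ; try exact: ler0n; first exact: esmall_pbad.
by apply: esmall_expr; [exact: rho_gt0 | exact: rho_lt1].
Qed.

Section Minority.
Variable d : nat.
Hypothesis d_ge : (100 <= d)%N.

Definition offphase S (u : cube d) : bool := (0 < kk S u)%N != ((0 < kk S (orig d))%N (+) par u).
Definition minority (S : {set cube d}) : nat := minn #|S :&: side d false| #|S :&: side d true|.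

(** Descend from [u] to the origin one coordinate at a time: each step fails to alternate with
    probability at most [pihat]. *)
Lemma Pr_offphase u : Pr x (fun S => offphase S u) <= (hw u)%:R * pihat x d.
Proof.
have [n] := ubnP (hw u); elim: n u => // n IH u; rewrite ltnS => hn.
have [h0|hpos] := posnP (hw u).
  have -> : u = orig d.
    apply/ffunP => i; rewrite !ffunE; apply/negbTE/negP => ui.
    by have := hw_flip_true ui; rewrite h0.
  rewrite (le_trans (Pr_le (Q' := fun=> false) x_gt0 _)) //.
    move=> S; rewrite /offphase; have := par_orig d; rewrite in_side => /eqP ->.
    by rewrite addbF eqxx.
  rewrite /Pr Ex1 // mulr_ge0 // pihat_ge0 //.
apply: (le_trans (Pr_le2 (Q1 := fun S => offphase S (low u))
  (Q2 := fun S => (0 < kk S u)%N == (0 < kk S (low u))%N) x_gt0 _)).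
  move=> S; rewrite /offphase par_low //.
  by case: (0 < kk S u)%N; case: (0 < kk S (low u))%N; case: (0 < kk S _)%N; case: (par u).
have := IH (low u); rewrite hw_low => /(_ ltac:(lia)) h1.
have h2 := Pr_low_le x_gt0 x_le d_ge hpos.
have -> : (hw u)%:R = ((hw u).-1)%:R + 1 :> R by rewrite natr1 prednK.
by rewrite mulrDl mul1r; exact: lerD.
Qed.

(** On one side the phase predicts vertices seeing nothing. An element of [S] on the opposite side
    is seen by its flip in a fixed direction, which is therefore off phase; this map is
    injective. *)
Lemma minority_le S : (minority S <= #|[set u | offphase S u]|)%N.
Proof.
have d0 : (0 < d)%N by exact: leq_trans d_ge.
pose i0 := Ordinal d0; pose b := (0 < kk S (orig d))%N.
have h : (#|S :&: side d (~~ b)| <= #|[set u | offphase S u]|)%N.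
  rewrite -(card_imset (mem (S :&: side d (~~ b))) (inv_inj (@flipK d i0))).
  apply: subset_leq_card; apply/subsetP => _ /imsetP[w wS ->]; move: wS; rewrite in_setI in_side => /andP[wS /eqP wb].
  rewrite inE /offphase -/b par_flip wb negbK addbb.
  have -> // : (0 < kk S (flip w i0))%N.
  by apply/card_gt0P; exists i0; rewrite inE flipK.
by rewrite /minority geq_min; move: h; case: (b) => /= ->; rewrite ?orbT.
Qed.

Lemma Ex_minority : Ex x (fun S => (minority S)%:R) <= 2 ^+ d * (d%:R * pihat x d).
Proof.
apply: (le_trans (y := Ex x (fun S => \sum_(u : cube d) (offphase S u)%:R))).
  apply: Ex_le => // S; rewrite -natr_sum ler_nat; apply: leq_trans (minority_le S) _.
  rewrite -sum1_card big_mkcond /=; apply: leq_sum => u _; rewrite inE; by case: offphase.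
rewrite Ex_sum; apply: (le_trans (y := \sum_(u : cube d) d%:R * pihat x d)).
  apply: ler_sum => u _; apply: (le_trans (Pr_offphase u)).
  apply: ler_wpM2r; first exact: pihat_ge0.
  by rewrite ler_nat -[leqRHS]card_ord max_card.
by rewrite sumr_const -cardsT card_cube -[_ *+ (2 ^ d)%N]mulr_natl natrX.
Qed.

End Minority.

(** The expected minority is at most C 2^d r^d, so Markov's inequality at level (2 sqrt r)^d leaves
    C (sqrt r)^d. *)
Lemma phase_concentration : exists s : R, [/\ 0 < s, s < 2 &
  esmall (fun d => Pr x (fun S : {set cube d} => s ^+ d < (minority S)%:R))].
Proof.
have [C [r [C0 r0 r1 [n0 h]]]] := esmall_natr esmall_pihat.
pose q := Num.sqrt r.
have q0 : 0 < q by rewrite sqrtr_gt0.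
have q1 : q < 1 by rewrite -sqrtr1 ltr_sqrt.
have qq : q * q = r by rewrite -expr2 sqr_sqrtr // ltW.
exists (2 * q); split; [lra | lra |].
exists C, q; split=> //; exists (maxn 100 n0) => d; rewrite geq_max => /andP[d100 dn0].
have s0 : 0 < (2 * q) ^+ d by rewrite exprn_gt0 // mulr_gt0.
rewrite -(ler_pM2l s0).
apply: (le_trans (Pr_markov (f := fun S : {set cube d} => (minority S)%:R) x_gt0 s0 _ _)) => //.
  by move=> S; exact: ltW.
apply: (le_trans (Ex_minority d100)).
rewrite exprMn -mulrA; apply: ler_wpM2l; first exact: exprn_ge0.
by apply: (le_trans (h d dn0)); rewrite -qq exprMn mulrCA.
Qed.

End Phase.

(** * Cluster sums *)

Section EdgeIso.
Variable R : realType.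

Lemma ln1D_ge (t : R) : 0 <= t -> t <= 1 -> t * ln 2 <= ln (1 + t).
Proof.
move=> t0 t1.
have p1 : (0 : R) < 1 by []; have p2 : (0 : R) < 2 by [].
have := @concave_ln R (Itv01 t0 t1) 2 1 p2 p1.
rewrite !convRE /= ln1 mulr0 addr0 => h; apply: (le_trans h).
by rewrite le_eqVlt; apply/orP; left; apply/eqP; congr ln; rewrite /unstable.onem /=; ring.
Qed.

(** The two-point inequality that carries the induction of [edge_iso_dir]; it follows from the
    concavity of ln on [1, 2]. *)
Lemma entropy_split (a b : nat) :
  a%:R * ln a%:R + b%:R * ln b%:R + 2 * (minn a b)%:R * ln 2 <= (a + b)%N%:R * ln (a + b)%N%:R :> R.
Proof.
wlog ab : a b / (a <= b)%N => [hw|].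
  case/orP: (leq_total a b) => h; first exact: hw.
  by rewrite minnC addnC [X in X + _ <= _]addrC; exact: hw.
rewrite (minn_idPl ab); case: (posnP a) => [->|a0].
  by rewrite !mul0r mulr0 mul0r add0r addr0.
have b0 : (0 < b)%N by exact: leq_trans ab.
have A : 0 < a%:R :> R by rewrite ltr0n.
have B : 0 < b%:R :> R by rewrite ltr0n.
have AB : a%:R <= b%:R :> R by rewrite ler_nat.
rewrite natrD mulrDl; move: (a%:R : R) (b%:R : R) A B AB => {a b ab a0 b0} a b A B AB.
have h1 : ln 2 + ln a <= ln (a + b).
  by rewrite -lnM ?posrE // ler_ln ?posrE ?mulr_gt0 ?addr_gt0 //; lra.
have h2 : a / b * ln 2 + ln b <= ln (a + b).
  have -> : a + b = (1 + a / b) * b by field; rewrite gt_eqF.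
  rewrite lnM ?posrE ?addr_gt0 ?divr_gt0 // lerD2r; apply: ln1D_ge.
    by rewrite divr_ge0 // ltW.
  by rewrite ler_pdivrMr // mul1r.
have h1' := ler_wpM2l (ltW A) h1.
have := ler_wpM2l (ltW B) h2; rewrite [leLHS]mulrDr mulrA mulrCA divff ?gt_eqF // mulr1.
by move: h1'; rewrite mulrDr; lra.
Qed.


Variable d : nat.
Implicit Types (u v w : cube d) (i j : 'I_d) (S T A B U : {set cube d}) (I : {set 'I_d}).

Definition inner i T : nat := #|[set u in T | flip u i \in T]|.

(** Split [T] along one direction: each of its edges in that direction matches a point of one half
    with a point of the other. [inner] counts edges at both ends, hence twice the smaller half. *)
Lemma edge_iso_dir I T : (\sum_(i in I) inner i T)%N%:R * ln 2 <= #|T|%:R * ln #|T|%:R :> R.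
Proof.
have [n] := ubnP #|I|; elim: n I T => // n IH I T; rewrite ltnS => cI.
have [->|/set0Pn[i iI]] := eqVneq I finset.set0.
  rewrite big_set0 mul0r; case: (posnP #|T|) => [->|T0]; first by rewrite mul0r.
  by rewrite mulr_ge0 // ln_ge0 // ler1n.
pose T0 := [set u in T | ~~ u i]; pose T1 := [set u in T | u i].
have cT : #|T| = (#|T0| + #|T1|)%N.
  rewrite -(cardsID [set u : cube d | ~~ u i] T); congr addn; apply: eq_card => u; rewrite !inE //.
  by rewrite negbK andbC.
have spl j : j != i -> inner j T = (inner j T0 + inner j T1)%N.
  move=> ji; rewrite /inner -(cardsID [set u : cube d | ~~ u i] [set u in T | flip u j \in T]).
  have fi u : flip u j i = u i by rewrite ffunE eq_sym (negPf ji) addbF.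
  by congr addn; apply: eq_card => u; rewrite !inE fi; case: (u i) => /=; rewrite ?andbT ?andbF.
have iT : (inner i T <= 2 * minn #|T0| #|T1|)%N.
  have mm b : (#|[set u in T | (flip u i \in T) && (u i == b)]| <= minn #|T0| #|T1|)%N.
    have h1 : (#|[set u in T | (flip u i \in T) && (u i == b)]| <= #|[set u in T | u i == b]|)%N.
      by apply: subset_leq_card; apply/subsetP => u; rewrite !inE => /and3P[-> _ ->].
    have h2 : (#|[set u in T | (flip u i \in T) && (u i == b)]| <= #|[set u in T | u i == ~~ b]|)%N.
      rewrite -(card_imset (mem [set u in T | (flip u i \in T) && (u i == b)]) (inv_inj (@flipK d i))).
      apply: subset_leq_card; apply/subsetP => _ /imsetP[u uT ->].
      by move: uT; rewrite !inE => /and3P[_ -> /eqP <-]; rewrite ffunE eqxx addbT eqxx.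
    have e1 : #|T1| = #|[set u in T | u i == true]| by apply: eq_card => u; rewrite !inE eqb_id.
    have e0 : #|T0| = #|[set u in T | u i == false]| by apply: eq_card => u; rewrite !inE eqbF_neg.
    by rewrite leq_min e0 e1; case: b h1 h2 => /= -> ->.
  rewrite mul2n -addnn; apply: leq_trans (leq_add (mm true) (mm false)).
  rewrite /inner -(cardsID [set u : cube d | u i] [set u in T | flip u i \in T]); apply: eq_leq.
  by congr addn; apply: eq_card => u; rewrite !inE; case: (u i); rewrite ?andbT ?andbF //= andbC.
have IH0 := IH (I :\ i) T0 _; have IH1 := IH (I :\ i) T1 _.
have cI' : (#|I :\ i| < n)%N by move: cI; rewrite (cardsD1 i I) iI.
have {IH0} IH0 := IH0 cI'; have {IH1} IH1 := IH1 cI'.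
rewrite (big_setD1 i) //= (eq_bigr (fun j => inner j T0 + inner j T1)%N); last first.
  by move=> j; rewrite in_setD1 => /andP[/spl].
rewrite big_split /= cT; apply: le_trans (entropy_split _ _).
have l2 : 0 <= ln 2 :> R by rewrite ln_ge0 // ler1n.
have iTR : (inner i T)%:R * ln 2 <= 2 * (minn #|T0| #|T1|)%:R * ln 2 :> R.
  by rewrite ler_wpM2r // -natrM ler_nat.
by rewrite !natrD !mulrDl; lra.
Qed.

(** Edge-isoperimetric inequality: the average internal degree is at most log2 of the size. *)
Lemma edge_iso T : (\sum_(u in T) kk T u)%N%:R * ln 2 <= #|T|%:R * ln #|T|%:R :> R.
Proof.
apply: le_trans (edge_iso_dir [set: 'I_d] T).
rewrite (_ : (\sum_(u in T) kk T u)%N = (\sum_(i in [set: 'I_d]) inner i T)%N) //.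
under eq_bigr do rewrite kkE.
rewrite exchange_big /=; apply: eq_big => [i|i _]; first by rewrite inE.
rewrite /inner -sum1_card big_mkcond [RHS]big_mkcond; apply: eq_bigr => u _ /=.
by rewrite !inE; case: (u \in T); case: (flip u i \in T).
Qed.

End EdgeIso.

(** * Greedy covers and sizes of neighbourhoods *)

Section Greedy.
Variable d : nat.
Implicit Types (u v w : cube d) (i j : 'I_d) (S T A B U : {set cube d}).

Definition NB A : {set cube d} := [set v | (0 < kk A v)%N].

Lemma in_NB A v : (v \in NB A) = (0 < kk A v)%N.
Proof. by rewrite inE. Qed.

Lemma NB_flip A u i : u \in A -> flip u i \in NB A.
Proof. by move=> uA; rewrite in_NB; apply/card_gt0P; exists i; rewrite inE flipK. Qed.

Lemma NBS A B : A \subset B -> NB A \subset NB B.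
Proof. by move=> AB; apply/subsetP => v; rewrite !in_NB => /leq_trans; apply; exact: kk_sub. Qed.

Lemma NB1 u : NB [set u] = nb u.
Proof.
apply/setP => v; rewrite in_NB; apply/card_gt0P/imsetP => [[i]|[i _ ->]].
  by rewrite !inE => /eqP <-; exists i; rewrite ?flipK.
by exists i; rewrite !inE flipK.
Qed.

Lemma NBU A B : NB (A :|: B) = NB A :|: NB B.
Proof.
apply/setP => v; rewrite in_setU !in_NB; apply/card_gt0P/orP => [[i]|].
  by rewrite !inE => /orP[] h; [left|right]; apply/card_gt0P; exists i; rewrite inE.
by case=> /card_gt0P[i]; rewrite inE => h; exists i; rewrite !inE h ?orbT.
Qed.

(** Take a largest [U] whose elements bring [h] new neighbours each on average. A vertex with [h]
    uncovered neighbours could still be added. *)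
Lemma greedy_cover h A : (0 < h)%N -> exists U, [/\ U \subset A, (#|U| * h <= #|NB A|)%N &
  forall u, u \in A -> (#|[set i | flip u i \notin NB U]| < h)%N].
Proof.
move=> h0; pose P U := (U \subset A) && (#|U| * h <= #|NB U|)%N.
have P0 : P finset.set0 by rewrite /P sub0set cards0.
case: (arg_maxnP (fun U : {set cube d} => #|U|) P0) => U /andP[UA cU] Umax.
exists U; split=> //; first by apply: leq_trans cU _; exact/subset_leq_card/NBS.
move=> u uA; rewrite ltnNge; apply/negP => hu.
have uU : u \notin U.
  apply/negP => uU; move: hu; have -> : [set i | flip u i \notin NB U] = finset.set0.
    by apply/setP => i; rewrite in_set in_set0 NB_flip.
  by rewrite cards0 leqn0 eqn0Ngt h0.
suff /Umax : P (u |: U) by rewrite /= cardsU1 uU add1n ltnn.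
rewrite /P subUset sub1set uA UA /= cardsU1 uU mulnDl mul1n addnC NBU NB1.
rewrite -(cardsID (NB U) (nb u :|: NB U)); apply: leq_add.
  by rewrite (setIidPr (subsetUr _ _)).
apply: leq_trans hu _; rewrite -(card_imset _ (@flip_inj d u)).
apply: subset_leq_card; apply/subsetP => _ /imsetP[i iN ->].
by move: iN; rewrite inE => iN; rewrite in_setD iN in_setU imset_f.
Qed.

(** Each round covers what the previous ones left. A vertex never selected misses at most [h]
    neighbours per round, so all but [tau * h] of its neighbours are covered [tau] times. *)
Lemma greedy_cover_iter h A tau : (0 < h)%N -> exists U, [/\ U \subset A,
  (#|U| * h <= tau * #|NB A|)%N &
  forall u, u \in A :\: U -> (#|[set i | (kk U (flip u i) < tau)%N]| <= tau * h)%N].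
Proof.
move=> h0; elim: tau => [|tau [U [UA cU hU]]].
  exists finset.set0; rewrite sub0set cards0; split=> // u _; rewrite leqn0 cards_eq0.
  by apply/eqP/setP => i; rewrite !inE.
have [U' [U'A cU' hU']] := @greedy_cover h (A :\: U) h0.
have dUU' : [disjoint U & U'].
  rewrite disjoint_sym disjoint_subset; apply/subsetP => u /(subsetP U'A).
  by rewrite in_setD inE => /andP[].
exists (U :|: U'); split.
- by rewrite subUset UA (subset_trans U'A) // subsetDl.
- rewrite cardsU (disjoint_setI0 dUU') cards0 subn0 mulnDl mulSn addnC leq_add //.
  by apply: leq_trans cU' _; exact/subset_leq_card/NBS/subsetDl.
move=> u; rewrite inE in_setU negb_or -andbA => /and3P[uU uU' uA].
have uAU : u \in A :\: U by rewrite inE uU.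
rewrite mulSn addnC; apply: leq_trans (leq_add (hU u uAU) (ltnW (hU' u uAU))).
apply: leq_trans (leq_card_setU _ _); apply: subset_leq_card; apply/subsetP => i.
rewrite 4!inE in_NB kkU //; case: (ltnP (kk U (flip u i)) tau) => //= h1.
by rewrite lt0n negbK; lia.
Qed.

Lemma card_nbI u v : u != v -> (#|nb u :&: nb v| <= 2)%N.
Proof.
move=> uv.
have [i0 hi0] : exists i, u i != v i.
  apply/existsP; rewrite -[X in is_true X]negbK; apply/negP => /existsPn h.
  by move/eqP: uv; apply; apply/ffunP => i; apply/eqP; have := h i; rewrite negbK.
have [[j0 [j0i hj0]]|h] := pselect (exists j, j != i0 /\ u j != v j).
  apply: leq_trans (_ : #|[set flip u i0; flip u j0]| <= 2)%N; last by rewrite cards2; case: eqP.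
  apply: subset_leq_card; apply/subsetP => w; rewrite in_setI => /andP[/imsetP[i _ ->]].
  case/imsetP => j _ /ffunP e; rewrite !inE.
  have ei := e i0; have ej := e j0; rewrite !ffunE in ei ej.
  have [->|ii0] := eqVneq i i0; first by rewrite eqxx.
  have [->|ij0] := eqVneq i j0; first by rewrite eqxx orbT.
  move: ei ej; rewrite ![_ == i]eq_sym (negPf ii0) (negPf ij0) !addbF.
  have [ji|_] := eqVneq i0 j; last by rewrite addbF => /eqP; rewrite (negPf hi0).
  by rewrite -ji (negPf j0i) addbF => _ /eqP; rewrite (negPf hj0).
(* only one coordinate differs: the common neighbourhood is empty by parity *)
have vE : v = flip u i0.
  apply/ffunP => j; rewrite ffunE; have [->|ji] := eqVneq j i0.
    by rewrite addbT; move: hi0; case: (u i0); case: (v i0).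
  rewrite addbF; apply/eqP; rewrite eq_sym; apply/negPn/negP => uvj; apply: h; by exists j.
rewrite (_ : nb u :&: nb v = finset.set0) ?cards0 //.
apply/eqP; rewrite -subset0; apply/subsetP => w; rewrite in_setI => /andP[/imsetP[i _ ->]].
by case/imsetP => j _ /(congr1 (@par d)); rewrite vE !par_flip; case: (par u).
Qed.

(** Inclusion-exclusion: two distinct vertices have at most two common neighbours. *)
Lemma card_NB_ge A : (#|A| * d <= #|NB A| + #|A| * #|A|.-1)%N.
Proof.
have [n] := ubnP #|A|; elim: n A => // n IH A; rewrite ltnS => cA.
have [->|/set0Pn[u uA]] := eqVneq A finset.set0; first by rewrite cards0.
have AE : A = u |: (A :\ u) by rewrite setD1K.
set B := A :\ u in AE; have uB : u \notin B by rewrite !inE eqxx.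
have cAB : #|A| = #|B|.+1 by rewrite AE cardsU1 uB.
have IHB : (#|B| * d <= #|NB B| + #|B| * #|B|.-1)%N by apply: IH; rewrite -cAB.
have h1 : (#|nb u :&: NB B| <= 2 * #|B|)%N.
  apply: leq_trans (_ : \sum_(v in B) #|nb u :&: nb v| <= _)%N; last first.
    rewrite mulnC -sum_nat_const; apply: leq_sum => v vB; apply: card_nbI.
    by apply: contraNneq uB => ->.
  have -> : nb u :&: NB B = \bigcup_(v in B) (nb u :&: nb v).
    apply/setP => w; rewrite in_setI; apply/andP/bigcupP => [[wu]|[v vB]].
      rewrite in_NB => /card_gt0P[i]; rewrite inE => fB; exists (flip w i) => //.
      by rewrite in_setI wu nb_sym imset_f.
    rewrite in_setI => /andP[-> wv]; split=> //; rewrite in_NB.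
    by case/imsetP: wv => i _ ->; rewrite -in_NB NB_flip.
  elim/big_rec2: _ => [|v m B' _ hm]; first by rewrite cards0.
  by apply: leq_trans (leq_card_setU _ _) _; rewrite leq_add2l.
have h3 := subset_leq_card (subsetIl (nb u) (NB B)); rewrite card_nb in h3.
have h2 : #|NB A| = (d - #|nb u :&: NB B| + #|NB B|)%N.
  by rewrite AE NBU NB1 cardsU card_nb addnBAC.
rewrite h2 cAB /=; move: h1 h3 IHB; move: #|nb u :&: _| #|NB B| => p q.
case: #|B| => [|k] /=; nia.
Qed.

End Greedy.

(** * Connected sets and their enumeration by walks *)

Section CutConnected.
Variable V : finType.
Implicit Types (r s : rel V) (A B O U : {set V}) (u v : V).

(** Connectivity through cuts: each use needs only a link leaving a proper nonempty part, never a
    path. *)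
Definition conn r U : bool :=
  [forall B : {set V}, [&& B \subset U, B != finset.set0 & B != U] ==>
    [exists b in B, exists c in U :\: B, r b c]].

Lemma connP r U : reflect (forall B : {set V}, B \subset U -> B != finset.set0 -> B != U ->
  exists b c, [/\ b \in B, c \in U, c \notin B & r b c]) (conn r U).
Proof.
apply: (iffP forallP) => [h B BU B0 BnU|h B].
  have := h B; rewrite BU B0 BnU => /existsP[b /andP[bB /existsP[c /andP[]]]].
  by rewrite in_setD => /andP[cB cU] rbc; exists b, c.
apply/implyP => /and3P[BU B0 BnU]; have [b [c [bB cU cB rbc]]] := h B BU B0 BnU.
by apply/existsP; exists b; rewrite bB; apply/existsP; exists c; rewrite in_setD cB cU.
Qed.

Lemma conn1 r u : conn r [set u].
Proof.
apply/connP => B; rewrite subset1 => /orP[/eqP->|/eqP->]; by rewrite eqxx.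
Qed.

Lemma conn_insert r A a c : symmetric r -> conn r A -> a \in A -> r a c -> conn r (c |: A).
Proof.
move=> rs /connP cA aA rac; apply/connP => B BU B0 BnU.
have [BA0|BA0] := eqVneq (B :&: A) finset.set0.
  have BE : B = [set c].
    apply/eqP; rewrite eqEsubset; apply/andP; split.
      apply/subsetP => b bB; have := subsetP BU b bB; rewrite !inE => /orP[//|bA].
      by have := in_set0 b; rewrite -BA0 inE bB bA.
    rewrite sub1set; case/set0Pn: B0 => b bB.
    have := subsetP BU b bB; rewrite !inE => /orP[/eqP <- //|bA].
    by have := in_set0 b; rewrite -BA0 inE bB bA.
  exists c, a; rewrite rs rac; split=> //; first by rewrite BE set11.
    by rewrite inE aA orbT.
  by apply/negP => aB; have := in_set0 a; rewrite -BA0 inE aB aA.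
have [BAA|BAA] := eqVneq (B :&: A) A.
  have AB : A \subset B by rewrite -BAA subsetIl.
  exists a, c; split=> //; first exact: (subsetP AB).
    by rewrite !inE eqxx.
  apply/negP => cB; move/eqP: BnU; apply; apply/eqP.
  by rewrite eqEsubset BU subUset sub1set cB AB.
have [b [c' [bB cU cB rbc]]] := cA _ (subsetIr B A) BA0 BAA.
exists b, c'; move: bB cB; rewrite !inE => /andP[-> _]; rewrite cU andbT => c'B.
by split=> //; rewrite orbT.
Qed.

Definition component r (O : {set V}) u : {set V} :=
  [arg max_(A > [set u] | [&& u \in A, A \subset O & conn r A]) #|A|].

Lemma componentP r O u : symmetric r -> u \in O ->
  [/\ u \in component r O u, component r O u \subset O, conn r (component r O u) &
   forall a c, a \in component r O u -> c \in O -> c \notin component r O u -> ~~ r a c].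
Proof.
move=> rs uO; rewrite /component; case: arg_maxnP => [|A /and3P[uA AO cA] Amax].
  by rewrite set11 sub1set uO conn1.
split=> // a c aA cO cA'; apply/negP => rac.
have := Amax (c |: A); rewrite !inE uA orbT subUset sub1set cO AO (conn_insert rs cA aA rac).
by move=> /(_ isT); rewrite /= cardsU1 cA' add1n ltnn.
Qed.

(* [r] and [s] describe adjacency along one and three (possibly trivial) links. *)
Lemma conn_net r s A U : symmetric r -> reflexive r -> (forall a b c e, r a b -> r b c -> r c e -> s a e) ->
  conn r A -> U \subset A -> (forall a, a \in A -> exists2 u, u \in U & r a u) -> conn s U.
Proof.
move=> rs rr r3 /connP cA UA net; apply/connP => B BU B0 BnU.
(* The part of [A] within one link of [B]. If it is all of [A], an element of [U] outside [B] is
   linked to [B]; otherwise a link leaving it, preceded by the link from [B] and followed by a link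
   into the net, gives the required triple. *)
pose AB := [set a in A | [exists b in B, r a b]].
have BAB : B \subset AB.
  apply/subsetP => b bB; rewrite inE (subsetP UA) ?(subsetP BU) //=.
  by apply/existsP; exists b; rewrite bB rr.
have [ABA|ABA] := eqVneq AB A.
  have /existsP[u /andP[uU uB]] : [exists u, (u \in U) && (u \notin B)].
    rewrite -[X in is_true X]negbK; apply/negP => /existsPn h; move/eqP: BnU; apply; apply/eqP.
    rewrite eqEsubset BU; apply/subsetP => u uU; have := h u; by rewrite uU negbK.
  have : u \in AB by rewrite ABA (subsetP UA).
  rewrite inE => /andP[_ /existsP[b /andP[bB rub]]].
  by exists b, u; split=> //; apply: (r3 b u u u); rewrite ?rr // rs.
have [|//|a [c [aAB cA' cAB rac]]] := cA AB _ _ ABA.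
- by apply/subsetP => a; rewrite inE => /andP[].
- by case/set0Pn: B0 => b bB; apply/set0Pn; exists b; exact: (subsetP BAB).
move: aAB; rewrite inE => /andP[aA /existsP[b /andP[bB rab]]].
have [u uU rcu] := net c cA'.
exists b, u; split=> //; last by apply: (r3 b a c u) => //; rewrite rs.
apply/negP => uB; move/negP: cAB; apply; rewrite inE cA' /=.
by apply/existsP; exists u; rewrite uB.
Qed.

Section Walk.
Variables (T : finType) (mv : V -> T -> V) (r : rel V).
Hypotheses (r_sym : symmetric r) (r_mv : forall u v, r u v -> exists t, mv u t = v).

Definition visited u (ts : seq T) : {set V} := [set v in u :: scanl mv u ts].

Lemma walk_prefix u ts b : b \in u :: scanl mv u ts ->
  exists ts1 ts2, ts = ts1 ++ ts2 /\ foldl mv u ts1 = b.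
Proof.
elim: ts u => [|t ts IH] u /=; first by rewrite inE => /eqP ->; exists [::], [::].
rewrite inE; case/orP => [/eqP ->|/IH [ts1 [ts2 [-> <-]]]]; first by exists [::], (t :: ts).
by exists (t :: ts1), ts2.
Qed.

(** Grow the visited set along cuts: a new vertex is inserted as a detour out and back at a visit of
    its neighbour, at the price of two steps. Hence connected sets are no more numerous than
    starting points with walks of twice the length. *)
Lemma walk_exists U u : conn r U -> u \in U ->
  exists ts : seq T, size ts = (2 * #|U|.-1)%N /\ visited u ts = U.
Proof.
move=> /connP cU uU.
have main n : (n < #|U|)%N -> exists ts, [/\ size ts = (2 * n)%N,
    visited u ts \subset U & #|visited u ts| = n.+1].
  elim: n => [|n IH] hn.
    exists [::]; split=> //; last by rewrite /visited (_ : [set v in _] = [set u]) ?cards1 //;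
      apply/setP => v; rewrite !inE.
    by apply/subsetP => v; rewrite !inE => /eqP ->.
  have [ts [sts tU ct]] := IH (ltnW hn).
  have n0 : visited u ts != finset.set0 by apply/set0Pn; exists u; rewrite !inE eqxx.
  have nU : visited u ts != U by apply: contraTneq hn => e; rewrite -e ct ltnn.
  have [b [c [bB cU' cB rbc]]] := cU _ tU n0 nU.
  have := bB; rewrite inE => /walk_prefix[ts1 [ts2 [tsE bE]]].
  have [t tE] := r_mv rbc; have [t' tE'] : exists t', mv c t' = b by apply: r_mv; rewrite r_sym.
  have vE : visited u (ts1 ++ [:: t, t' & ts2]) = c |: visited u ts.
    apply/setP => v; rewrite tsE !inE !scanl_cat /= bE tE tE' !mem_cat /= !inE.
    have : b \in u :: scanl mv u ts1.
      rewrite -bE; case/lastP: (ts1) => [|q t0]; first by rewrite inE eqxx.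
      by rewrite -cats1 scanl_cat foldl_cat /= !(inE, mem_cat) eqxx !orbT.
    rewrite inE; case: (eqVneq v b) => [->|_].
      by case/orP => ->; rewrite ?orbT.
    by move=> _; case: (v == u); case: (v \in scanl mv u ts1); case: (v == c); case: (_ \in _).
  exists (ts1 ++ [:: t, t' & ts2]); split.
  - by move: sts; rewrite tsE !size_cat /=; lia.
  - by rewrite vE subUset sub1set cU'.
  - by rewrite vE cardsU1 cB ct.
have U0 : (0 < #|U|)%N by apply/card_gt0P; exists u.
have [|ts [s1 s2 s3]] := main #|U|.-1; first by rewrite prednK.
by exists ts; split=> //; apply/eqP; rewrite eqEcard s2 s3 prednK // leqnn.
Qed.

Lemma card_conn n : (#|[set U | conn r U & #|U| == n.+1]| <= #|V| * #|T| ^ (2 * n))%N.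
Proof.
rewrite -(card_tuple (2 * n) T) -card_prod.
pose f (p : V * (2 * n).-tuple T) := visited p.1 p.2.
apply: leq_trans (leq_imset_card f _); apply: subset_leq_card; apply/subsetP => U.
rewrite inE => /andP[cU /eqP cardU].
have /card_gt0P[u uU] : (0 < #|U|)%N by rewrite cardU.
have [ts [sts vts]] := walk_exists cU uU; rewrite cardU /= in sts.
apply/imsetP; exists (u, tcast sts (in_tuple ts)) => //.
by rewrite /f /= val_tcast.
Qed.
End Walk.

End CutConnected.

(** * Links between vertices, covers of clusters and the isoperimetric gap *)

Section Links.
Variable d : nat.
Implicit Types (u v w a c : cube d) (i j : 'I_d) (S T A B U G : {set cube d}).

(** Having a common neighbour, that is, being at distance 2, or equal when d > 0. *)
Definition lk a c : bool := ~~ [disjoint nb a & nb c].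
Definition lk3 a e : bool := [exists b, exists c, [&& lk a b, lk b c & lk c e]].

Lemma lkP a c : reflect (exists i j, c = flip (flip a i) j) (lk a c).
Proof.
apply: (iffP idP) => [|[i [j ->]]].
  rewrite /lk -setI_eq0 => /set0Pn[w]; rewrite in_setI => /andP[/imsetP[i _ ->] /imsetP[j _ e]].
  by exists i, j; rewrite e flipK.
rewrite /lk -setI_eq0; apply/set0Pn; exists (flip a i); rewrite in_setI imset_f //=.
by rewrite -{1}(flipK j (flip a i)) imset_f.
Qed.

Lemma lk_sym : symmetric lk.
Proof. by move=> a c; rewrite /lk disjoint_sym. Qed.

Lemma lk_refl : (0 < d)%N -> reflexive lk.
Proof. by move=> d0 a; apply/lkP; exists (Ordinal d0), (Ordinal d0); rewrite flipK. Qed.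

Lemma lk3_sym : symmetric lk3.
Proof.
suff h a e : lk3 a e -> lk3 e a by move=> a e; apply/idP/idP; exact: h.
case/existsP => b /existsP[c /and3P[h1 h2 h3]].
apply/existsP; exists c; apply/existsP; exists b; by rewrite (lk_sym e c) h3 (lk_sym c b) h2 (lk_sym b a) h1.
Qed.

Definition mv2 a (t : 'I_d * 'I_d) : cube d := flip (flip a t.1) t.2.
Definition mv6 a (t : ('I_d * 'I_d) * ('I_d * 'I_d) * ('I_d * 'I_d)) : cube d :=
  mv2 (mv2 (mv2 a t.1.1) t.1.2) t.2.

Lemma lk_mv a c : lk a c -> exists t, mv2 a t = c.
Proof. by case/lkP => i [j ->]; exists (i, j). Qed.

Lemma lk3_mv a e : lk3 a e -> exists t, mv6 a t = e.
Proof.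
case/existsP => b /existsP[c /and3P[/lk_mv[t1 <-] /lk_mv[t2 <-] /lk_mv[t3 <-]]].
by exists (t1, t2, t3).
Qed.

Lemma card_conn_le (r : rel (cube d)) m n :
  (forall s, #|[set U : {set cube d} | conn r U & #|U| == s.+1]| <= 2 ^ d * (d ^ m) ^ (2 * s))%N ->
  (0 < d)%N ->
  (#|[set U : {set cube d} | [&& conn r U, 0 < #|U| & #|U| <= n]]| <= n * (2 ^ d * (d ^ m) ^ (2 * n)))%N.
Proof.
move=> h d0; have -> : (n * (2 ^ d * (d ^ m) ^ (2 * n)) = \sum_(s < n) 2 ^ d * (d ^ m) ^ (2 * n))%N.
  by rewrite sum_nat_const card_ord.
apply: (@leq_trans (\sum_(s < n) #|[set U : {set cube d} | conn r U & #|U| == s.+1]|)); last first.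
  apply: leq_sum => s _; apply: leq_trans (h s) _; rewrite leq_mul2l; apply/orP; right.
  by rewrite leq_pexp2l ?expn_gt0 ?d0 // leq_mul2l ltnW.
apply: (@leq_trans #|\bigcup_(s < n) [set U : {set cube d} | conn r U & #|U| == s.+1]|).
  apply: subset_leq_card; apply/subsetP => U; rewrite inE => /and3P[cU U0 Un].
  have lt : (#|U|.-1 < n)%N by rewrite prednK.
  by apply/bigcupP; exists (Ordinal lt) => //; rewrite inE cU /= prednK.
elim/big_rec2: _ => [|v m' B' _ hm]; first by rewrite cards0.
by apply: leq_trans (leq_card_setU _ _) _; rewrite leq_add2l.
Qed.

Lemma card_conn_lk n : (0 < d)%N ->
  (#|[set U : {set cube d} | [&& conn lk U, 0 < #|U| & #|U| <= n]]| <= n * (2 ^ d * (d ^ 2) ^ (2 * n)))%N.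
Proof.
move=> d0; apply: card_conn_le => // s.
have := card_conn lk_sym lk_mv s.
by rewrite -[#|cube d|]cardsT card_cube card_prod card_ord.
Qed.

Lemma card_conn_lk3 n : (0 < d)%N ->
  (#|[set U : {set cube d} | [&& conn lk3 U, 0 < #|U| & #|U| <= n]]| <= n * (2 ^ d * (d ^ 6) ^ (2 * n)))%N.
Proof.
move=> d0; apply: card_conn_le => // s.
have := card_conn lk3_sym lk3_mv s.
rewrite -[#|cube d|]cardsT card_cube !card_prod card_ord.
by have -> : (d * d * (d * d) * (d * d) = d ^ 6)%N by rewrite !expnS expn0; lia.
Qed.

Lemma NB_side b A : A \subset side d b -> NB A \subset side d (~~ b).
Proof.
move=> Ab; apply/subsetP => v; rewrite in_NB => /card_gt0P[i]; rewrite inE => /(subsetP Ab).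
by rewrite flip_side.
Qed.

Lemma card_NB_le A : (#|NB A| <= #|A| * d)%N.
Proof.
have -> : NB A = \bigcup_(u in A) nb u.
  apply/setP => v; rewrite in_NB; apply/card_gt0P/bigcupP => [[i]|[u uA /imsetP[i _ ->]]].
    by rewrite inE => fA; exists (flip v i) => //; rewrite nb_sym imset_f.
  by exists i; rewrite inE flipK.
rewrite -sum_nat_const; elim/big_rec2: _ => [|v m' B' _ hm]; first by rewrite cards0.
by apply: leq_trans (leq_card_setU _ _) _; rewrite card_nb leq_add2l.
Qed.

Definition core tau U : {set cube d} := [set v | (tau <= kk U v)%N].
Definition shell b tau k U : {set cube d} :=
  [set u in side d b | (#|[set i | (kk U (flip u i) < tau)%N]| <= k)%N].

Lemma core_NB tau U : (0 < tau)%N -> core tau U \subset NB U.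
Proof. by move=> t0; apply/subsetP => v; rewrite in_NB inE; exact: leq_trans. Qed.

Lemma shell_degree b tau k U u : u \in shell b tau k U -> (d - k <= kk (core tau U) u)%N.
Proof.
rewrite inE => /andP[_ h]; have := cardsC [set i | (kk U (flip u i) < tau)%N].
rewrite card_ord => e; rewrite leq_subLR -{1}e leq_add //.
by apply: subset_leq_card; apply/subsetP => i; rewrite !inE -leqNgt.
Qed.

(** Elements outside the cover have nearly all their neighbours in the core, so given [U] the
    cluster is determined by a subset of the shell. Every element is linked to [U], hence [U] itself
    is connected by triple links. *)
Lemma cover_exists A h tau : (0 < h)%N -> (0 < tau)%N -> (tau * h < d)%N -> conn lk A -> A != finset.set0 ->
  exists U, [/\ U \subset A, conn lk3 U, (0 < #|U|)%N, (#|U| * h <= tau * #|NB A|)%N &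
   forall b, A \subset side d b -> A :\: U \subset shell b tau (tau * h) U].
Proof.
move=> h0 t0 thd cA A0.
have [U [UA cU hU]] := @greedy_cover_iter d h A tau h0.
have d0 : (0 < d)%N by lia.
have net a : a \in A -> exists2 u, u \in U & lk a u.
  move=> aA; have [aU|aU] := boolP (a \in U); first by exists a => //; exact: lk_refl.
  have aAU : a \in A :\: U by rewrite in_setD aU.
  have := hU a aAU => hc.
  have /card_gt0P[i] : (0 < #|~: [set i | (kk U (flip a i) < tau)%N]|)%N.
    by have := cardsC [set i | (kk U (flip a i) < tau)%N]; rewrite card_ord; lia.
  rewrite !inE -leqNgt => hi; have /card_gt0P[j] := leq_trans t0 hi.
  by rewrite inE => fU; exists (flip (flip a i) j) => //; apply/lkP; exists i, j.
exists U; split=> //.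
- apply: (conn_net lk_sym (lk_refl d0) _ cA UA net) => a b c e h1 h2 h3.
  by apply/existsP; exists b; apply/existsP; exists c; rewrite h1 h2.
- by case/set0Pn: A0 => a /net[u uU _]; apply/card_gt0P; exists u.
by move=> b Ab; apply/subsetP => u uAU; rewrite inE hU // andbT; move: uAU; rewrite in_setD => /andP[_ /(subsetP Ab)].
Qed.

Section Gap.
Variables (R : realType) (s c : R) (b : bool) (tau k : nat).
Hypotheses (tau0 : (0 < tau)%N) (c0 : 0 < c) (c1 : c < 1) (kd : 4 * k%:R <= c * d%:R) (d0 : (0 < d)%N).
Hypothesis s_small : 3 * (d%:R * s ^+ d) <= expR ((1 - c) * (d%:R * ln 2)).

(** Each shell vertex sends nearly d edges into the core. If the core were not larger, shell and
    core together would have average internal degree near d, whereas isoperimetry allows only (1 -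
    c) d for so small a set. *)
Lemma shell_gap U : U \subset side d b -> #|U|%:R <= s ^+ d ->
  (1 + c / 2) * #|shell b tau k U|%:R <= #|core tau U|%:R.
Proof.
move=> Ub Us; set V := shell b tau k U; set G := core tau U.
have Gs : G \subset side d (~~ b) by apply: subset_trans (core_NB _ tau0) (NB_side Ub).
have Vs : V \subset side d b by apply/subsetP => u; rewrite inE => /andP[].
pose T := V :|: G.
have TV : T :&: side d b = V.
  rewrite setIUl (setIidPl Vs); apply/setUidPl.
  by rewrite (subset_trans (setSI _ Gs)) // setIC (disjoint_setI0 (side_disj _ _)) sub0set.
have TG : T :&: side d (~~ b) = G.
  rewrite setIUl (setIidPl Gs); apply/setUidPr.
  by rewrite (subset_trans (setSI _ Vs)) // (disjoint_setI0 (side_disj _ _)) sub0set.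
have cT : #|T| = (#|V| + #|G|)%N.
  rewrite cardsU (_ : V :&: G = finset.set0) ?cards0 ?subn0 //; apply/eqP; rewrite -subset0.
  by rewrite -(disjoint_setI0 (side_disj d b)) setISS.
have e1 : (#|V| * (d - k) <= es b T)%N.
  rewrite /es TV -sum_nat_const; apply: leq_sum => u /shell_degree h; apply: leq_trans h _.
  by apply: kk_sub; exact: subsetUr.
have e2 : (es b T <= #|G| * d)%N.
  rewrite -es_side /es TG -sum_nat_const; apply: leq_sum => u _; exact: kk_le.
have := edge_iso R T; rewrite -(es_double b) -mul2n natrM => iso.
have dR : 0 < d%:R :> R by rewrite ltr0n.
have kdn : (k <= d)%N.
  rewrite -(ler_nat R); have : c * d%:R <= d%:R by rewrite ler_piMl // ltW.
  by move: kd; have := ler0n R k; lra.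
have dk : (d - k)%N%:R = d%:R - k%:R :> R by rewrite natrB.
have e1R : #|V|%:R * (d%:R - k%:R) <= (es b T)%:R :> R by rewrite -dk -natrM ler_nat.
have e2R : (es b T)%:R <= #|G|%:R * d%:R :> R by rewrite -natrM ler_nat.
have GR : #|G|%:R <= d%:R * s ^+ d.
  apply: (le_trans (y := (#|U| * d)%N%:R)).
    by rewrite ler_nat (leq_trans (subset_leq_card (core_NB _ tau0))) // card_NB_le.
  by rewrite natrM mulrC ler_wpM2l // ltW.
have VG : #|V|%:R <= 2 * #|G|%:R :> R.
  have h1 : #|V|%:R * (d%:R - k%:R) <= #|G|%:R * d%:R := le_trans e1R e2R.
  have h2 : d%:R <= 2 * (d%:R - k%:R) :> R.
    have : c * d%:R <= d%:R by rewrite ler_piMl // ltW.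
    by move: kd; lra.
  have h3 := ler_wpM2l (ler0n R #|V|) h2.
  rewrite -(ler_pM2r dR); move: h3 h1; rewrite mulrCA; lra.
have [T0|Tpos] := posnP #|T|.
  by move/eqP: T0; rewrite cT addn_eq0 => /andP[/eqP -> _]; rewrite mulr0.
have TR : 0 < #|T|%:R :> R by rewrite ltr0n.
have lT : ln #|T|%:R <= (1 - c) * (d%:R * ln 2).
  rewrite -[leRHS]expRK ler_ln ?posrE ?expR_gt0 //; apply: le_trans s_small.
  by rewrite cT natrD; lra.
have l2 : 0 < ln 2 :> R by rewrite ln_gt0 // ltr1n.
have h : 2 * (#|V|%:R * (d%:R - k%:R)) <= #|T|%:R * ((1 - c) * d%:R).
  rewrite -(ler_pM2r l2).
  apply: (le_trans (y := 2 * (es b T)%:R * ln 2)); first by rewrite ler_pM2r // ler_pM2l.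
  apply: (le_trans iso); rewrite -!mulrA; exact: ler_wpM2l.
have h2 : 2 * (#|V|%:R * ((1 - c / 4) * d%:R)) <= #|T|%:R * ((1 - c) * d%:R).
  apply: le_trans h; rewrite ler_pM2l // ler_wpM2l //; move: kd; lra.
have h3 : 2 * (#|V|%:R * (1 - c / 4)) <= #|T|%:R * (1 - c).
  by rewrite -(ler_pM2r dR) -!mulrA.
have cc : 0 < 1 - c by rewrite subr_gt0.
rewrite -(ler_pM2r cc); move: h3; rewrite cT natrD.
have V0 : 0 <= #|V|%:R :> R by [].
have cV : 0 <= c * #|V|%:R by rewrite mulr_ge0 // ltW.
have : 0 <= c * (c * #|V|%:R) by rewrite mulr_ge0 // ltW.
move: cV; by move: (#|V|%:R : R) (#|G|%:R : R) V0 => p q; lra.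
Qed.
End Gap.

End Links.

(** * Weights of clusters *)

Section Weights.
Variables (R : realType) (x : R) (d : nat) (b : bool).
Hypotheses (x_gt0 : 0 < x) (x_le : x <= 3^-1).
Implicit Types (u v w a c : cube d) (i j : 'I_d) (S T A B U G : {set cube d}).

(** The total annealed weight of all sets whose part on side [b] is [A], divided by its value for
    the empty part. *)
Definition wgt A : R := \prod_(v in side d (~~ b)) ((1 + x ^+ kk A v) / 2).

Let x0 : 0 <= x. Proof. exact: ltW. Qed.
Let x1 : x <= 1. Proof. by rewrite (le_trans x_le) // invf_le1 // ler1n. Qed.

Lemma wgt_gt0 A : 0 < wgt A.
Proof. by apply: prodr_gt0 => v _; rewrite divr_gt0 // ltr_pwDl // exprn_ge0. Qed.

Lemma wgt_NB A : A \subset side d b -> wgt A = \prod_(v in NB A) ((1 + x ^+ kk A v) / 2).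
Proof.
move=> Ab; rewrite /wgt (big_setID (NB A)) /= (setIidPr (NB_side Ab)) [X in _ * X]big1 ?mulr1 //.
move=> v; rewrite in_setD in_NB lt0n negbK => /andP[/eqP -> _].
by rewrite expr0 divff.
Qed.

Lemma wgt_le U A tau : (0 < tau)%N -> U \subset A -> A \subset side d b ->
  wgt A <= ((1 + x ^+ tau) / 2) ^+ #|core tau U| * ((1 + x) / 2) ^+ (#|NB A| - #|core tau U|).
Proof.
move=> t0 UA Ab; have GN : core tau U \subset NB A.
  exact: subset_trans (core_NB _ t0) (NBS UA).
rewrite wgt_NB // (big_setID (core tau U)) /= (setIidPr GN).
have p k : 0 <= (1 + x ^+ k) / 2 by rewrite divr_ge0 // addr_ge0 // exprn_ge0.
have h1 : \prod_(v in core tau U) ((1 + x ^+ kk A v) / 2) <= ((1 + x ^+ tau) / 2) ^+ #|core tau U|.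
  rewrite -prodr_const; apply: ler_prod => v; rewrite inE => tv; rewrite p /=.
  rewrite ler_pM2r ?invr_gt0 // lerD2l ler_wiXn2l //.
  by apply: leq_trans tv _; exact: kk_sub.
have h2 : \prod_(v in NB A :\: core tau U) ((1 + x ^+ kk A v) / 2) <=
    ((1 + x) / 2) ^+ (#|NB A| - #|core tau U|).
  rewrite -{2}(setIidPr GN) -cardsD -prodr_const; apply: ler_prod => v.
  rewrite in_setD in_NB => /andP[_ kv]; rewrite p /=.
  by rewrite ler_pM2r ?invr_gt0 // lerD2l -[leRHS]expr1 ler_wiXn2l.
by apply: ler_pM => //; apply: prodr_ge0.
Qed.

Section PerCover.
Variables (tau k K : nat) (y : R).
Hypotheses (tau0 : (0 < tau)%N) (K0 : (0 < K)%N) (xK : (1 + x ^+ tau) ^+ K <= 3 / 2).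
Hypotheses (y0 : 0 < y) (yK : 3 / 4 <= y ^+ K) (y23 : 2 / 3 <= y).

(** The 2^V choices inside the shell are paid by factors close to 1/2, one per core vertex. Raising
    to the power [K] avoids roots: 2^(K-1) (3/2) / 2^K = 3/4. *)
Lemma cover_weight (V G : nat) : (K * V <= K.-1 * G)%N ->
  2 ^+ V * ((1 + x ^+ tau) / 2) ^+ G <= y ^+ G.
Proof.
move=> h; have p : 0 <= (1 + x ^+ tau) / 2 by rewrite divr_ge0 // addr_ge0 // exprn_ge0.
rewrite -(@ler_pXn2r _ K) ?nnegrE ?mulr_ge0 ?exprn_ge0 ?(ltW y0) //.
rewrite exprMn -!exprM [(V * K)%N]mulnC.
apply: (le_trans (y := 2 ^+ (K.-1 * G) * ((1 + x ^+ tau) / 2) ^+ (G * K))).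
  by rewrite ler_wpM2r ?exprn_ge0 // ler_weXn2l // ler1n.
rewrite [(G * K)%N]mulnC !exprM -exprMn; apply: lerXn2r.
- by rewrite nnegrE mulr_ge0 ?exprn_ge0.
- by rewrite nnegrE exprn_ge0 // ltW.
have e2 : (2 : R) ^+ K = 2 * 2 ^+ K.-1 by rewrite -exprS prednK.
apply: le_trans yK; rewrite expr_div_n e2.
have e0 : (2 : R) ^+ K.-1 != 0 by rewrite expf_neq0.
have -> : 2 ^+ K.-1 * ((1 + x ^+ tau) ^+ K / (2 * 2 ^+ K.-1)) = (1 + x ^+ tau) ^+ K / 2 by field.
by move: xK; lra.
Qed.

(** Core vertices pay for the choice of the cluster; each other neighbour contributes at most (1 +
    x)/2 <= 2/3 <= y. *)
Lemma sum_per_cover U g : (K * #|shell b tau k U| <= K.-1 * #|core tau U|)%N ->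
  \sum_(A : {set cube d} | [&& A \subset side d b, U \subset A, A :\: U \subset shell b tau k U & #|NB A| == g]) wgt A
  <= y ^+ g.
Proof.
move=> h.
pose P A := [&& A \subset side d b, U \subset A, A :\: U \subset shell b tau k U & #|NB A| == g].
have [/existsP[A0 /and4P[_ UA0 _ /eqP gE]]|/existsPn no] := boolP [exists A, P A]; last first.
  by rewrite big1 ?exprn_ge0 // ?ltW // => A PA; have := no A; rewrite /P PA.
have Gg : (#|core tau U| <= g)%N.
  rewrite -gE; apply: subset_leq_card; exact: subset_trans (core_NB _ tau0) (NBS UA0).
pose Bd := ((1 + x ^+ tau) / 2) ^+ #|core tau U| * ((1 + x) / 2) ^+ (g - #|core tau U|).
have Bd0 : 0 <= Bd by rewrite mulr_ge0 // exprn_ge0 // divr_ge0 // addr_ge0 // exprn_ge0.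
apply: (le_trans (y := \sum_(A | P A) Bd)).
  by apply: ler_sum => A /and4P[Ab UA _ /eqP gA]; rewrite /Bd -gA; exact: wgt_le.
rewrite sumr_const.
have cP : (#|P| <= 2 ^ #|shell b tau k U|)%N.
  rewrite -card_powerset -(card_in_imset (f := fun A => A :\: U) (D := P)); last first.
    move=> A A' /and4P[_ UA _ _] /and4P[_ UA' _ _] e.
    by rewrite -(setID A U) -(setID A' U) (setIidPr UA) (setIidPr UA') e.
  apply: subset_leq_card; apply/subsetP => _ /imsetP[A /and4P[_ _ AS _] ->].
  by rewrite powersetE.
rewrite -mulr_natl; apply: (le_trans (y := 2 ^+ #|shell b tau k U| * Bd)).
  by rewrite ler_wpM2r // -natrX ler_nat.
rewrite /Bd mulrA -{2}(subnKC Gg) exprD; apply: ler_pM.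
- by rewrite mulr_ge0 ?exprn_ge0 // divr_ge0 // addr_ge0 // exprn_ge0.
- by rewrite exprn_ge0 // divr_ge0 // addr_ge0.
- exact: cover_weight.
- by rewrite lerXn2r ?nnegrE ?(ltW y0) ?divr_ge0 ?addr_ge0 //; move: x_le y23; lra.
Qed.

Variables (s : R) (h : nat).
Hypotheses (h0 : (0 < h)%N) (k_def : k = (tau * h)%N) (thd : (tau * h < d)%N).
Hypothesis gap : forall U, U \subset side d b -> #|U|%:R <= s ^+ d ->
  (K * #|shell b tau k U| <= K.-1 * #|core tau U|)%N.

Definition clust A : bool := [&& A \subset side d b, conn (@lk d) A, (1 < #|A|)%N & #|A|%:R <= s ^+ d].

(** Sum over the possible covers, which have at most tau g / h elements and are connected by triple
    links. *)
Lemma sum_cluster_NB g :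
  \sum_(A | clust A && (#|NB A| == g)) wgt A <=
  ((tau * g) %/ h * (2 ^ d * (d ^ 6) ^ (2 * ((tau * g) %/ h))))%N%:R * y ^+ g.
Proof.
have d0 : (0 < d)%N by exact: leq_ltn_trans thd.
set n := ((tau * g) %/ h)%N.
pose UU := [set U : {set cube d} | [&& conn (@lk3 d) U, 0 < #|U| & #|U| <= n]%N].
pose gd U := (U \subset side d b) && (#|U|%:R <= s ^+ d).
apply: (le_trans (y := \sum_(U in UU | gd U) \sum_(A : {set cube d} | [&& A \subset side d b, U \subset A,
    A :\: U \subset shell b tau k U & #|NB A| == g]) wgt A)).
  rewrite (exchange_big_dep xpredT) //= big_mkcond /=; apply: ler_sum => A _.
  have w0 : 0 <= wgt A by exact: ltW (wgt_gt0 A).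
  case: ifP => [/andP[/and4P[Ab cA A1 As] gE]|_]; last by apply: sumr_ge0 => *.
  have A0 : A != finset.set0 by rewrite -card_gt0 ltnW.
  have [U [UA cU U0 Uh AS]] := cover_exists h0 tau0 thd cA A0.
  rewrite (bigD1 U) /=; first by rewrite lerDl; apply: sumr_ge0 => *.
  rewrite Ab UA k_def AS // gE /gd (subset_trans UA Ab) inE cU U0 /= !andbT; apply/andP; split.
    by rewrite /n leq_divRL // -(eqP gE).
  by apply: le_trans As; rewrite ler_nat subset_leq_card.
apply: (le_trans (y := \sum_(U in UU | gd U) y ^+ g)).
  by apply: ler_sum => U /andP[_ /andP[Ub Us]]; apply: sum_per_cover; exact: gap.
apply: (le_trans (y := \sum_(U in UU) y ^+ g)).
  rewrite big_mkcondr /=; apply: ler_sum => U _; case: ifP => // _.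
  by rewrite exprn_ge0 // ltW.
rewrite sumr_const -[y ^+ g *+ _]mulr_natl; apply: ler_wpM2r; first by rewrite exprn_ge0 // ltW.
rewrite ler_nat; exact: card_conn_lk3.
Qed.

End PerCover.

Lemma wgt_small A : A \subset side d b -> wgt A <= (2 / 3) ^+ #|NB A|.
Proof.
move=> Ab; have := @wgt_le A A 1 isT (subxx _) Ab; rewrite expr1.
have e : core 1 A = NB A by [].
rewrite e subnn expr0 mulr1 => /le_trans; apply.
by rewrite lerXn2r ?nnegrE ?divr_ge0 ?addr_ge0 //; move: x_le; lra.
Qed.

End Weights.

Section ExpSmall2.
Variable R : realType.

Lemma esmall_lt (f : nat -> R) e : esmall f -> 0 < e -> exists n0, forall n, (n0 <= n)%N -> f n <= e.
Proof.
move=> [C [r [C0 r0 r1 [m h]]]] e0.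
pose q := Num.sqrt r.
have q0 : 0 < q by rewrite sqrtr_gt0.
have q1 : q < 1 by rewrite -sqrtr1 ltr_sqrt.
have qq : q * q = r by rewrite -expr2 sqr_sqrtr // ltW.
have D0 : 0 <= (1 - q)^-1 by rewrite invr_ge0 subr_ge0 ltW.
have CD0 : 0 <= C * (1 - q)^-1 / e by rewrite divr_ge0 ?mulr_ge0 // ltW.
exists (maxn m (Num.bound (C * (1 - q)^-1 / e)).+1) => n; rewrite geq_max => /andP[mn n1].
apply: (le_trans (h n mn)).
have nb : C * (1 - q)^-1 / e <= n%:R.
  apply: (le_trans (ltW (archi_boundP CD0))); by rewrite ler_nat ltnW.
have np : 0 < n%:R :> R by rewrite ltr0n; exact: leq_ltn_trans n1.
have g1 := natr_expr_le n (ltW q0) q1.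
rewrite -(ler_pM2l np) mulrCA -qq exprMn.
apply: (le_trans (y := C * (1 - q)^-1)); last by rewrite -ler_pdivrMr.
apply: ler_wpM2l => //; rewrite mulrA -[leRHS]mulr1; apply: ler_pM => //.
- by rewrite mulr_ge0 // exprn_ge0 // ltW.
- by rewrite exprn_ge0 // ltW.
- by rewrite exprn_ile1 // ltW.
Qed.

Lemma esmall_natrX k (f : nat -> R) : esmall f -> esmall (fun n => n%:R ^+ k * f n).
Proof.
elim: k => [|k IH] hf.
  by apply: (esmall_le (n0 := 0)) hf => n _; rewrite expr0 mul1r.
by apply: (esmall_le (n0 := 0)) (esmall_natr (IH hf)) => n _; rewrite exprS mulrA.
Qed.

Lemma sum_geometric_tail (r : R) m n : 0 <= r -> r < 1 ->
  \sum_(g < n | (m <= g)%N) r ^+ g <= r ^+ m / (1 - r).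
Proof.
move=> r0 r1; have p : 0 < 1 - r by rewrite subr_gt0.
rewrite ler_pdivlMr // big_mkcond /=.
have [nm|mn] := leqP n m.
  rewrite big1 ?mul0r ?exprn_ge0 // => i _; rewrite leqNgt (leq_trans (ltn_ord i) nm) //.
have -> : \sum_(i < n) (if (m <= i)%N then r ^+ i else 0) = \sum_(m <= i < n) r ^+ i.
  rewrite -(big_mkord xpredT (fun i => if (m <= i)%N then r ^+ i else 0)).
  rewrite (@big_cat_nat _ _ _ m) ?(ltnW mn) //= big_nat_cond big1 ?add0r.
    by rewrite !big_nat; apply: eq_bigr => i /andP[->].
  by move=> i /andP[/andP[_ im] _]; rewrite leqNgt im.
rewrite -{1}[m]add0n big_addn big_mkord.
have -> : \sum_(i < n - m) r ^+ (i + m) = r ^+ m * \sum_(i < n - m) r ^+ i.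
  by rewrite mulr_sumr; apply: eq_bigr => i _; rewrite exprD mulrC.
have := subrX1 r (n - m); have h2 := exprn_ge0 (n - m) r0; have h3 := exprn_ge0 m r0.
move=> h; have -> : r ^+ m * (\sum_(i < n - m) r ^+ i) * (1 - r) = r ^+ m * (1 - r ^+ (n - m)).
  by rewrite -mulrA; congr (_ * _); rewrite -[1 - r]opprB mulrN mulrC -h opprB.
by rewrite ler_piMr // lerBlDr lerDl.
Qed.

End ExpSmall2.

Lemma subset_card (T : finType) (A : {set T}) m : (m <= #|A|)%N ->
  exists B : {set T}, B \subset A /\ #|B| = m.
Proof.
elim: m => [|m IH] mA; first by exists finset.set0; rewrite sub0set cards0.
have [B [BA cB]] := IH (ltnW mA).
have : (0 < #|A :\: B|)%N by rewrite cardsD (setIidPr BA) cB subn_gt0.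
case/card_gt0P => a; rewrite in_setD => /andP[aB aA].
by exists (a |: B); rewrite subUset sub1set aA BA cardsU1 aB cB.
Qed.

Lemma card_NB_sub d (A : {set cube d}) m : (m <= #|A|)%N -> (m * d <= #|NB A| + m * m.-1)%N.
Proof.
move=> /subset_card[B [BA <-]]; apply: leq_trans (card_NB_ge B) _.
by rewrite leq_add2r; exact/subset_leq_card/NBS.
Qed.

Lemma count_le (R : realType) n d :
  (n * (2 ^ d * (d ^ 6) ^ (2 * n)))%N%:R <= 2 ^+ d * (2 * d%:R ^+ 12) ^+ n :> R.
Proof.
have h : (n * (2 ^ d * (d ^ 6) ^ (2 * n)) <= 2 ^ d * (2 * d ^ 12) ^ n)%N.
  rewrite mulnCA leq_mul2l expnMn -expnM mulnA expnM; apply/orP; right.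
  by rewrite leq_mul2r; apply/orP; right; exact/ltnW/ltn_expl.
move: h; rewrite -(ler_nat R) => /le_trans; apply.
by rewrite natrM (natrX _ 2 d) (natrX _ _ n) natrM (natrX _ d 12).
Qed.

(** Shows that more than 2K elements have at least K d neighbours once d >= 8K. *)
Lemma small_degree_arith K d p : (8 * K <= d)%N ->
  (2 * K * d <= p + 2 * K * (2 * K).-1)%N -> (K * d <= p)%N.
Proof.
move=> h1 h2.
have h3 : (8 * (K * K) <= K * d)%N by rewrite mulnCA leq_mul2l h1 orbT.
have h4 : (2 * K * (2 * K).-1 <= 4 * (K * K))%N.
  apply: leq_trans (leq_mul (leqnn _) (leq_pred _)) _; lia.
have h5 : (2 * K * d = 2 * (K * d))%N by rewrite mulnA.
move: h2 h3 h4; rewrite h5; move: (2 * K * _)%N (K * d)%N (K * K)%N => a b c; lia.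
Qed.

Section ClusterSum.
Variables (R : realType) (x : R).
Hypotheses (x_gt0 : 0 < x) (x_le : x <= 3^-1).

Lemma sum_cluster_esmall (s : R) (b : bool) : 0 < s -> s < 2 ->
  esmall (fun d => \sum_(A : {set cube d} | clust b s A) wgt x b A).
Proof.
move=> s0 s2.
(* With s1 = 2^(1 - c), the room between s and s1 absorbs the factor 3d of [shell_gap], and s1 > 1
   keeps c < 1. *)
have [s1 [ss1 s11 s12]] : exists s1 : R, [/\ s < s1, 1 < s1 & s1 < 2].
  have h1 : s <= Num.max s 1 by rewrite le_max lexx.
  have h2 : 1 <= Num.max s 1 by rewrite le_max lexx orbT.
  have h3 : Num.max s 1 < 2 by rewrite gt_max s2 ltr1n.
  by exists ((Num.max s 1 + 2) / 2); split; move: h1 h2 h3; lra.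
have l2 : 0 < ln 2 :> R by rewrite ln_gt0 // ltr1n.
have ls1 : 0 < ln s1 by rewrite ln_gt0.
have ls12 : ln s1 < ln 2 by rewrite ltr_ln ?posrE // (lt_trans _ s11).
have [c [c0 c1 cE]] : exists c : R, [/\ 0 < c, c < 1 &
    forall d : nat, expR ((1 - c) * (d%:R * ln 2)) = s1 ^+ d].
  exists (1 - ln s1 / ln 2); split.
  - by rewrite subr_gt0 ltr_pdivrMr // mul1r.
  - by rewrite ltrBlDr ltrDl divr_gt0.
  move=> d; have -> : (1 - (1 - ln s1 / ln 2)) * (d%:R * ln 2) = d%:R * ln s1.
    by rewrite opprB addrC subrK mulrCA divfK // gt_eqF.
  by rewrite expRM_natl lnK // posrE (lt_trans _ s11).
have [d1 hd1] : exists d1, forall d, (d1 <= d)%N -> 3 * (d%:R * s ^+ d) <= s1 ^+ d.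
  have s1p : 0 < s1 by rewrite (lt_trans _ s11).
  have : esmall (fun d => 3 * (d%:R * (s / s1) ^+ d)).
    apply: esmallZ => //; apply: esmall_natr; apply: esmall_expr; first exact: divr_gt0.
    by rewrite ltr_pdivrMr // mul1r.
  move=> /esmall_lt /(_ ltr01)[d1 h]; exists d1 => d /h.
  by rewrite expr_div_n !mulrA ler_pdivrMr ?exprn_gt0 // mul1r.
(* Turns the gap 1 + c/2 into the ratio K / (K - 1). *)
have [K [K0 Kc]] : exists K, (0 < K)%N /\ 2 / c <= K.-1%:R.
  by exists (Num.bound (2 / c)).+1; split=> //; exact/ltW/archi_boundP/ltW/divr_gt0.
have KR : 0 < K%:R :> R by rewrite ltr0n.
have [tau [tau0 xK]] : exists tau, (0 < tau)%N /\ (1 + x ^+ tau) ^+ K <= 3 / 2.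
  have l32 : 0 < ln (3 / 2) / K%:R :> R by rewrite divr_gt0 ?ltr0n // ln_gt0 //; lra.
  have xs : esmall (fun n => x ^+ n) by apply: esmall_expr => //; apply: (le_lt_trans x_le); lra.
  have [t ht] := esmall_lt xs l32; exists t.+1; split=> //.
  have h := ht _ (leqnSn t).
  apply: (le_trans (y := expR (x ^+ t.+1) ^+ K)).
    rewrite lerXn2r ?nnegrE ?addr_ge0 ?exprn_ge0 ?expR_ge0 ?(ltW x_gt0) //; exact: expR_ge1Dx.
  have p32 : (0 : R) < 3 / 2 by lra.
  rewrite -expRM_natl -[leRHS]lnK ?posrE // ler_expR mulrC -ler_pdivlMr ?ltr0n //.
(* The K-th root of 3/4, raised to 2/3 if it is smaller. *)
have [y [y23 y0 y1 yK]] : exists y : R, [/\ 2 / 3 <= y, 0 < y, y < 1 & 3 / 4 <= y ^+ K].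
  have p34 : (0 : R) < 3 / 4 by rewrite divr_gt0.
  have p23 : (0 : R) < 2 / 3 by rewrite divr_gt0.
  pose z : R := expR (ln (3 / 4) / K%:R); have y23 : 2 / 3 <= Num.max (2 / 3 : R) z by rewrite le_max lexx.
  exists (Num.max (2 / 3 : R) z); split=> //.
  - exact: lt_le_trans y23.
  - rewrite gt_max; apply/andP; split; first by rewrite ltr_pdivrMr // mul1r ltr_nat.
    rewrite expR_lt1 pmulr_llt0 ?invr_gt0 // ln_lt0 // p34 /=.
    by rewrite ltr_pdivrMr // mul1r ltr_nat.
  apply: (le_trans (y := z ^+ K)).
    by rewrite /z -expRM_natl [K%:R * _]mulrC divfK ?gt_eqF // lnK // posrE.
  by rewrite lerXn2r ?nnegrE ?expR_ge0 ?(le_trans (ltW p23)) // le_max lexx orbT.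
(* With h = d / q rounded down, the tau h missing neighbours stay below c d / 4 while h remains
   linear in d. *)
have [q [q0 qc]] : exists q, (0 < q)%N /\ 4 * tau%:R / c <= q%:R.
  have h : 0 <= 4 * tau%:R / c by rewrite divr_ge0 ?mulr_ge0 // ltW.
  exists (Num.bound (4 * tau%:R / c)).+1; split=> //.
  by apply: (le_trans (ltW (archi_boundP h))); rewrite ler_nat.
(* The ratio eta = y' / y is the room for the number of covers: their size is O(g / d), so the
   polynomial factor per element amounts to at most eta^g for large d. *)
have [y' [y'0 y'1 yy']] : exists y' : R, [/\ 0 < y', y' < 1 & y < y'].
  by exists ((y + 1) / 2); rewrite divr_gt0 ?addr_gt0 // !midf_lt.
have [eta [eta1 etaE]] : exists eta : R, 1 < eta /\ eta * y = y'.
  by exists (y' / y); rewrite ltr_pdivlMr // mul1r divfK // gt_eqF.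
have leta : 0 < ln eta by rewrite ln_gt0.
have qt : (0 < 2 * q * tau)%N by rewrite !muln_gt0 q0 tau0.
have [kap [kap0 kapE]] : exists kap : R, 0 < kap /\ kap * (2 * q * tau)%N%:R = ln eta.
  by exists (ln eta / (2 * q * tau)%N%:R); rewrite divr_gt0 ?ltr0n // divfK // pnatr_eq0 -lt0n.
have [d2 hd2] : exists d2, forall d, (d2 <= d)%N -> 2 * d%:R ^+ 12 <= expR (kap * d%:R).
  have : esmall (fun d => 2 * (d%:R ^+ 12 * expR (- kap) ^+ d)).
    apply: esmallZ => //; apply: esmall_natrX; apply: esmall_expr; first exact: expR_gt0.
    by rewrite expR_lt1 oppr_lt0.
  move=> /esmall_lt /(_ ltr01)[d2 h]; exists d2 => d /h.
  rewrite expRN exprVn -expRM_natr mulrA ler_pdivrMr ?expR_gt0 // mul1r //.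
have y's : esmall (fun n => y' ^+ n) by exact: esmall_expr.
have q4 : 0 < 4^-1 :> R by rewrite invr_gt0.
have [K1 hK1] := esmall_lt y's q4.
(* Clusters with at least K2 d neighbours then total a constant multiple of 2^d 4^(-d). *)
have [K2 K2y] : exists K2, y' ^+ K2 <= 4^-1 by exists K1; exact: hK1.
pose D := maxn (maxn d1 d2) (maxn (2 * q) (8 * K2)).
(* clusters with large neighbourhood through their covers, the others have bounded size *)
pose f1 (d : nat) : R := (1 - y')^-1 * 2^-1 ^+ d.
pose f2 (d : nat) : R := ((2 * K2)%N%:R * (9 / 4)) * (d%:R ^+ (8 * K2) * (8 / 9) ^+ d).
have e12 : esmall (fun d => f1 d + f2 d).
  apply: esmallD; apply: esmallZ.
  - by rewrite invr_ge0 subr_ge0 ltW.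
  - by apply: esmall_expr; lra.
  - by rewrite mulr_ge0 //; lra.
  by apply: esmall_natrX; apply: esmall_expr; lra.
apply: (esmall_le (n0 := D)) e12 => d; rewrite /D !geq_max => /andP[/andP[dd1 dd2] /andP[dq dK]].
have d0 : (0 < d)%N by apply: leq_trans dq; rewrite muln_gt0 q0.
have dR : 0 < d%:R :> R by rewrite ltr0n.
pose h := (d %/ q)%N.
have h0 : (0 < h)%N by rewrite divn_gt0 // (leq_trans _ dq) // leq_pmull.
have hq : (h * q <= d)%N by exact: leq_trunc_div.
have dh : (d <= 2 * q * h)%N.
  apply: ltnW; apply: leq_trans (ltn_ceil d q0) _; rewrite -/h mulnAC leq_mul2r.
  by apply/orP; right; rewrite mul2n -addnn -addn1 leq_add2l.
have kd : 4 * (tau * h)%N%:R <= c * d%:R :> R.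
  have hqR : h%:R * q%:R <= d%:R :> R by rewrite -natrM ler_nat.
  have qc' : 4 * tau%:R <= q%:R * c by rewrite -ler_pdivrMr.
  rewrite natrM mulrA; apply: (le_trans (ler_wpM2r (ler0n R h) qc')).
  have -> : q%:R * c * h%:R = c * (h%:R * q%:R) by rewrite mulrAC mulrC [h%:R * _]mulrC.
  by rewrite ler_pM2l.
have thd : (tau * h < d)%N.
  rewrite -(ltr_nat R); have : c * d%:R < d%:R by rewrite gtr_pMl.
  by have := ler0n R (tau * h); move: kd; lra.
have gap (U : {set cube d}) : U \subset side d b -> #|U|%:R <= s ^+ d ->
    (K * #|shell b tau (tau * h) U| <= K.-1 * #|core tau U|)%N.
  move=> Ub Us; have := shell_gap tau0 c0 c1 kd d0 (_ : 3 * (d%:R * s ^+ d) <= _) Ub Us.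
  rewrite cE => /(_ (hd1 _ dd1)) G.
  have n0 : 0 <= K.-1%:R :> R by [].
  have := ler_wpM2l n0 G.
  have h1 : 1 <= K.-1%:R * (c / 2).
    have c20 : 0 <= c / 2 by rewrite divr_ge0 // ltW.
    have := ler_wpM2r c20 Kc.
    have -> : 2 / c * (c / 2) = 1 :> R by field; rewrite gt_eqF.
    by [].
  have h2 := ler_wpM2r (ler0n R #|shell b tau (tau * h) U|) h1.
  have KE : K%:R = K.-1%:R + 1 :> R by rewrite natr1 prednK.
  rewrite -(ler_nat R) !natrM KE.
  move: (K.-1%:R : R) (#|shell _ _ _ _|%:R : R) (#|core _ _|%:R : R) h2 => a v g.
  by lra.
have main g : \sum_(A : {set cube d} | clust b s A && (#|NB A| == g)) wgt x b A <= 2 ^+ d * y' ^+ g.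
  apply: le_trans (sum_cluster_NB x_gt0 x_le tau0 K0 xK y0 yK y23 h0 erefl thd gap g) _.
  set n := ((tau * g) %/ h)%N.
  have n1 : (n * (2 ^ d * (d ^ 6) ^ (2 * n)))%N%:R <= 2 ^+ d * (2 * d%:R ^+ 12) ^+ n :> R.
    exact: count_le.
  have n2 : (2 * d%:R ^+ 12) ^+ n <= eta ^+ g :> R.
    apply: (le_trans (y := expR (kap * d%:R) ^+ n)).
      by rewrite lerXn2r ?nnegrE ?expR_ge0 ?mulr_ge0 ?exprn_ge0 //; exact: hd2.
    have -> : eta ^+ g = expR (g%:R * ln eta) by rewrite expRM_natl lnK // posrE (lt_trans _ eta1).
    rewrite -expRM_natl ler_expR.
    have nh : (n * h <= tau * g)%N by exact: leq_trunc_div.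
    have dn : (d * n <= 2 * q * tau * g)%N.
      apply: leq_trans (leq_mul dh (leqnn n)) _.
      by rewrite -!mulnA !leq_mul2l [(h * n)%N]mulnC nh !orbT.
    have -> : n%:R * (kap * d%:R) = kap * (d * n)%N%:R by rewrite natrM; ring.
    apply: (le_trans (y := kap * (2 * q * tau * g)%N%:R)); first by rewrite ler_pM2l // ler_nat.
    by rewrite natrM mulrA kapE mulrC.
  apply: (le_trans (y := 2 ^+ d * eta ^+ g * y ^+ g)).
    rewrite ler_pM2r ?exprn_gt0 //; apply: (le_trans n1); by rewrite ler_pM2l ?exprn_gt0.
  by rewrite -mulrA -exprMn etaE.
rewrite (bigID (fun A : {set cube d} => (K2 * d <= #|NB A|)%N)) /=; apply: lerD.
  apply: (le_trans (y := \sum_(g < (2 ^ d).+1 | (K2 * d <= g)%N) 2 ^+ d * y' ^+ g)).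
    apply: (le_trans (y := \sum_(g < (2 ^ d).+1 | (K2 * d <= g)%N)
       \sum_(A : {set cube d} | clust b s A && (#|NB A| == g)) wgt x b A)); last first.
      by apply: ler_sum => g _; exact: main.
    rewrite (exchange_big_dep (fun A : {set cube d} => clust b s A)) /=; last first.
      by move=> g A _ /andP[].
    rewrite big_mkcondr /=; apply: ler_sum => A cA.
    have w0 : 0 <= wgt x b A by exact/ltW/wgt_gt0.
    case: ifP => hA; last by apply: sumr_ge0 => *.
    have lt : (#|NB A| < (2 ^ d).+1)%N by rewrite ltnS -card_cube cardsT max_card.
    rewrite (bigD1 (Ordinal lt)) /= ?hA ?cA ?eqxx // lerDl; by apply: sumr_ge0 => *.
  rewrite -mulr_sumr /f1 mulrC.
  apply: (le_trans (ler_wpM2r _ (sum_geometric_tail _ _ (ltW y'0) y'1))); first exact: exprn_ge0.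
  rewrite mulrAC mulrC ler_pM2l ?invr_gt0 ?subr_gt0 //.
  have -> : 2^-1 ^+ d = 4^-1 ^+ d * 2 ^+ d :> R.
    by rewrite -exprMn; congr (_ ^+ _); field.
  rewrite ler_pM2r ?exprn_gt0 // mulnC exprM -exprM mulnC exprM lerXn2r ?nnegrE ?exprn_ge0 ?(ltW y'0) //.
pose B := (9 / 4) * (4 / 9) ^+ d : R.
have B0 : 0 <= B by rewrite mulr_ge0 ?exprn_ge0 //; lra.
pose fam := [set A : {set cube d} | [&& conn (@lk d) A, 0 < #|A| & #|A| <= 2 * K2]%N].
apply: (le_trans (y := \sum_(A in fam) B)).
  rewrite [leRHS]big_mkcond [leLHS]big_mkcond /=; apply: ler_sum => A _.
  case: ifP => [/andP[/and4P[Ab cA A1 As] hN]|_]; last by case: ifP.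
  have Af : A \in fam.
    rewrite inE cA (ltnW A1) /= leqNgt; apply/negP => hA; move/negP: hN; apply.
    exact: small_degree_arith dK (card_NB_sub (ltnW hA)).
  rewrite Af; apply: (le_trans (wgt_small x_gt0 x_le Ab)).
  (* Two elements already have 2d - 2 neighbours, so (2/3)^(2d - 2) against the 2^d positions leaves
     (8/9)^d up to a constant. *)
  have N2 : (2 * d - 2 <= #|NB A|)%N by rewrite leq_subLR addnC; exact: card_NB_sub A1.
  apply: (le_trans (y := (2 / 3) ^+ (2 * d - 2))).
    by rewrite ler_wiXn2l //; lra.
  have -> : (2 / 3) ^+ (2 * d - 2) = ((2 / 3) ^+ 2) ^+ d.-1 :> R.
    by rewrite -exprM -subn1 mulnBr muln1.
  have e49 : (4 / 9) ^+ d = 4 / 9 * (4 / 9) ^+ d.-1 :> R by rewrite -exprS prednK.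
  rewrite /B e49 mulrA.
  have -> : 9 / 4 * (4 / 9) = 1 :> R by field.
  rewrite mul1r lerXn2r ?nnegrE //; try lra.
rewrite sumr_const -[B *+ _]mulr_natl.
apply: (le_trans (y := (2 * K2 * (2 ^ d * (d ^ 2) ^ (2 * (2 * K2))))%N%:R * B)).
  by rewrite ler_wpM2r // ler_nat; exact: card_conn_lk.
rewrite natrM [(2 ^ d * _)%N%:R]natrM !natrX -exprM /B /f2.
have -> : (2 * (2 * (2 * K2)) = 8 * K2)%N by rewrite !mulnA.
have -> : (8 / 9) ^+ d = 2 ^+ d * (4 / 9) ^+ d :> R by rewrite -exprMn; congr (_ ^+ _); field.
by rewrite le_eqVlt; apply/orP; left; apply/eqP; ring.
Qed.

End ClusterSum.

(** * Annealed weight of sets scattered on neither side *)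

Section Isolated.
Variable d : nat.
Implicit Types (u v w a c : cube d) (i j : 'I_d) (S T A B O U G : {set cube d}) (b : bool).

Definition scattered O : bool := [forall u in O, forall v in O, (u != v) ==> ~~ lk u v].

Lemma scatteredP O : reflect (forall u v, u \in O -> v \in O -> u != v -> ~~ lk u v) (scattered O).
Proof.
apply: (iffP forallP) => [h u v uO vO uv|h u].
  by have /implyP/(_ uO)/forallP/(_ v)/implyP/(_ vO)/implyP/(_ uv) := h u.
by apply/implyP => uO; apply/forallP => v; apply/implyP => vO; apply/implyP; exact: h.
Qed.

Lemma scattered_kk O v : scattered O -> (kk O v <= 1)%N.
Proof.
move=> /scatteredP h; rewrite leqNgt; apply/negP => /card_gt1P[i [j [iO jO ij]]].
move: iO jO; rewrite !inE => iO jO.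
have /negP : ~~ lk (flip v i) (flip v j) by apply: h => //; apply: contra_neq ij; exact: flip_inj.
by apply; apply/lkP; exists i, j; rewrite flipK.
Qed.

Lemma sum_kk O : (\sum_v kk O v = #|O| * d)%N.
Proof.
under eq_bigr do rewrite kkE.
rewrite exchange_big /= (eq_bigr (fun=> #|O|)).
  by rewrite sum_nat_const card_ord mulnC.
move=> i _; rewrite (reindex_inj (inv_inj (@flipK d i))) /= -sum1_card [RHS]big_mkcond /=.
by apply: eq_bigr => u _; rewrite flipK; case: (u \in O).
Qed.

Lemma card_NB_scattered O : scattered O -> #|NB O| = (#|O| * d)%N.
Proof.
move=> iO; rewrite -sum_kk -sum1_card [LHS]big_mkcond /=; apply: eq_bigr => v _; rewrite in_NB.
by have := scattered_kk v iO; case: (kk O v) => [|[|]].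
Qed.

(** Take the component of an offending pair: a vertex seeing both the component and the rest would
    link them. *)
Lemma nonscattered_component O : (0 < d)%N -> ~~ scattered O ->
  exists A : {set cube d}, [/\ A \subset O, conn (@lk d) A, (1 < #|A|)%N & [disjoint NB A & NB (O :\: A)]].
Proof.
move=> d0 ni.
have [u [v [uO vO uv luv]]] : exists u v, [/\ u \in O, v \in O, u != v & lk u v].
  move: ni => /forall_inPn[u uO /forall_inPn[v vO]]; rewrite negb_imply negbK => /andP[uv l].
  by exists u, v.
have [uA AO cA hA] := componentP (@lk_sym d) uO.
set A := component _ O u in uA AO cA hA *.
have vA : v \in A.
  by apply/negPn/negP => vA; have := hA u v uA vO vA; rewrite luv.
exists A; split=> //; first by apply/card_gt1P; exists u, v.
rewrite -setI_eq0 -subset0; apply/subsetP => w; rewrite in_setI !in_NB => /andP[].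
move=> /card_gt0P[i]; rewrite inE => iA /card_gt0P[j]; rewrite inE in_setD => /andP[jA jO].
have := hA _ _ iA jO jA; move/negP => []; apply/lkP; exists i, j; by rewrite flipK.
Qed.

End Isolated.

Section IsolatedWeight.
Variables (R : realType) (x s : R) (d : nat) (b : bool).
Hypotheses (x_gt0 : 0 < x) (x_le : x <= 3^-1) (d0 : (0 < d)%N).
Implicit Types (u v w a c : cube d) (i j : 'I_d) (S T A B O U G : {set cube d}).
Local Notation wgt := (wgt x b).

(** The weight of a single element, which is also the mean of phi_u. *)
Definition occ : R := ((1 + x) / 2) ^+ d.
Definition sparse O : bool := (O \subset side d b) && (#|O|%:R <= s ^+ d).
Definition sparse_sum : R := \sum_(O | sparse O) wgt O.
Definition cluster_sum : R := \sum_(A : {set cube d} | clust b s A) wgt A.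

Lemma wgtU A B : [disjoint NB A & NB B] -> [disjoint A & B] -> wgt (A :|: B) = wgt A * wgt B.
Proof.
move=> dN dAB; rewrite /wgt -big_split /=; apply: eq_bigr => v _; rewrite kkU //.
have [->|kA] := posnP (kk A v); first by rewrite add0n expr0 divff // mul1r.
have -> : kk B v = 0%N.
  apply/eqP; rewrite -leqn0 leqNgt; apply/negP => kB.
  have vA : v \in NB A by rewrite in_NB.
  by have := disjointFr dN vA; rewrite in_NB kB.
by rewrite addn0 expr0 divff // mulr1.
Qed.

Lemma wgt_scattered O : O \subset side d b -> scattered O -> wgt O = occ ^+ #|O|.
Proof.
move=> Ob iO; rewrite (wgt_NB x Ob) /occ -exprM mulnC -card_NB_scattered // -prodr_const.
apply: eq_bigr => v; rewrite in_NB => kv.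
have -> : kk O v = 1%N by apply/eqP; rewrite eqn_leq scattered_kk.
by rewrite expr1.
Qed.

Lemma occ_gt0 : 0 < occ.
Proof. by rewrite exprn_gt0 // divr_gt0 // addr_gt0. Qed.

Lemma sum_occ_le : \sum_(O in powerset (side d b)) occ ^+ #|O| <= expR (#|side d b|%:R * occ).
Proof.
rewrite (eq_bigr (fun O => \prod_(w in O) occ)); last by move=> O _; rewrite prodr_const.
rewrite sum_powerset_prod prodr_const expRM_natl lerXn2r ?nnegrE ?expR_ge0 ?addr_ge0 ?(ltW occ_gt0) //.
exact: expR_ge1Dx.
Qed.

Lemma sum_scattered_le : \sum_(O | sparse O && scattered O) wgt O <= expR (#|side d b|%:R * occ).
Proof.
apply: le_trans sum_occ_le; rewrite big_mkcond [leRHS]big_mkcond /=; apply: ler_sum => O _.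
rewrite powersetE; case: ifP => [/andP[/andP[Ob _] iO]|_].
  by rewrite Ob wgt_scattered.
by case: ifP => // _; rewrite exprn_ge0 // ltW ?occ_gt0.
Qed.

(** Peel off one cluster with at least two elements; its neighbourhood is disjoint from that of the
    rest, so weights multiply, and the rest is again sparse. *)
Lemma sum_nonscattered_le :
  \sum_(O | sparse O && ~~ scattered O) wgt O <= cluster_sum * sparse_sum.
Proof.
have w0 A : 0 <= wgt A by exact/ltW/wgt_gt0.
pose P A O := [&& sparse O, A \subset O & [disjoint NB A & NB (O :\: A)]].
apply: (le_trans (y := \sum_(A : {set cube d} | clust b s A) \sum_(O | P A O) wgt O)).
  rewrite (exchange_big_dep sparse) /=; last by move=> A O _ /andP[].
  rewrite big_mkcondr /=; apply: ler_sum => O sO.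
  case: ifP => [nO|_]; last by apply: sumr_ge0 => *.
  have [A [AO cA A1 dA]] := nonscattered_component d0 nO.
  have /andP[Ob Os] := sO.
  rewrite (bigD1 A) /=; first by rewrite lerDl; apply: sumr_ge0 => *.
  rewrite /clust (subset_trans AO Ob) cA A1 /P sO AO dA !andbT /=.
  by apply: le_trans Os; rewrite ler_nat subset_leq_card.
rewrite /cluster_sum mulr_suml; apply: ler_sum => A cA.
apply: (le_trans (y := \sum_(O | P A O) wgt A * wgt (O :\: A))).
  apply: ler_sum => O /and3P[sO AO dA].
  have e : O = A :|: (O :\: A) by rewrite -{1}(setID O A) (setIidPr AO).
  rewrite {1}e wgtU // -setI_eq0; apply/eqP/setP => u.
  by rewrite !inE; case: (u \in A).
rewrite -mulr_sumr ler_wpM2l //.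
pose D := [set O | P A O].
have -> : \sum_(O | P A O) wgt (O :\: A) = \sum_(O in [set O :\: A | O in D]) wgt O.
  rewrite big_imset /=; first by apply: eq_bigl => O; rewrite inE.
  move=> O Q; rewrite !inE => /and3P[_ AO _] /and3P[_ AQ _] e.
  by rewrite -(setID O A) -(setID Q A) (setIidPr AO) (setIidPr AQ) e.
rewrite /sparse_sum big_mkcond [leRHS]big_mkcond /=; apply: ler_sum => O _.
case: ifP => [/imsetP[Q QD ->]|_]; last by case: ifP.
move: QD; rewrite inE => /and3P[/andP[Ob Os] AO _].
rewrite /sparse (subset_trans (subsetDl _ _) Ob) /=.
have -> // : #|Q :\: A|%:R <= s ^+ d by apply: le_trans Os; rewrite ler_nat subset_leq_card // subsetDl.
Qed.

(** Bootstrap: the nonscattered part is at most half of the sum that it belongs to. *)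
Lemma sparse_sum_le : cluster_sum <= 2^-1 -> sparse_sum <= 2 * expR (#|side d b|%:R * occ).
Proof.
move=> c2; have h1 := sum_scattered_le; have h2 := sum_nonscattered_le.
have X0 : 0 <= sparse_sum by apply: sumr_ge0 => A _; exact/ltW/wgt_gt0.
have e : sparse_sum = \sum_(O | sparse O && scattered O) wgt O + \sum_(O | sparse O && ~~ scattered O) wgt O.
  by rewrite /sparse_sum (bigID (@scattered d)).
have h3 : sparse_sum <= expR (#|side d b|%:R * occ) + 2^-1 * sparse_sum.
  by rewrite {1}e; apply: lerD h1 (le_trans h2 (ler_wpM2r X0 c2)).
by move: h3; move: (expR _) sparse_sum => u v; lra.
Qed.

Lemma sum_wt_cond (P : {set cube d} -> bool) :
  \sum_(S | P (S :&: side d b)) wt x S = 2 ^+ #|side d (~~ b)| * \sum_(O in powerset (side d b) | P O) wgt O.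
Proof.
rewrite big_mkcond (big_side _ b) /= mulr_sumr [RHS]big_mkcondr /=; apply: eq_bigr => E.
rewrite powersetE => Eb.
have e O : O \in powerset (side d (~~ b)) -> (E :|: O) :&: side d b = E.
  rewrite powersetE => Ob; rewrite setIUl (setIidPl Eb); apply/setUidPl.
  by rewrite (subset_trans (setSI _ Ob)) // setIC (disjoint_setI0 (side_disj _ _)) sub0set.
rewrite (eq_bigr (fun O => if P E then wt x (E :|: O) else 0)); last by move=> O /e ->.
case: ifP => PE; last by rewrite big1.
rewrite (sum_wt_side1 x Eb) /wgt -prodr_const -big_split /=; apply: eq_bigr => v _.
by rewrite mulrCA divff // mulr1.
Qed.

End IsolatedWeight.

Section Annealed.
Variables (R : realType) (x : R).
Hypotheses (x_gt0 : 0 < x) (x_le : x <= 3^-1).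

(** Failure on both sides is required, since sets with a scattered side are counted exactly by
    [sum_indep_scattered]. *)
Definition messy d (S : {set cube d}) : bool :=
  ~~ scattered (S :&: side d false) && ~~ scattered (S :&: side d true).

(** Either the minority exceeds s^d, which phase concentration excludes, or one side is sparse; for
    a messy set that side is nonscattered, and the cluster sum bounds its weight. *)
Lemma annealed_messy : esmall (fun d =>
  (\sum_(S : {set cube d} | messy S) wt x S) / (2 ^+ (2 ^ d.-1) * expR (2^-1 * (1 + x) ^+ d))).
Proof.
have [s [s0 s2 ps]] := phase_concentration x_gt0 x_le.
have cf := sum_cluster_esmall x_gt0 x_le false s0 s2.
have ct := sum_cluster_esmall x_gt0 x_le true s0 s2.
have q2 : (0 : R) < 2^-1 by rewrite invr_gt0.
have [d1 h1] := esmall_lt ps q2; have [d2 h2] := esmall_lt cf q2; have [d3 h3] := esmall_lt ct q2.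
have es8 : esmall (fun d => 8 * Pr x (fun S : {set cube d} => s ^+ d < (minority S)%:R) +
    (2 * cluster_sum x s d false + 2 * cluster_sum x s d true)).
  by apply: esmallD; [|apply: esmallD]; apply: esmallZ.
apply: (esmall_le (n0 := maxn (maxn d1 1) (maxn d2 d3))) es8 => d.
rewrite !geq_max => /andP[/andP[dd1 d0] /andP[dd2 dd3]].
set p := Pr x _; have p2 : p <= 2^-1 := h1 d dd1.
have p0 : 0 <= p by exact: Pr_ge0.
pose N := (2 ^ d.-1)%N; pose mu : R := 2^-1 * (1 + x) ^+ d.
have cs b : #|side d b| = N by rewrite card_side.
have muE b : #|side d b|%:R * occ x d = mu.
  have e2 : (2 : R) ^+ d = 2 * 2 ^+ d.-1 by rewrite -exprS prednK.
  rewrite cs /occ expr_div_n natrX e2 /mu.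
  have : (2 : R) ^+ d.-1 != 0 by rewrite expf_neq0.
  by move: ((1 + x) ^+ d) (2 ^+ d.-1 : R) => a c c0; field.
have Xf := sparse_sum_le x_gt0 d0 (h2 d dd2); rewrite muE in Xf.
have Xt := sparse_sum_le x_gt0 d0 (h3 d dd3); rewrite muE in Xt.
have NIf := @sum_nonscattered_le R x s d false x_gt0 d0.
have NIt := @sum_nonscattered_le R x s d true x_gt0 d0.
pose E := expR mu; have E0 : 0 < E by exact: expR_gt0.
pose P2 : R := 2 ^+ N; have P20 : 0 < P2 by exact: exprn_gt0.
have Z0 := Zpart_gt0 d x_gt0.
have PZ : p * Zpart x d = \sum_(S : {set cube d} | s ^+ d < (minority S)%:R) wt x S.
  rewrite /p /Pr /Ex divfK ?gt_eqF // [RHS]big_mkcond /=; apply: eq_bigr => S _.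
  by case: ifP => _; rewrite ?mulr1 ?mulr0.
have sp b (Q : {set cube d} -> bool) :
    \sum_(S : {set cube d} | (#|S :&: side d b|%:R <= s ^+ d) && Q (S :&: side d b)) wt x S =
    P2 * \sum_(O | sparse s b O && Q O) wgt x b O.
  rewrite (@sum_wt_cond R x d b (fun O : {set cube d} => (#|O|%:R <= s ^+ d) && Q O)) cs; congr (_ * _).
  by apply: eq_bigl => O; rewrite powersetE /sparse andbA.
have cover (S : {set cube d}) : [|| s ^+ d < (minority S)%:R, #|S :&: side d false|%:R <= s ^+ d |
    #|S :&: side d true|%:R <= s ^+ d].
  rewrite /minority; case: (ltP (s ^+ d)) => //= h.
  by move: h; rewrite /minn; case: ifP => _ ->; rewrite ?orbT.
have w0 (S : {set cube d}) : 0 <= wt x S by exact: wt_ge0.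
have split3 (Q1 Q2 Q : {set cube d} -> bool) : (forall S, Q S -> (Q1 (S :&: side d false) && Q2 (S :&: side d true))%B) ->
   \sum_(S : {set cube d} | Q S) wt x S <= p * Zpart x d +
     (P2 * (\sum_(O | sparse s false O && Q1 O) wgt x false O) +
      P2 * (\sum_(O | sparse s true O && Q2 O) wgt x true O)).
  move=> hQ; rewrite PZ -(sp false Q1) -(sp true Q2) big_mkcond [X in _ <= X + _]big_mkcond.
  rewrite [X in _ <= _ + (X + _)]big_mkcond [X in _ <= _ + (_ + X)]big_mkcond /= -!big_split /=.
  apply: ler_sum => S _; have := cover S; have := hQ S.
  case: (Q S) => [/(_ isT)/andP[-> ->]|_ _]; last first.
    by rewrite !addr_ge0 //; case: ifP.
  rewrite !andbT; case: ifP => _ /=; first by rewrite lerDl addr_ge0 //; case: ifP.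
  by case: ifP => _ /=; [rewrite add0r lerDl; case: ifP | move=> ->; rewrite !add0r].
(* The phase-violating part is at most Z / 2, and the two sparse sides give 2 P2 E each. *)
have Zle : Zpart x d <= 8 * (P2 * E).
  have := @split3 xpredT xpredT xpredT (fun _ _ => isT).
  have eX b : \sum_(O : {set cube d} | sparse s b O && true) wgt x b O = sparse_sum x s d b.
    by rewrite /sparse_sum big_mkcondr.
  rewrite !eX -/(Zpart x d) => hZ.
  have pz := ler_wpM2r (ltW Z0) p2.
  have xf := ler_wpM2l (ltW P20) Xf; have xt := ler_wpM2l (ltW P20) Xt.
  have h1' := le_trans hZ (lerD pz (lerD xf xt)).
  move: h1'; rewrite -/E ![P2 * (2 * E)]mulrCA.
  by move: (P2 * E) (Zpart x d) => u v; lra.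
rewrite ler_pdivrMr ?mulr_gt0 //.
apply: (le_trans (split3 (fun O => ~~ scattered O) (fun O => ~~ scattered O) _ _)) => //.
have c0 b : 0 <= cluster_sum x s d b by apply: sumr_ge0 => A _; exact/ltW/wgt_gt0.
have a1 := ler_wpM2l p0 Zle.
have a2 : P2 * (\sum_(O : {set cube d} | sparse s false O && ~~ scattered O) wgt x false O) <= P2 * (cluster_sum x s d false * (2 * E)).
  by apply: ler_wpM2l; [exact: ltW|apply: (le_trans NIf); apply: ler_wpM2l => //].
have a3 : P2 * (\sum_(O : {set cube d} | sparse s true O && ~~ scattered O) wgt x true O) <= P2 * (cluster_sum x s d true * (2 * E)).
  by apply: ler_wpM2l; [exact: ltW|apply: (le_trans NIt); apply: ler_wpM2l => //].
apply: (le_trans (lerD a1 (lerD a2 a3))).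
rewrite -/N -/P2 -/E le_eqVlt; apply/orP; left; apply/eqP.
by move: (cluster_sum _ _ _ false) (cluster_sum _ _ _ true) => u v; ring.
Qed.

End Annealed.

(** * Poisson approximation of elementary symmetric sums *)

Section Poisson.
Variable R : realType.
Implicit Types (l mu K q : R) (k m n : nat).

Definition pois l k : R := l ^+ k / k`!%:R.

Lemma pois_ge0 l k : 0 <= l -> 0 <= pois l k.
Proof. by move=> l0; rewrite divr_ge0 // exprn_ge0. Qed.

Lemma poisS l k : k.+1%:R * pois l k.+1 = l * pois l k.
Proof.
have k0 : (k`!%:R : R) != 0 by rewrite pnatr_eq0 -lt0n fact_gt0.
have k1 : (k.+1%:R : R) != 0 by rewrite pnatr_eq0.
rewrite /pois factS natrM exprS invfM.
by move: (l ^+ k) (k`!%:R : R) (k.+1%:R : R) k0 k1 => a u v u0 v0; field; rewrite u0 v0.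
Qed.

Lemma sum_pois_le l n : 0 <= l -> \sum_(k < n) pois l k <= expR l.
Proof.
move=> l0.
have -> : \sum_(k < n) pois l k = series (exp_coeff l) n by rewrite /series /= big_mkord.
apply: nondecreasing_cvgn_le; last exact: is_cvg_series_exp_coeff.
move=> a c ac; rewrite /series /= -(subnKC ac) [leRHS](big_cat_nat _ (leq_addr _ a)) //= lerDl.
by apply: sumr_ge0 => k _; exact: pois_ge0.
Qed.

Lemma sum_pois_cvg l e : 0 < e -> exists n0, forall n, (n0 <= n)%N ->
  expR l - e <= \sum_(k < n) pois l k.
Proof.
move=> e0; have /cvgrPdist_lt/(_ e e0)[n0 _ h] := @is_cvg_series_exp_coeff R l.
exists n0 => n nn.
have -> : \sum_(k < n) pois l k = series (exp_coeff l) n by rewrite /series /= big_mkord.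
have := le_lt_trans (ler_norm _) (h n nn); rewrite -/(expR l).
by move: (series _ n) (expR l) => u v; lra.
Qed.

(** The truncated Poisson variance, exactly; the boundary term is nonpositive once n + 1 >= l. *)
Lemma sum_pois_sqE l n : \sum_(k < n.+2) pois l k * (k%:R - l) ^+ 2 =
  l * \sum_(k < n.+1) pois l k + l ^+ 2 * (pois l n.+1 - pois l n).
Proof.
elim: n => [|n IH].
  by rewrite !big_ord_recr !big_ord0 /= /pois (_ : 1`! = 1%N) // fact0 !expr0 expr1 !divr1; ring.
rewrite big_ord_recr /= IH [in RHS]big_ord_recr /=.
have e1 := poisS l n.+1; have e2 := poisS l n.
move: (\sum_(k < n.+1) _) e1 e2 => s; rewrite -![n.+2]addn2 -![n.+1]addn1 !natrD.
move: (pois l (n + 2)) (pois l (n + 1)) (pois l n) (n%:R : R) => u v w t e1 e2.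
have -> : u * (t + 2%:R - l) ^+ 2 = (t + 2%:R) * ((t + 2%:R) * u) - 2 * l * ((t + 2%:R) * u) + l ^+ 2 * u by ring.
have -> : (t + 2%:R) * u = l * v by rewrite -e1; ring.
have -> : (t + 2%:R) * (l * v) = l * v + l * (l * w) by rewrite -e2; ring.
by ring.
Qed.

Lemma sum_pois_sq l n : 0 <= l -> \sum_(k < n) pois l k * (k%:R - l) ^+ 2 <= l * expR l.
Proof.
(* Lengthen the sum beyond l so that the boundary term has the right sign. *)
move=> l0; pose m := (Num.bound l + n)%N.
have lm : l <= m%:R.
  by rewrite /m natrD; apply: ler_wpDr => //; rewrite ltW // archi_boundP.
have t0 k : 0 <= pois l k * (k%:R - l) ^+ 2 by rewrite mulr_ge0 ?pois_ge0 ?sqr_ge0.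
apply: (@le_trans _ _ (\sum_(k < m.+2) pois l k * (k%:R - l) ^+ 2)).
  have nm : (n <= m.+2)%N by rewrite /m; lia.
  rewrite -!(big_mkord xpredT (fun k => pois l k * (k%:R - l) ^+ 2)).
  by rewrite [leRHS](big_cat_nat _ nm) //= lerDl; apply: sumr_ge0.
rewrite sum_pois_sqE -[leRHS]addr0 lerD //.
  by apply: ler_wpM2l => //; exact: sum_pois_le.
apply: mulr_ge0_le0; first exact: sqr_ge0.
rewrite subr_le0 -(ler_pM2l (_ : 0 < m.+1%:R)) ?ltr0n // poisS.
apply: ler_wpM2r; first exact: pois_ge0.
by apply: (le_trans lm); rewrite ler_nat.
Qed.

Lemma expR_close (a b y Y : R) : 0 <= a -> 0 <= b -> 0 <= y -> y <= Y ->
  a <= expR y * b -> b <= expR y * a -> `|a - b| <= b * (y * expR Y).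
Proof.
move=> a0 b0 y0 yY h1 h2; have EY : expR y <= expR Y by rewrite ler_expR.
have h3 := expR_ge1Dx (- y); rewrite expRN in h3.
have E1 : 1 <= expR y by rewrite -expR0 ler_expR.
have E0 := expR_gt0 y.
have h4 : expR y - 1 <= y * expR y.
  have : (1 + - y) * expR y <= 1 by rewrite -ler_pdivlMr // mul1r.
  lra.
have yE := ler_wpM2l y0 EY; move: h1 h2 h4 yE E1 E0; move: (expR y) (y * expR Y) => E Z h1 h2 h4 yE E1 E0.
have b1 := ler_wpM2l b0 (le_trans h4 yE).
have b2 : a <= b + b * Z by lra.
have b3 : b * (1 - Z) <= a.
  have : E * ((1 - Z) * b) <= E * a.
    apply: le_trans h2; rewrite mulrA -[leRHS]mul1r; apply: ler_wpM2r => //; nra.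
  by rewrite ler_pM2l // [_ * b]mulrC.
rewrite ler_norml; lra.
Qed.

Lemma le_amgm (t c : R) : 0 < c -> t <= c + t ^+ 2 / c.
Proof.
move=> c0; rewrite -(ler_pM2l c0) mulrDr [c * (_ / _)]mulrC divfK ?gt_eqF //.
by have := sqr_ge0 (t - c); have := sqr_ge0 t; nra.
Qed.

Section NearlyPoisson.
Variables (K mu l q : R) (e : nat -> R).
Hypotheses (K_ge1 : 1 <= K) (mu_ge : 20 * K <= mu) (e_ge0 : forall k, 0 <= e k)
  (e0 : e 0 = 1) (e1 : e 1 = l) (l_le : l <= mu + K) (l_ge : mu - K <= l) (q_le : q <= K)
  (e_up : forall k, k.+1%:R * e k.+1 <= l * e k)
  (e_lo : forall k, l * e k.+1 - q * e k <= k.+2%:R * e k.+2).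

Let mu_gt0 : 0 < mu. Proof. by move: K_ge1 mu_ge; lra. Qed.
Let beta : R := K / mu.
Let beta_ge0 : 0 <= beta. Proof. by apply: divr_ge0; [exact: le_trans ler01 K_ge1|exact: ltW]. Qed.
Let beta_le : 10 * beta <= 1.
Proof. by rewrite /beta mulrA ler_pdivrMr // mul1r; move: K_ge1 mu_ge; lra. Qed.
Let bmu : beta * mu = K. Proof. by rewrite /beta divfK ?gt_eqF. Qed.
Let p_gt0 k : 0 < pois mu k. Proof. by rewrite divr_gt0 ?exprn_gt0 // ltr0n fact_gt0. Qed.

Definition pratio k : R := e k / pois mu k.

Let pratio_ge0 k : 0 <= pratio k. Proof. by rewrite divr_ge0 // ltW. Qed.

Let eE k : e k = pratio k * pois mu k. Proof. by rewrite /pratio divfK ?gt_eqF. Qed.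

Lemma pratio_up k : pratio k.+1 <= (1 + beta) * pratio k.
Proof.
rewrite -(ler_pM2r (p_gt0 k.+1)) -eE -(ler_pM2l (_ : 0 < k.+1%:R)) ?ltr0n //.
apply: (le_trans (e_up k)); rewrite [leRHS]mulrCA poisS [X in X <= _]mulrC eE.
rewrite [leRHS](_ : _ = (pratio k * pois mu k) * (mu + beta * mu)); last by ring.
rewrite bmu; apply: ler_wpM2l => //; apply: mulr_ge0 => //; exact: ltW.
Qed.

(** The correction q e_k must be compared with e_{k+1}, and the previous ratio bound does this:
    hence the induction. *)
Lemma pratio_lo k : k%:R <= 2 * mu -> (1 - 5 * beta) * pratio k <= pratio k.+1.
Proof.
elim: k => [_|k IH hk].
  have -> : pratio 0 = 1 by rewrite /pratio e0 /pois expr0 fact0 !divr1.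
  have -> : pratio 1 = l / mu by rewrite /pratio e1 /pois expr1 (_ : 1`! = 1%N) // divr1.
  by rewrite ler_pdivlMr // mulr1 mulrBl -mulrA bmu mul1r; move: K_ge1 l_ge; lra.
have hk' : k%:R <= 2 * mu by apply: le_trans hk; rewrite ler_nat.
have {IH} := IH hk'.
have q1 := pratio_ge0 k.+1; have q0 := pratio_ge0 k.
have pk1 := p_gt0 k.+1.
move=> IH; suff h : (1 - 5 * beta) * pratio k.+1 * (k.+2%:R * pois mu k.+2) <= k.+2%:R * e k.+2.
  rewrite -(ler_pM2r (p_gt0 k.+2)) -eE -(ler_pM2l (_ : 0 < k.+2%:R)) ?ltr0n //.
  by apply: le_trans h; rewrite le_eqVlt; apply/orP; left; apply/eqP; ring.
apply: le_trans (e_lo k); rewrite poisS.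
(* One factor 2 comes from 1 - 5 beta >= 1/2, the other from k + 1 <= 2 mu. *)
have ek : e k <= 2 * pratio k.+1 * (2 * pois mu k.+1).
  rewrite eE; apply: ler_pM => //; first exact: ltW.
    by move: IH q0 q1 beta_le beta_ge0; move: (pratio k) (pratio k.+1) => u v; nra.
  have := poisS mu k; move: hk; move: (k.+1%:R : R) => t ht et.
  rewrite -(ler_pM2l mu_gt0) -et [leRHS]mulrCA [leRHS]mulrA.
  by apply: ler_wpM2r => //; exact: ltW.
have qk : q * e k <= K * (2 * pratio k.+1 * (2 * pois mu k.+1)).
  apply: (le_trans (ler_wpM2r (e_ge0 k) q_le)); apply: ler_wpM2l => //.
  exact: le_trans ler01 K_ge1.
have lk : (mu - K) * (pratio k.+1 * pois mu k.+1) <= l * e k.+1.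
  by rewrite -eE; apply: ler_wpM2r.
apply: le_trans (lerB lk qk); rewrite -bmu.
by rewrite le_eqVlt; apply/orP; left; apply/eqP; ring.
Qed.

Let gam : R := 10 * beta.

Lemma pratio_expR k : pratio k.+1 <= expR gam * pratio k.
Proof.
apply: (le_trans (pratio_up k)); apply: ler_wpM2r => //.
by apply: le_trans (expR_ge1Dx gam); rewrite /gam; move: beta_ge0; lra.
Qed.

Lemma pratio_expR' k : k%:R <= 2 * mu -> pratio k <= expR gam * pratio k.+1.
Proof.
move=> /pratio_lo h; have := expR_ge1Dx gam.
have := pratio_ge0 k; have := pratio_ge0 k.+1; move: h; rewrite /gam.
move: (pratio k) (pratio k.+1) (expR _) beta_le beta_ge0 => u v E b1 b0 h v0 u0 hE.
have h2 := ler_wpM2r v0 hE; apply: le_trans h2.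
have h3 : (1 + 10 * beta) * ((1 - 5 * beta) * u) <= (1 + 10 * beta) * v by apply: ler_wpM2l => //; lra.
apply: le_trans h3; rewrite -[leLHS]mul1r mulrA; apply: ler_wpM2r => //; nra.
Qed.

Lemma pratio_dist i m : (i + m)%:R <= 2 * mu ->
  pratio (i + m) <= expR (m%:R * gam) * pratio i /\ pratio i <= expR (m%:R * gam) * pratio (i + m).
Proof.
elim: m => [_|m IH h]; first by rewrite addn0 mul0r expR0 mul1r.
have h' : (i + m)%:R <= 2 * mu by apply: le_trans h; rewrite ler_nat leq_add2l.
have [a1 a2] := IH h'.
rewrite -natr1 mulrDl mul1r expRD addnS; split.
  rewrite [expR _ * expR gam]mulrC -mulrA; apply: (le_trans (pratio_expR _)).
  by apply: ler_wpM2l => //; exact: expR_ge0.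
rewrite -mulrA; apply: (le_trans a2); apply: ler_wpM2l; first exact: expR_ge0.
exact: pratio_expR'.
Qed.

Let kap := Num.truncn mu.
Let kap_le : kap%:R <= mu. Proof. by rewrite truncn_le ltW. Qed.
Let kap_gt : mu < kap%:R + 1. Proof. by rewrite natr1; apply: truncnS_gt; apply: gtr0_real. Qed.
Let Y : R := 10 * K.
Let gamE : gam * mu = Y. Proof. by rewrite /gam -mulrA bmu. Qed.
Let gam_ge0 : 0 <= gam. Proof. by rewrite mulr_ge0. Qed.
Let V := pratio kap.

(** Up to twice the mode each step changes the ratio by at most exp(gam), and the total exponent
    stays below gam mu = 10 K, which allows linearising. *)
Lemma pratio_near k : (k <= kap + kap)%N -> `|pratio k - V| <= V * (gam * `|k%:R - kap%:R| * expR Y).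
Proof.
have le2 m : (m <= kap + kap)%N -> m%:R <= 2 * mu.
  by rewrite -(ler_nat R) natrD; move: kap_le; lra.
move=> kk; apply: expR_close => //; [exact: pratio_ge0|exact: mulr_ge0|..].
- rewrite -gamE; apply: ler_wpM2l => //.
  have : (k%:R : R) <= kap%:R + kap%:R by rewrite -natrD ler_nat.
  have : (0 : R) <= k%:R by [].
  by rewrite ler_norml; move: kap_le; lra.
- case: (leqP kap k) => [h|/ltnW h].
    have [] := @pratio_dist kap (k - kap); rewrite subnKC //; first exact: le2.
    by rewrite -natrB // normr_nat [gam * _]mulrC.
  have [] := @pratio_dist k (kap - k); rewrite subnKC //; first by apply: le2; rewrite leq_addr.
  by rewrite distrC -natrB // normr_nat [gam * _]mulrC.
- case: (leqP kap k) => [h|/ltnW h].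
    have [] := @pratio_dist kap (k - kap); rewrite subnKC //; first exact: le2.
    by rewrite -natrB // normr_nat [gam * _]mulrC.
  have [] := @pratio_dist k (kap - k); rewrite subnKC //; first by apply: le2; rewrite leq_addr.
  by rewrite distrC -natrB // normr_nat [gam * _]mulrC.
Qed.

Let V_ge : 1 <= expR Y * V.
Proof.
have [|_] := @pratio_dist 0 kap; first by rewrite add0n; move: kap_le mu_gt0; lra.
have -> : pratio 0 = 1 by rewrite /pratio e0 /pois expr0 fact0 !divr1.
rewrite add0n => h; apply: (le_trans h); apply: ler_wpM2r => //.
by rewrite ler_expR -gamE [gam * _]mulrC; apply: ler_wpM2r.
Qed.

Let l_ge0 : 0 <= l. Proof. by move: K_ge1 mu_ge l_ge; lra. Qed.

Let e_le k : e k <= pois l k.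
Proof.
elim: k => [|k IH]; first by rewrite e0 /pois expr0 fact0 divr1.
rewrite -(ler_pM2l (_ : 0 < k.+1%:R)) ?ltr0n // poisS.
by apply: (le_trans (e_up k)); apply: ler_wpM2l.
Qed.

Let C := Y * expR Y.
Let Y_ge0 : 0 <= Y. Proof. by rewrite /Y; move: K_ge1; lra. Qed.
Let C_ge0 : 0 <= C. Proof. by rewrite mulr_ge0 ?expR_ge0. Qed.

Let far k a : (kap + kap < k)%N -> a <= mu + K -> 1 <= 4 / mu ^+ 2 * (k%:R - a) ^+ 2.
Proof.
move=> kk aK; have h : mu <= 2 * (k%:R - a).
  have : kap%:R + kap%:R + 1 <= (k%:R : R) by rewrite -natrD natr1 ler_nat.
  by move: kap_gt aK K_ge1 mu_ge; lra.
rewrite mulrAC ler_pdivlMr ?exprn_gt0 // mul1r.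
have -> : 4 * (k%:R - a) ^+ 2 = (2 * (k%:R - a)) ^+ 2 by ring.
rewrite ler_sqr // nnegrE; first exact: ltW.
by apply: le_trans h; exact: ltW.
Qed.

(** Inside the window, [pratio_near] and the inequality t <= c + t^2 / c with c = del mu; outside, a
    Chebyshev factor at least 1 is inserted. Both leave second moments to be summed. *)
Lemma nearly_poisson_term (del : R) k : 0 < del ->
  `|e k - V * pois mu k| <=
   V * C * (del + mu^-1) * pois mu k + V * (C / (del * mu ^+ 2) + 4 / mu ^+ 2) * (pois mu k * (k%:R - mu) ^+ 2)
   + 4 / mu ^+ 2 * (pois l k * (k%:R - l) ^+ 2).
Proof.
move=> d0; have d0' := ltW d0; have P0 := p_gt0 k; have P0' := ltW P0; have V0 : 0 <= V by exact: pratio_ge0.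
have pl0 : 0 <= pois l k by exact: pois_ge0.
have m2 : 0 <= 4 / mu ^+ 2 by rewrite divr_ge0 // exprn_ge0 // ltW.
have Cd : 0 <= C / (del * mu ^+ 2) by rewrite divr_ge0 // mulr_ge0 ?exprn_ge0 // ltW.
have mui : 0 <= mu^-1 by rewrite invr_ge0 ltW.
have sq a : 0 <= (k%:R - a : R) ^+ 2 by exact: sqr_ge0.
case: (leqP k (kap + kap)) => kk; last first.
  have f1 : 1 <= 4 / mu ^+ 2 * (k%:R - mu) ^+ 2 by apply: far => //; move: K_ge1; lra.
  have f2 := far kk l_le.
  have a1 : V * pois mu k <= V * pois mu k * (4 / mu ^+ 2 * (k%:R - mu) ^+ 2).
    by apply: ler_peMr => //; rewrite mulr_ge0 // ltW.
  have a2 : e k <= pois l k * (4 / mu ^+ 2 * (k%:R - l) ^+ 2).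
    by apply: (le_trans (e_le k)); apply: ler_peMr.
  have a3 : 0 <= V * C * (del + mu^-1) * pois mu k by do ![apply: mulr_ge0 => // | apply: addr_ge0 => //].
  have a4 : 0 <= V * (C / (del * mu ^+ 2)) * (pois mu k * (k%:R - mu) ^+ 2) by do ![apply: mulr_ge0 => //].
  apply: (le_trans (ler_normB _ _)); rewrite (ger0_norm (e_ge0 k)) ger0_norm; last exact: mulr_ge0 V0 (ltW P0).
  move: a1 a2 a3 a4; set A := _ / (del * _); set B := 4 / _.
  move: (V * C * (del + mu^-1) * pois mu k) (pois mu k) (pois l k) ((k%:R - mu) ^+ 2) ((k%:R - l) ^+ 2) (e k) => a p pl s1 s2 ee.
  move=> h1 h2 h3 h4; lra.
have h := pratio_near kk; rewrite eE -mulrBl normrM (ger0_norm (ltW P0)).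
have a5 : 0 <= V * (4 / mu ^+ 2) * (pois mu k * (k%:R - mu) ^+ 2) by do ![apply: mulr_ge0 => //].
have a6 : 0 <= 4 / mu ^+ 2 * (pois l k * (k%:R - l) ^+ 2) by do ![apply: mulr_ge0 => //].
suff a7 : V * (gam * `|k%:R - kap%:R| * expR Y) <= V * C * (del + mu^-1) + V * (C / (del * mu ^+ 2)) * (k%:R - mu) ^+ 2.
  have := ler_wpM2r (ltW P0) (le_trans h a7); move: a5 a6.
  move: (`|pratio k - V|) (C / (del * mu ^+ 2)) (4 / mu ^+ 2) (V * C * (del + mu^-1)) (pois mu k) (pois l k) ((k%:R - mu) ^+ 2) ((k%:R - l) ^+ 2).
  move=> x1 x2 x3 x4 x5 x6 x7 x8 y1 y2 y3; lra.
have ay : gam * `|k%:R - kap%:R| <= Y * (del + mu^-1 + (k%:R - mu) ^+ 2 / (del * mu ^+ 2)).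
  have t1 : `|k%:R - kap%:R| <= `|k%:R - mu| + 1.
    apply: (le_trans (ler_distD mu _ _)); rewrite lerD2l ger0_norm ?subr_ge0 //.
    by move: kap_gt; lra.
  have t2 := @le_amgm `|k%:R - mu| (del * mu) (mulr_gt0 d0 mu_gt0).
  rewrite real_normK ?num_real // in t2.
  rewrite -gamE -mulrA; apply: ler_wpM2l => //; apply: (le_trans t1).
  have -> : mu * (del + mu^-1 + (k%:R - mu) ^+ 2 / (del * mu ^+ 2)) = del * mu + (k%:R - mu) ^+ 2 / (del * mu) + 1.
    by field; rewrite !gt_eqF.
  by rewrite lerD2r.
have := ler_wpM2l V0 (ler_wpM2r (expR_ge0 Y) ay) => h2; apply: (le_trans h2).
by rewrite le_eqVlt; apply/orP; left; apply/eqP; rewrite /C; move: (expR Y) => EY; field; rewrite !gt_eqF.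
Qed.

Lemma nearly_poisson_sum (del : R) n : 0 < del ->
  \sum_(k < n) `|e k - V * pois mu k| <=
  V * expR mu * (C * (del + mu^-1) + (C / del + 4) / mu + 8 * expR (11 * K) / mu).
Proof.
move=> d0; have V0 : 0 <= V by exact: pratio_ge0.
have d0' := ltW d0; have mu0 := ltW mu_gt0.
apply: (le_trans (ler_sum _ (fun (k : 'I_n) _ => nearly_poisson_term k d0))).
rewrite !big_split /= -!mulr_sumr.
have m2 : 0 <= 4 / mu ^+ 2 by rewrite divr_ge0 // exprn_ge0.
have b1 := sum_pois_le n mu0; have b2 := sum_pois_sq n mu0; have b3 := sum_pois_sq n l_ge0.
have f1 : 0 <= V * C * (del + mu^-1).
  by do ![apply: mulr_ge0 => // | apply: addr_ge0 => //]; rewrite invr_ge0.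
have f2 : 0 <= V * (C / (del * mu ^+ 2) + 4 / mu ^+ 2).
  by apply: mulr_ge0 => //; apply: addr_ge0 => //; apply: divr_ge0 => //; apply: mulr_ge0 => //; exact: exprn_ge0.
apply: (le_trans (lerD (lerD (ler_wpM2l f1 b1) (ler_wpM2l f2 b2)) (ler_wpM2l m2 b3))).
have lE : l * expR l <= 2 * mu * (expR mu * (expR (11 * K) * V)).
  apply: ler_pM; rewrite ?expR_ge0 //.
    by move: l_le mu_ge K_ge1; lra.
  apply: (@le_trans _ _ (expR mu * (expR K * (expR Y * V)))); last first.
    by rewrite [expR K * _]mulrA -expRD /Y (_ : K + 10 * K = 11 * K) //; ring.
  rewrite mulrA -expRD -[leLHS]mulr1; apply: ler_pM; rewrite ?expR_ge0 //.
  by rewrite ler_expR.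
apply: (le_trans (lerD (lexx _) (ler_wpM2l m2 lE))).
rewrite le_eqVlt; apply/orP; left; apply/eqP.
by move: (expR mu) (expR (11 * K)) => E1 E2; field; rewrite !gt_eqF.
Qed.

Lemma pratio_mode_ge : expR (- (10 * K)) <= V.
Proof. by rewrite expRN -[_^-1]mul1r ler_pdivrMr ?expR_gt0 // mulrC. Qed.

End NearlyPoisson.

Lemma sum_poisson_pmf_cvg l e : 0 <= l -> 0 < e -> exists n0, forall n, (n0 <= n)%N ->
  1 - e <= \sum_(k < n) Defs.poisson_pmf l k.
Proof.
move=> l0 e0; have [n0 h] := sum_pois_cvg l (mulr_gt0 e0 (expR_gt0 l)).
exists n0 => n /h {}h.
have -> : \sum_(k < n) Defs.poisson_pmf l k = expR (- l) * \sum_(k < n) pois l k.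
  by rewrite mulr_sumr; apply: eq_bigr => k _; rewrite /Defs.poisson_pmf /pois [RHS]mulrA.
have := ler_wpM2l (expR_ge0 (- l)) h.
by rewrite mulrBr mulrCA -expRD addNr expR0 mulr1.
Qed.

Lemma pois_pmf_ge0 l k : 0 <= l -> 0 <= Defs.poisson_pmf l k.
Proof. by move=> l0; rewrite /Defs.poisson_pmf divr_ge0 // mulr_ge0 ?expR_ge0 // exprn_ge0. Qed.

Lemma sum_poisson_pmf_le1 l n : 0 <= l -> \sum_(k < n) Defs.poisson_pmf l k <= 1.
Proof.
move=> l0; have -> : \sum_(k < n) Defs.poisson_pmf l k = expR (- l) * \sum_(k < n) pois l k.
  by rewrite mulr_sumr; apply: eq_bigr => k _; rewrite /Defs.poisson_pmf /pois mulrA.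
by rewrite expRN mulrC ler_pdivrMr ?expR_gt0 // mul1r; apply: sum_pois_le.
Qed.

(* [e k / pois mu k] changes by a factor [1 + O(1 / mu)] from [k] to [k + 1] as long as [k <= 2 mu],
   so it is almost constant on the window of width [sqrt mu] carrying the Poisson mass; its value at
   the mode then determines the normalising constant [A]. *)
Lemma nearly_poisson (K eps : R) : 1 <= K -> 0 < eps -> exists m0 : R, forall (mu l q A : R) (e : nat -> R),
  m0 <= mu -> (forall k, 0 <= e k) -> e 0 = 1 -> e 1 = l -> l <= mu + K -> mu - K <= l -> q <= K ->
  (forall k, k.+1%:R * e k.+1 <= l * e k) ->
  (forall k, l * e k.+1 - q * e k <= k.+2%:R * e k.+2) ->
  (exists n0, forall n, (n0 <= n)%N -> \sum_(k < n) e k = A) ->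
  2^-1 * expR (- (10 * K)) * expR mu <= A /\
  forall n, \sum_(k < n) `|e k - A * Defs.poisson_pmf mu k| <= eps * A.
Proof.
move=> K1 eps0.
pose C : R := 10 * K * expR (10 * K).
(* The errors total 3 W h; h <= 1/4 gives W <= 2 A, and then h <= eps / 8 suffices. *)
pose h : R := Num.min (4^-1) (eps / 8).
have h0 : 0 < h by rewrite /h lt_min; apply/andP; split; [lra|apply: divr_gt0; lra].
have C0 : 0 < C by rewrite !mulr_gt0 ?expR_gt0 //; lra.
(* Makes C del = h / 2; all other errors are D / mu, below h / 2 for large mu. *)
pose del := h / (2 * C); have del0 : 0 < del by rewrite divr_gt0 // mulr_gt0.
pose D := C + (C / del + 4) + 8 * expR (11 * K).
have D0 : 0 < D.
  have := divr_gt0 C0 del0; have := expR_gt0 (11 * K); rewrite /D; move: (C / del) (expR _) C0 => u v w; lra.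
pose m0 := Num.max (20 * K) (2 * D / h).
exists m0 => mu l q A e; rewrite /m0 ge_max => /andP[muK muD] e_ge0 e0 e1 lle lge qle eup elo [n0 sumA].
have mu0 : 0 < mu by lra.
pose V := pratio mu e (Num.truncn mu).
have S n : \sum_(k < n) `|e k - V * pois mu k| <= V * expR mu * h.
  apply: (le_trans (nearly_poisson_sum K1 muK e_ge0 e0 e1 lle lge qle eup elo n del0)).
  apply: ler_wpM2l.
    by apply: mulr_ge0; [apply: divr_ge0 => //; apply: pois_ge0; exact: ltW|exact: expR_ge0].
  rewrite -/C.
  have -> : C * (del + mu^-1) + (C / del + 4) / mu + 8 * expR (11 * K) / mu = C * del + D / mu.
    rewrite /D; field; rewrite !gt_eqF //.
  have -> : C * del = h / 2 by rewrite /del; field; rewrite gt_eqF.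
  suff : D / mu <= h / 2 by lra.
  rewrite ler_pdivrMr //; move: muD; rewrite ler_pdivrMr // => muD.
  by rewrite mulrAC ler_pdivlMr // mulrC [h * _]mulrC.
pose W := V * expR mu.
have W0 : expR (- (10 * K)) * expR mu <= W.
  apply: ler_wpM2r; first exact: expR_ge0.
  exact: pratio_mode_ge K1 muK e_ge0 e0 e1 lle lge qle eup elo.
have W1 : 0 < W by apply: lt_le_trans W0; rewrite mulr_gt0 ?expR_gt0.
have VW k : V * pois mu k = W * Defs.poisson_pmf mu k.
  rewrite -[LHS]mul1r -(expRxMexpNx_1 mu) /W /Defs.poisson_pmf /pois.
  by move: (expR mu) (expR (- mu)) => E E'; ring.
have S' n : \sum_(k < n) `|e k - W * Defs.poisson_pmf mu k| <= W * h.
  by apply: le_trans (S n); rewrite le_eqVlt; apply/orP; left; apply/eqP/eq_bigr => k _; rewrite VW.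
have pi0 k := pois_pmf_ge0 k (ltW mu0); have pi1 n := sum_poisson_pmf_le1 n (ltW mu0).
have AW : `|A - W| <= W * (2 * h).
  have [n1 t1] := @sum_poisson_pmf_cvg mu h (ltW mu0) h0.
  pose n := maxn n0 n1; have t2 := t1 n (leq_maxr _ _).
  have t3 : `|\sum_(k < n) e k - W * \sum_(k < n) Defs.poisson_pmf mu k| <= W * h.
    by rewrite mulr_sumr -sumrB; exact: le_trans (ler_norm_sum _ _ _) (S' n).
  rewrite (sumA n (leq_maxl _ _)) in t3; have t4 := pi1 n.
  move: t2 t3 t4; move: (\sum_(k < n) Defs.poisson_pmf mu k) => s t2 t3 t4.
  have t5 : W * (1 - h) <= W * s by rewrite ler_pM2l.
  have t6 : W * s <= W * 1 by rewrite ler_pM2l.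
  by move: t3; rewrite !ler_norml => /andP[? ?]; apply/andP; split; lra.
have h4 : h <= 4^-1 by rewrite /h ge_min lexx.
have h8 : 8 * h <= eps.
  have : h <= eps / 8 by rewrite /h ge_min lexx orbT.
  lra.
have AW2 : W <= 2 * A.
  move: AW; rewrite ler_norml => /andP[a1 _].
  have : W * (2 * h) <= W * 2^-1 by rewrite ler_pM2l //; lra.
  by lra.
split; first by rewrite -mulrA; lra.
move=> n; apply: (@le_trans _ _ (\sum_(k < n) (`|e k - W * Defs.poisson_pmf mu k| + W * (2 * h) * Defs.poisson_pmf mu k))).
  apply: ler_sum => k _; apply: (le_trans (ler_distD (W * Defs.poisson_pmf mu k) _ _)).
  by rewrite lerD2l -mulrBl normrM (ger0_norm (pi0 k)) distrC; apply: ler_wpM2r.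
rewrite big_split /= -mulr_sumr.
have u1 : W * (2 * h) * (\sum_(k < n) Defs.poisson_pmf mu k) <= W * (2 * h) * 1.
  apply: ler_wpM2l; last exact: pi1.
  by apply: mulr_ge0; [exact: ltW|apply: mulr_ge0 => //; exact: ltW].
apply: (le_trans (lerD (S' n) u1)).
have u2 : W * (8 * h) <= 2 * A * eps by apply: ler_pM => //; [exact: ltW|apply: mulr_ge0 => //; exact: ltW].
have u3 : 0 <= W * h by apply: mulr_ge0; exact: ltW.
by move: u2 u3; clear; lra.
Qed.

End Poisson.

(** * Newton-type recursions for elementary symmetric sums *)

Section ElementarySymmetric.
Variables (R : realType) (T : finType) (D : {set T}) (f : T -> R).
Hypothesis f_ge0 : forall u, 0 <= f u.
Implicit Types (O : {set T}) (u : T).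

Definition elsym k : R := \sum_(O : {set T} | (O \subset D) && (#|O| == k)) \prod_(u in O) f u.

Lemma elsym_ge0 k : 0 <= elsym k.
Proof. by apply: sumr_ge0 => O _; apply: prodr_ge0. Qed.

Lemma elsym0 : elsym 0 = 1.
Proof.
rewrite /elsym (big_pred1 finset.set0) ?big_set0 // => O.
by rewrite cards_eq0 /=; case: eqP => [->|_]; rewrite ?sub0set ?andbF.
Qed.

Lemma sum_elsym n : (#|D| < n)%N -> \sum_(k < n) elsym k = \prod_(u in D) (1 + f u).
Proof.
move=> Dn; rewrite -sum_powerset_prod (exchange_big_dep (fun O : {set T} => O \subset D)) /=; last by move=> k O _ /andP[].
apply: eq_big => [U|U UD]; first by rewrite powersetE.
have Un : (#|U| < n)%N by apply: leq_ltn_trans Dn; exact: subset_leq_card.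
by rewrite (big_pred1 (Ordinal Un)) // => k; rewrite UD eq_sym.
Qed.

(** Double counting of a set with a distinguished element. *)
Lemma sum_remove_one (G : {set T} -> T -> R) k :
  \sum_(O : {set T} | (O \subset D) && (#|O| == k.+1)) \sum_(u in O) G (O :\ u) u =
  \sum_(O : {set T} | (O \subset D) && (#|O| == k)) \sum_(u in D :\: O) G O u.
Proof.
rewrite (exchange_big_dep (mem D)) /=; last by move=> O u /andP[/subsetP h _] /h.
rewrite [RHS](exchange_big_dep (mem D)) /=; last by move=> O u _; rewrite !inE => /andP[].
apply: eq_bigr => u uD.
rewrite (reindex_onto (fun O => u |: O) (fun O => O :\ u)) /=; last first.
  by move=> O /andP[_ uO]; rewrite finset.setD1K.
apply: eq_big => [U|U /andP[_ /eqP ->] //].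
rewrite subUset sub1set !inE uD eqxx /= andbT cardsU1.
case uO: (u \in U) => /=; last by rewrite finset.setU1K ?uO // eqxx !andbT.
rewrite andbF; apply/negP => /andP[_ /eqP h]; move: uO.
by rewrite -h !inE eqxx.
Qed.

Let lam : R := \sum_(u in D) f u.

Lemma elsymS k : k.+1%:R * elsym k.+1 =
  lam * elsym k - \sum_(O : {set T} | (O \subset D) && (#|O| == k)) \sum_(u in O) (\prod_(v in O) f v) * f u.
Proof.
have -> : k.+1%:R * elsym k.+1 =
    \sum_(O : {set T} | (O \subset D) && (#|O| == k.+1)) \sum_(u in O) (\prod_(v in O :\ u) f v) * f u.
  rewrite mulr_sumr; apply: eq_bigr => O /andP[_ /eqP <-].
  rewrite mulr_natl -sumr_const; apply: eq_bigr => u uO.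
  by rewrite (big_setD1 u uO) mulrC.
rewrite (sum_remove_one (fun O u => (\prod_(v in O) f v) * f u)).
rewrite mulr_sumr -sumrB; apply: eq_bigr => O /andP[OD _].
rewrite /lam mulrC mulr_sumr [X in _ = X - _](big_setID O) /= (finset.setIidPr OD).
by rewrite addrAC subrr add0r.
Qed.

Lemma elsym1 : elsym 1 = lam.
Proof.
have := elsymS 0; rewrite elsym0 mulr1 mul1r => ->.
rewrite (big_pred1 finset.set0) ?big_set0 ?subr0 // => O.
by rewrite cards_eq0 /=; case: eqP => [->|_]; rewrite ?sub0set ?andbF.
Qed.

Lemma elsym_up k : k.+1%:R * elsym k.+1 <= lam * elsym k.
Proof.
rewrite elsymS gerBl; apply: sumr_ge0 => O _; apply: sumr_ge0 => u _.
by rewrite mulr_ge0 // prodr_ge0.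
Qed.

(** In the recursion [elsymS] a repeated factor becomes f u ^+ 2 times a product over [O :\ u];
    dropping the condition that [u] lies outside the smaller set only increases the subtracted
    term. *)
Lemma elsym_lo k : lam * elsym k.+1 - (\sum_(u in D) f u ^+ 2) * elsym k <= k.+2%:R * elsym k.+2.
Proof.
rewrite [leRHS]elsymS lerD2l lerN2.
have -> : \sum_(O : {set T} | (O \subset D) && (#|O| == k.+1)) \sum_(u in O) (\prod_(v in O) f v) * f u =
    \sum_(O : {set T} | (O \subset D) && (#|O| == k.+1)) \sum_(u in O) (\prod_(v in O :\ u) f v) * f u ^+ 2.
  apply: eq_bigr => O _; apply: eq_bigr => u uO.
  by rewrite (big_setD1 u uO) /=; ring.
rewrite (sum_remove_one (fun O u => (\prod_(v in O) f v) * f u ^+ 2)).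
rewrite mulrC mulr_suml; apply: ler_sum => O _; rewrite -mulr_sumr; apply: ler_wpM2l.
  exact: prodr_ge0.
rewrite [leRHS](big_setID O) /= lerDr; apply: sumr_ge0 => u _; exact: sqr_ge0.
Qed.

End ElementarySymmetric.

(** * Percolation moments *)

Lemma sum_powerset_if (R : realType) (T : finType) (D : {set T}) (F G : T -> R) :
  \sum_(A in powerset D) \prod_(w in D) (if w \in A then F w else G w) = \prod_(w in D) (F w + G w).
Proof.
transitivity (\prod_w ((if w \in D then F w else 0) + (if w \in D then G w else 1))).
  rewrite bigA_distr big_mkcond /=; apply: eq_bigr => J _.
  rewrite powersetE; case: (boolP (J \subset D)) => [/subsetP JD|].
    rewrite [LHS]big_mkcond; apply: eq_bigr => w _.
    by case: ifP => // wD; case: ifP => // /JD; rewrite wD.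
  by move=> /subsetPn[w wJ wD]; rewrite (bigD1 w) //= wJ (negPf wD) mul0r.
by rewrite [RHS]big_mkcond; apply: eq_bigr => w _; case: ifP => //; rewrite add0r.
Qed.

Section Percolation.
Variable d : nat.
Implicit Types (u v : cube d) (i j : 'I_d) (b : bool) (w : {set {set cube d}}) (S : {set cube d}).

Definition edge v i : {set cube d} := [set v; flip v i].

Lemma hamming1P v u : reflect (exists i, u = flip v i) (hamming v u == 1%N).
Proof.
apply: (iffP cards1P) => [[i h]|[i ->]]; exists i.
  apply/ffunP => j; rewrite ffunE; move/finset.setP/(_ j): h; rewrite !inE.
  by case: (v j) (u j) => -[]; case: (j == i).
by apply/finset.setP => j; rewrite !inE ffunE; case: (v j); case: (j == i).
Qed.

Lemma edge_flip v i : edge (flip v i) i = edge v i.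
Proof. by rewrite /edge flipK finset.setUC. Qed.

Lemma edge_inj b v u i j : v \in side d b -> u \in side d b -> edge v i = edge u j -> v = u /\ i = j.
Proof.
move=> vb ub h.
have side_neq (v' u' : cube d) k : v' \in side d b -> u' \in side d b -> v' != flip u' k.
  by move=> v'b u'b; apply: contraTneq v'b => ->; rewrite flip_side -sideC finset.inE u'b.
have vu : v = u.
  have : v \in edge u j by rewrite -h !inE eqxx.
  by rewrite !inE (negPf (side_neq v u j vb ub)) orbF => /eqP.
split=> //; subst u; apply: (@flip_inj _ v); apply/eqP.
have : flip v i \in edge v j by rewrite -h !inE eqxx orbT.
by rewrite !inE eq_sym (negPf (side_neq v v i vb vb)).
Qed.

Lemma Qedges_imset b : Qedges d = [set edge z.1 z.2 | z in setX (side d b) [set: 'I_d]].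
Proof.
apply/finset.setP => A; apply/imset2P/imsetP => [[v u _]|[[v i]]]; last first.
  rewrite in_setX /= => _ ->; exists v (flip v i); rewrite ?inE //.
  by apply/hamming1P; exists i.
rewrite inE => /hamming1P[i ->] ->.
case: (boolP (v \in side d b)) => vb; first by exists (v, i) => //; rewrite in_setX vb inE.
exists (flip v i, i) => /=; last by rewrite edge_flip.
by rewrite in_setX finset.in_setT flip_side -sideC finset.in_setC vb.
Qed.

Lemma big_Qedges (R : Type) (idx : R) (op : Monoid.com_law idx) b (F : {set cube d} -> R) :
  \big[op/idx]_(A in Qedges d) F A = \big[op/idx]_(v in side d b) \big[op/idx]_i F (edge v i).
Proof.
rewrite (Qedges_imset b) big_imset /=; last first.
  move=> [v i] [u j]; rewrite !in_setX /= => /andP[vb _] /andP[ub _] h.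
  by have [-> ->] := edge_inj vb ub h.
by rewrite pair_big; apply: eq_bigl => -[v i]; rewrite in_setX finset.in_setT.
Qed.

Definition edge_loc b (A : {set cube d}) : option (cube d * 'I_d) :=
  [pick z | (z.1 \in side d b) && (edge z.1 z.2 == A)].

Lemma edge_locK b v i : v \in side d b -> edge_loc b (edge v i) = Some (v, i).
Proof.
move=> vb; rewrite /edge_loc; case: pickP => [[u j] /= /andP[ub /eqP h]|/(_ (v, i))].
  by have [-> ->] := edge_inj ub vb h.
by rewrite /= vb eqxx.
Qed.

Section Expectation.
Variables (R : realType) (p : R).
Hypotheses (p_ge0 : 0 <= p) (p_le1 : p <= 1).
Implicit Types (f g : {set {set cube d}} -> R).

Definition PE f : R := \sum_(w in powerset (Qedges d)) perc_weight p w * f w.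

Lemma perc_weight_ge0 w : 0 <= perc_weight p w.
Proof. by rewrite mulr_ge0 ?exprn_ge0 // subr_ge0. Qed.

Lemma perc_weightE w : w \in powerset (Qedges d) ->
  perc_weight p w = \prod_(A in Qedges d) (if A \in w then p else 1 - p).
Proof.
rewrite powersetE => wQ; rewrite (big_setID w) /= (finset.setIidPr wQ); congr (_ * _).
  by rewrite -prodr_const; apply: eq_bigr => A ->.
have -> : (#|Qedges d| - #|w| = #|Qedges d :\: w|)%N by rewrite cardsD (finset.setIidPr wQ).
by rewrite -prodr_const; apply: eq_bigr => A; rewrite inE => /andP[/negPf ->].
Qed.

Lemma PE_prod b (g : cube d -> 'I_d -> R) :
  PE (fun w => \prod_(v in side d b) \prod_i (if edge v i \in w then g v i else 1)) =
  \prod_(v in side d b) \prod_i (p * g v i + (1 - p)).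
Proof.
pose a (A : {set cube d}) := if edge_loc b A is Some z then g z.1 z.2 else 1.
have aE v i : v \in side d b -> a (edge v i) = g v i by move=> vb; rewrite /a edge_locK.
transitivity (\prod_(A in Qedges d) (p * a A + (1 - p))); last first.
  rewrite (big_Qedges _ b); apply: eq_bigr => v vb; apply: eq_bigr => i _.
  by rewrite aE.
rewrite -sum_powerset_if /PE; apply: eq_bigr => w wQ.
rewrite (perc_weightE wQ) !(big_Qedges _ b) -big_split /=; apply: eq_bigr => v vb.
rewrite -big_split /=; apply: eq_bigr => i _.
by rewrite aE //; case: ifP => _ //; rewrite mulr1.
Qed.

Lemma PE1 : PE (fun=> 1) = 1.
Proof.
have := PE_prod false (fun _ _ => 1).
have -> : (fun w => \prod_(v in side d false) \prod_i (if edge v i \in w then 1 else 1)) = (fun=> 1) :> ({set {set cube d}} -> R).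
  by apply/funext => w; apply: big1 => v _; apply: big1 => i _; case: ifP.
move=> ->; apply: big1 => v _; apply: big1 => i _.
by rewrite mulr1 addrC subrK.
Qed.

Lemma PED f g : PE (fun w => f w + g w) = PE f + PE g.
Proof. by rewrite -big_split; apply: eq_bigr => w _; rewrite mulrDr. Qed.

Lemma PEZ a f : PE (fun w => a * f w) = a * PE f.
Proof. by rewrite mulr_sumr; apply: eq_bigr => w _; rewrite mulrCA. Qed.

Lemma PE_sum (I : finType) (P : pred I) (F : I -> {set {set cube d}} -> R) :
  PE (fun w => \sum_(i | P i) F i w) = \sum_(i | P i) PE (F i).
Proof. by rewrite exchange_big; apply: eq_bigr => w _; rewrite mulr_sumr. Qed.

Lemma PE_le f g : (forall w, w \subset Qedges d -> f w <= g w) -> PE f <= PE g.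
Proof.
move=> h; apply: ler_sum => w; rewrite powersetE => /h wfg.
by apply: ler_wpM2l => //; exact: perc_weight_ge0.
Qed.

End Expectation.

End Percolation.

(** * Counting independent sets for a fixed percolation *)

Section Quenched.
Variables (d : nat) (R : realType).
Implicit Types (u v : cube d) (i j : 'I_d) (b : bool) (w : {set {set cube d}}) (S O E : {set cube d}).

(** Because [w] contains only genuine edges, the pairs x = y in [indep] impose nothing, and each
    edge may be read from its end on side [b]. *)
Lemma indepE b w S : w \subset Qedges d ->
  indep w S = [forall v in side d b, forall i, (edge v i \in w) ==> ~~ ((v \in S) && (flip v i \in S))].
Proof.
move=> wQ; apply/idP/idP => [/forallP h|/forallP h].
  apply/forallP => v; apply/implyP => vb; apply/forallP => i; apply/implyP => ew.
  apply/negP => /andP[vS fS].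
  by have /implyP/(_ vS)/forallP/(_ (flip v i))/implyP/(_ fS)/negP := h v; apply.
apply/forallP => u; apply/implyP => uS; apply/forallP => v; apply/implyP => vS.
apply/negP => ew; have := subsetP wQ _ ew.
rewrite (Qedges_imset d b) => /imsetP[[v' i]]; rewrite in_setX finset.in_setT andbT /= => vb eE.
have /implyP/(_ vb)/forallP/(_ i)/implyP := h v'; rewrite -eE => /(_ ew)/negP; apply.
have sub a : a \in edge v' i -> a \in S by rewrite -eE !inE => /orP[] /eqP ->.
by rewrite !sub // !inE eqxx ?orbT.
Qed.

Lemma indep_prod b w S : w \subset Qedges d ->
  (indep w S)%:R = \prod_(v in side d b) \prod_i
     (if edge v i \in w then (if (v \in S) && (flip v i \in S) then 0 else 1) else 1) :> R.
Proof.
move=> wQ; rewrite (indepE b S wQ); case: forallP => [h|/forallP].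
  symmetry; apply: big1 => v vb; apply: big1 => i _; case: ifP => // ew.
  have /implyP/(_ vb)/forallP/(_ i)/implyP/(_ ew) := h v.
  by case: ifP.
rewrite negb_forall => /existsP[v]; rewrite negb_imply => /andP[vb].
rewrite negb_forall => /existsP[i]; rewrite negb_imply negbK => /andP[ew vS].
by rewrite (bigD1 v vb) /= (bigD1 i) //= ew vS !mul0r.
Qed.

Lemma PE_indep (p : R) S : PE p (fun w => (indep w S)%:R) = wt (1 - p) S.
Proof.
transitivity (PE p (fun w => \prod_(v in side d false) \prod_i
     (if edge v i \in w then (if (v \in S) && (flip v i \in S) then 0 else 1) else 1) : R)).
  by apply: eq_bigr => w; rewrite powersetE => wQ; rewrite (indep_prod false).
rewrite PE_prod /wt /es expr_sum.
transitivity (\prod_(v in side d false | v \in S) (1 - p) ^+ kk S v).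
  rewrite big_mkcondr; apply: eq_bigr => v _; case: (boolP (v \in S)) => vS; last first.
    by apply: big1 => i _; rewrite /= mulr1 addrC subrK.
  rewrite kkE expr_sum; apply: eq_bigr => i _ /=.
  by case: ifP => _; rewrite ?mulr0 ?add0r // mulr1 addrC subrK.
by apply: eq_bigl => v; rewrite in_setI andbC.
Qed.

Definition phi w u : R := \prod_i (if edge u i \in w then 2^-1 else 1).

Lemma phi_ge0 w u : 0 <= phi w u.
Proof. by apply: prodr_ge0 => i _; case: ifP => _; rewrite ?invr_ge0. Qed.

Lemma prod_side_flip b (F : cube d -> 'I_d -> R) :
  \prod_(v in side d (~~ b)) \prod_i F (flip v i) i = \prod_(u in side d b) \prod_i F u i.
Proof.
rewrite exchange_big [RHS]exchange_big; apply: eq_bigr => i _ /=.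
rewrite [RHS](reindex_inj (inv_inj (@flipK d i))) /=.
by apply: eq_bigl => v; rewrite flip_side.
Qed.

(* Distinct elements of a scattered set have disjoint neighbourhoods, so every vertex on the
   other side sees at most one constraint. *)
Lemma sum_indep_scattered b w O : w \subset Qedges d -> (0 < d)%N -> O \subset side d b -> scattered O ->
  \sum_(E in powerset (side d (~~ b))) (indep w (O :|: E))%:R = 2 ^+ (2 ^ d.-1) * \prod_(u in O) phi w u :> R.
Proof.
move=> wQ d0 Ob isoO.
pose z v : R := \prod_i (if (edge v i \in w) && (flip v i \in O) then 0 else 1).
transitivity (\sum_(E in powerset (side d (~~ b))) \prod_(v in E) z v).
  apply: eq_bigr => E; rewrite powersetE => Eb; rewrite (indep_prod (~~ b)) //.
  transitivity (\prod_(v in side d (~~ b) | v \in E) z v); last first.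
    by apply: eq_bigl => v; apply/andP/idP => [[]//|vE]; split=> //; exact: (subsetP Eb).
  rewrite big_mkcondr; apply: eq_bigr => v vb.
  have vO : v \notin O by apply: contraL vb => /(subsetP Ob); rewrite -sideC finset.in_setC negbK.
  have fE i : flip v i \notin E.
    apply: contraL vb => /(subsetP Eb); rewrite flip_side negbK => vb.
    by rewrite -sideC finset.in_setC negbK.
  case: (boolP (v \in E)) => vE; last first.
    by apply: big1 => i _; rewrite in_setU (negPf vO) (negPf vE) /=; case: ifP.
  apply: eq_bigr => i _; rewrite !in_setU vE orbT (negPf (fE i)) orbF /=.
  by case: ifP.
rewrite sum_powerset_prod.
pose h v i : R := if (edge v i \in w) && (flip v i \in O) then 2^-1 else 1.
(* [z v] is 1 if [v] may be added and 0 otherwise; as [v] has at most one neighbour in [O], a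
   constraint simply halves its two choices. *)
have zh v : 1 + z v = 2 * \prod_i h v i.
  have := scattered_kk v isoO; rewrite leq_eqVlt ltnS leqn0 => /orP[/cards1P[i hi]|].
    have iE j : (flip v j \in O) = (j == i).
      by move/finset.setP/(_ j): hi; rewrite !inE.
    rewrite /z (bigD1 i) //= [X in _ * X]big1 ?mulr1; last first.
      by move=> j /negPf ji; rewrite iE ji andbF.
    rewrite (bigD1 i) //= [X in _ = 2 * (_ * X)]big1 ?mulr1; last first.
      by move=> j /negPf ji; rewrite /h iE ji andbF.
    rewrite /h iE eqxx andbT; case: ifP => _; first by rewrite addr0 divff.
    by rewrite mulr1.
  rewrite cards_eq0 => /eqP hi.
  have iE j : (flip v j \in O) = false.
    by move/finset.setP/(_ j): hi; rewrite !inE.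
  by rewrite /z !big1 ?mulr1 // => j _; rewrite ?/h iE andbF.
under eq_bigr => v _ do rewrite zh.
rewrite big_split /= prodr_const card_side //; congr (_ * _).
rewrite (eq_bigr (fun v => \prod_i (if (edge (flip v i) i \in w) && (flip v i \in O) then 2^-1 else 1))); last first.
  by move=> v _; apply: eq_bigr => i _; rewrite edge_flip.
rewrite (prod_side_flip b (fun u i => if (edge u i \in w) && (u \in O) then 2^-1 else 1)).
transitivity (\prod_(u in side d b | u \in O) phi w u).
  rewrite big_mkcondr; apply: eq_bigr => u _; case: (u \in O).
    by apply: eq_bigr => i _; rewrite andbT.
  by apply: big1 => i _; rewrite andbF.
by apply: eq_bigl => u; apply/andP/idP => [[]//|uO]; split=> //; exact: (subsetP Ob).
Qed.

Section Moments.
Variables (p : R).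

Lemma PE_prod_phi b O : O \subset side d b -> PE p (fun w => \prod_(u in O) phi w u) = occ (1 - p) d ^+ #|O|.
Proof.
move=> Ob; transitivity (PE p (fun w => \prod_(v in side d b) \prod_i
    (if edge v i \in w then (if v \in O then 2^-1 else 1) else 1) : R)).
  apply: eq_bigr => w _; congr (_ * _).
  transitivity (\prod_(u in side d b | u \in O) phi w u).
    by apply: eq_bigl => u; apply/idP/andP => [uO|[]//]; split=> //; exact: (subsetP Ob).
  rewrite big_mkcondr; apply: eq_bigr => u _; case: (u \in O) => //.
  by symmetry; apply: big1 => i _; case: ifP.
rewrite PE_prod -prodr_const; transitivity (\prod_(v in side d b | v \in O) occ (1 - p) d).
  rewrite big_mkcondr; apply: eq_bigr => v _; case: (v \in O).
    by rewrite prodr_const card_ord /occ; congr (_ ^+ _); field.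
  by apply: big1 => i _; rewrite mulr1 addrC subrK.
by apply: eq_bigl => u; apply/andP/idP => [[]//|uO]; split=> //; exact: (subsetP Ob).
Qed.

Lemma PE_phi_sq b u : u \in side d b -> PE p (fun w => phi w u ^+ 2) = (1 - 3 / 4 * p) ^+ d.
Proof.
move=> ub; transitivity (PE p (fun w => \prod_(v in side d b) \prod_i
    (if edge v i \in w then (if v == u then 4^-1 else 1) else 1) : R)).
  apply: eq_bigr => w _; congr (_ * _).
  rewrite [RHS](bigD1 u) //= [X in _ = _ * X]big1 ?mulr1; last first.
    by move=> v /andP[_ /negPf ->]; apply: big1 => i _; case: ifP.
  rewrite expr2 /phi -big_split; apply: eq_bigr => i _ /=; rewrite eqxx.
  by case: ifP => _; rewrite ?mulr1 //; field.
rewrite PE_prod (bigD1 u) //= [X in _ * X]big1 ?mulr1; last first.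
  by move=> v /andP[_ /negPf ->]; apply: big1 => i _; rewrite mulr1 addrC subrK.
by rewrite prodr_const card_ord eqxx; congr (_ ^+ _); field.
Qed.

Definition lam b w : R := \sum_(u in side d b) phi w u.
Definition lam2 b w : R := \sum_(u in side d b) phi w u ^+ 2.

Lemma PE_lam2 b : (0 < d)%N -> PE p (lam2 b) = 2 ^+ d.-1 * (1 - 3 / 4 * p) ^+ d.
Proof.
move=> d0; rewrite PE_sum (eq_bigr (fun=> (1 - 3 / 4 * p) ^+ d)); last by move=> u; exact: PE_phi_sq.
by rewrite sumr_const card_side // -[LHS]mulr_natl natrX.
Qed.

Lemma PE_lam b : (0 < d)%N -> PE p (lam b) = mu_p p d.
Proof.
move=> d0; rewrite PE_sum (eq_bigr (fun=> occ (1 - p) d)); last first.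
  move=> u ub; rewrite -[RHS]expr1 -(cards1 u) -(@PE_prod_phi b) ?sub1set //.
  by apply: eq_bigr => w _; rewrite big_set1.
rewrite sumr_const card_side // -[LHS]mulr_natl natrX /mu_p /occ expr_div_n.
have -> : 1 + (1 - p) = 2 - p by ring.
have -> : (2 : R) ^+ d = 2 * 2 ^+ d.-1 by rewrite -exprS prednK.
have : (2 : R) ^+ d.-1 != 0 by rewrite expf_neq0.
by move: ((2 - p) ^+ d) (2 ^+ d.-1 : R) => a c c0; field.
Qed.

(** The phi_u of one side depend on disjoint sets of edges, so the off-diagonal terms add at most
    mu^2 and only the diagonal remains. *)
Lemma PE_lam_var b : (0 < d)%N -> PE p (fun w => (lam b w - mu_p p d) ^+ 2) <= PE p (lam2 b).
Proof.
move=> d0; set mu := mu_p p d; pose N : R := 2 ^+ d.-1.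
have muE : mu = N * occ (1 - p) d.
  rewrite /mu -(PE_lam b d0) PE_sum (eq_bigr (fun=> occ (1 - p) d)); last first.
    move=> u ub; rewrite -[RHS]expr1 -(cards1 u) -(@PE_prod_phi b) ?sub1set //.
    by apply: eq_bigr => w _; rewrite big_set1.
  by rewrite sumr_const card_side // -[LHS]mulr_natl natrX.
have -> : (fun w => (lam b w - mu) ^+ 2) =
    (fun w => (\sum_(u in side d b) \sum_(v in side d b | v != u) phi w u * phi w v + lam2 b w)
        + ((- (2 * mu)) * lam b w + mu ^+ 2 * 1)).
  apply/funext => w.
  have -> : \sum_(u in side d b) \sum_(v in side d b | v != u) phi w u * phi w v + lam2 b w = lam b w ^+ 2.
    rewrite /lam2 -big_split expr2 /lam [RHS]mulr_suml; apply: eq_bigr => u ub /=.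
    by rewrite mulr_sumr [RHS](bigD1 u) //= expr2 addrC.
  by ring.
rewrite !PED !PEZ PE1 PE_lam //.
suff : PE p (fun w => \sum_(u in side d b) \sum_(v in side d b | v != u) phi w u * phi w v) <= mu ^+ 2.
  by move: (PE _ _) (PE _ _) => y z; rewrite -/mu; lra.
rewrite PE_sum; apply: (@le_trans _ _ (\sum_(u in side d b) \sum_(v in side d b) occ (1 - p) d ^+ 2)).
  apply: ler_sum => u ub; rewrite PE_sum big_mkcondr /=; apply: ler_sum => v vb.
  case: ifP => [vu|_]; last exact: sqr_ge0.
  rewrite -(_ : #|[set u; v]| = 2%N); last by rewrite cards2 eq_sym vu.
  rewrite -(@PE_prod_phi b); last by rewrite subUset !sub1set ub vb.
  rewrite le_eqVlt; apply/orP; left; apply/eqP; apply: eq_bigr => w _; congr (_ * _).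
  by rewrite big_setU1 ?big_set1 // !inE eq_sym.
have sumc (c : R) : \sum_(v in side d b) c = N * c by rewrite sumr_const -[LHS]mulr_natl card_side // natrX.
rewrite sumc sumc muE le_eqVlt; apply/orP; left; apply/eqP.
by rewrite mulrA -expr2 exprMn.
Qed.

Definition nonscat b w : R := \sum_(O : {set cube d} | (O \subset side d b) && ~~ scattered O) \prod_(u in O) phi w u.

Lemma sum_two_in (D : {set cube d}) (c : R) u v : 0 <= c -> u != v ->
  \sum_(O : {set cube d} | (O \subset D) && (u \in O) && (v \in O)) c ^+ #|O| <=
  c ^+ 2 * \sum_(O in powerset D) c ^+ #|O|.
Proof.
move=> c0 uv; rewrite (reindex_onto (fun O => u |: (v |: O)) (fun O => O :\ u :\ v)) /=; last first.
  move=> O /andP[/andP[_ uO] vO]; rewrite [v |: _]finset.setD1K ?finset.setD1K //.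
  by rewrite !inE eq_sym uv.
rewrite mulr_sumr big_mkcond [leRHS]big_mkcond; apply: ler_sum => O _ /=.
case: ifP => [/andP[/andP[/andP[OD _] _] /eqP h]|_]; last first.
  by case: ifP => // _; rewrite mulr_ge0 ?exprn_ge0.
have uO : u \notin O by rewrite -h !inE eqxx andbF.
have vO : v \notin O by rewrite -h !inE eqxx.
rewrite powersetE (subset_trans _ OD); last by rewrite finset.setUA finset.subsetUr.
by rewrite !cardsU1 !inE (negPf uv) (negPf uO) vO /= -exprD.
Qed.

(** A nonscattered set contains a linked pair; there are at most 2^(d-1) d^2 such pairs, and the
    other elements sum to at most exp(mu). *)
Lemma PE_nonscat b : p < 1 -> (0 < d)%N ->
  PE p (nonscat b) <= 2 ^+ d.-1 * (d%:R * d%:R) * (occ (1 - p) d ^+ 2 * expR (mu_p p d)).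
Proof.
move=> p1 d0; have o0 : 0 <= occ (1 - p) d.
  by apply: exprn_ge0; apply: divr_ge0 => //; move: p1; lra.
set o := occ (1 - p) d in o0 *; set E := expR _.
have -> : PE p (nonscat b) = \sum_(O : {set cube d} | (O \subset side d b) && ~~ scattered O) o ^+ #|O|.
  by rewrite PE_sum; apply: eq_bigr => O /andP[Ob _]; exact: PE_prod_phi Ob.
have muE : mu_p p d = #|side d b|%:R * o.
  rewrite -(PE_lam b d0) PE_sum (eq_bigr (fun=> o)); last first.
    move=> u ub; rewrite -[RHS]expr1 -(cards1 u) -(@PE_prod_phi b) ?sub1set //.
    by apply: eq_bigr => w _; rewrite big_set1.
  by rewrite sumr_const -[LHS]mulr_natl.
pose v (z : cube d * ('I_d * 'I_d)) := flip (flip z.1 z.2.1) z.2.2.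
pose F (O : {set cube d}) z : R := if [&& z.1 \in O, v z \in O & z.1 != v z] then o ^+ #|O| else 0.
apply: (@le_trans _ _ (\sum_(O : {set cube d} | O \subset side d b) \sum_(z | z.1 \in side d b) F O z)).
  rewrite big_mkcondr; apply: ler_sum => O Ob; case: ifP => [ns|_]; last first.
    by apply: sumr_ge0 => z _; rewrite /F; case: ifP => // _; exact: exprn_ge0.
  move: ns; rewrite /scattered negb_forall => /existsP[u]; rewrite negb_imply => /andP[uO].
  rewrite negb_forall => /existsP[a]; rewrite negb_imply => /andP[aO].
  rewrite negb_imply => /andP[ua]; rewrite negbK => /lkP[i [j ae]].
  rewrite (bigD1 (u, (i, j))) /=; last exact: (subsetP Ob).
  rewrite {1}/F /v /= -ae uO aO ua lerDl; apply: sumr_ge0 => z _.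
  by rewrite /F; case: ifP => // _; exact: exprn_ge0.
rewrite exchange_big; apply: (@le_trans _ _ (\sum_(z : cube d * ('I_d * 'I_d) | z.1 \in side d b) o ^+ 2 * E)).
  apply: ler_sum => z _; have [zv|zv] := eqVneq z.1 (v z).
    rewrite big1; last move=> O _.
      by apply: mulr_ge0; [exact: sqr_ge0|exact: expR_ge0].
    by rewrite /F zv eqxx !andbF.
  apply: (@le_trans _ _ (o ^+ 2 * \sum_(O in powerset (side d b)) o ^+ #|O|)).
    apply: le_trans (sum_two_in (side d b) o0 zv); rewrite [leLHS]big_mkcond [leRHS]big_mkcond /=.
    apply: ler_sum => O _; rewrite /F zv andbT -andbA.
    by case: (O \subset _) => //=; case: ifP.
  apply: ler_wpM2l; first exact: exprn_ge0.
  by rewrite /E muE; apply: sum_occ_le => //; rewrite subr_gt0.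
apply: (@le_trans _ _ (\sum_(u in side d b) \sum_(ij : 'I_d * 'I_d) o ^+ 2 * E)).
  rewrite pair_big /= le_eqVlt; apply/orP; left; apply/eqP.
  by apply: eq_bigl => z; rewrite andbT.
rewrite (eq_bigr (fun=> d%:R * d%:R * (o ^+ 2 * E))); last first.
  by move=> u _; rewrite sumr_const card_prod card_ord -[LHS]mulr_natl natrM.
by rewrite sumr_const card_side // -[leLHS]mulr_natl natrX mulrA.
Qed.

End Moments.

End Quenched.

(** * Quenched comparison *)

Section Comparison.
Variables (d : nat) (R : realType) (w : {set {set cube d}}).
Hypotheses (wQ : w \subset Qedges d) (d0 : (0 < d)%N).
Implicit Types (b : bool) (S O E : {set cube d}) (k n : nat).

(** The threshold is the largest possible size of a scattered set, so outside thin sets a scattered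
    side is the minority. *)
Definition thin S : bool := (d * #|S :&: side d false| <= 2 ^ d.-1)%N && (d * #|S :&: side d true| <= 2 ^ d.-1)%N.
Definition abnormal S : bool := messy S || thin S.

Lemma scattered_thin b O : O \subset side d b -> scattered O -> (d * #|O| <= 2 ^ d.-1)%N.
Proof.
move=> Ob iO; rewrite mulnC -card_NB_scattered // -(card_side (~~ b) d0).
apply: subset_leq_card; apply/subsetP => v; rewrite in_NB => /card_gt0P[i].
by rewrite inE => /(subsetP Ob); rewrite flip_side.
Qed.

Definition ind_size b k S : R := (scattered (S :&: side d b) && (#|S :&: side d b| == k))%:R.

(** A set that is not abnormal has exactly one scattered side, its minority, and the terms cancel.
    Otherwise three indicators, each summing to at most 1, remain. *)
Lemma minority_ind_size n S :
  \sum_(k < n) `|(minority S == k)%:R - (ind_size false k S + ind_size true k S)| <= 3 * (abnormal S)%:R.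
Proof.
have one (m : nat) : \sum_(k < n) (m == k)%:R <= 1 :> R.
  case: (ltnP m n) => mn.
    rewrite (bigD1 (Ordinal mn)) //= eqxx big1 ?addr0 // => k kn.
    by have := negPf kn; rewrite -val_eqE /= eq_sym => ->.
  by rewrite big1 // => k _; case: eqP => // mk; move: mn; rewrite mk leqNgt ltn_ord.
case: (boolP (abnormal S)) => [_|]; last first.
  rewrite /abnormal /messy negb_or negb_and !negbK mulr0 => /andP[sc th].
  rewrite big1 // => k _; rewrite /ind_size.
  move: sc th; rewrite /thin.
  case sf: (scattered (S :&: side d false)); case st: (scattered (S :&: side d true)) => //= _.
  - by rewrite !(@scattered_thin _ _ (subsetIr _ _)).
  - have h := scattered_thin (subsetIr _ _) sf; rewrite h /= -ltnNge => h2.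
    have h3 := leq_ltn_trans h h2; rewrite ltn_pmul2l // in h3.
    by rewrite /minority /minn h3 addr0 subrr normr0.
  - have h := scattered_thin (subsetIr _ _) st; rewrite h andbT -ltnNge => h2.
    have h3 := leq_ltn_trans h h2; rewrite ltn_pmul2l // in h3.
    by rewrite /minority /minn ltnNge (ltnW h3) /= add0r subrr normr0.
rewrite mulr1; apply: (@le_trans _ _ (\sum_(k < n) ((minority S == k)%:R +
   ((#|S :&: side d false| == k)%:R + (#|S :&: side d true| == k)%:R)))).
  apply: ler_sum => k _; apply: (le_trans (ler_normB _ _)); rewrite ger0_norm //.
  rewrite lerD2l ger0_norm ?addr_ge0 //.
  by apply: lerD; rewrite /ind_size ler_nat; case: (scattered _).
rewrite !big_split /=; have := one (minority S); have := one #|S :&: side d false|.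
by have := one #|S :&: side d true|; move: (\sum_(k < n) _) (\sum_(k < n) _) (\sum_(k < n) _) => y1 y2 y3; lra.
Qed.

Lemma sum_indep_ind_size b k :
  \sum_(S : {set cube d}) (indep w S)%:R * ind_size b k S =
  2 ^+ (2 ^ d.-1) * \sum_(O : {set cube d} | (O \subset side d b) && (scattered O && (#|O| == k))) \prod_(u in O) phi R w u.
Proof.
rewrite (big_side _ b) mulr_sumr big_mkcondr /=.
rewrite (eq_bigl (fun O => O \subset side d b)); last by move=> O; rewrite powersetE.
apply: eq_bigr => O Ob.
rewrite (eq_bigr (fun E => (indep w (O :|: E))%:R * (scattered O && (#|O| == k))%:R)); last first.
  move=> E; rewrite powersetE => Eb; rewrite /ind_size finset.setIUl (finset.setIidPl Ob).
  suff -> : E :&: side d b = finset.set0 by rewrite finset.setU0.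
  apply/eqP; rewrite setI_eq0 disjoint_sym; apply: disjointWr Eb _; exact: side_disj.
rewrite -mulr_suml; case: (boolP (scattered O)) => /= [iO|_]; last by rewrite mulr0.
by case: (_ == _) => /=; rewrite ?mulr0 // mulr1; apply: sum_indep_scattered.
Qed.

(** The elementary symmetric sums run over all sets [O], while only scattered ones are counted
    exactly; [nonscat] is the excess. *)
Lemma quenched_compare n :
  \sum_(k < n) `|\sum_(S : {set cube d}) (indep w S)%:R * (minority S == k)%:R -
     2 ^+ (2 ^ d.-1) * (elsym (side d false) (phi R w) k + elsym (side d true) (phi R w) k)| <=
  3 * \sum_(S : {set cube d} | abnormal S) (indep w S)%:R +
  2 ^+ (2 ^ d.-1) * (nonscat R false w + nonscat R true w).
Proof.
set P2 : R := 2 ^+ _; have P20 : 0 <= P2 by exact: exprn_ge0.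
pose h b k : R := \sum_(O : {set cube d} | (O \subset side d b) && (~~ scattered O && (#|O| == k))) \prod_(u in O) phi R w u.
have h0 b k : 0 <= h b k by apply: sumr_ge0 => O _; apply: prodr_ge0 => u _; exact: phi_ge0.
have eh b k : \sum_(S : {set cube d}) (indep w S)%:R * ind_size b k S = P2 * (elsym (side d b) (phi R w) k - h b k).
  rewrite sum_indep_ind_size -/P2; congr (_ * _); apply/eqP; rewrite eq_sym subr_eq; apply/eqP.
  rewrite /elsym /h (bigID (@scattered d)) /=; congr (_ + _); apply: eq_bigl => O.
    by rewrite -andbA [(_ == _) && _]andbC.
  by rewrite -andbA [(_ == _) && _]andbC.
have sh b : \sum_(k < n) h b k <= nonscat R b w.
  rewrite /h (exchange_big_dep (fun O : {set cube d} => (O \subset side d b) && ~~ scattered O)) /=; last first.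
    by move=> k O _ /and3P[-> ->].
  apply: ler_sum => O /andP[Ob nO].
  rewrite Ob nO /=; have p0 : 0 <= \prod_(u in O) phi R w u by apply: prodr_ge0 => u _; exact: phi_ge0.
  case: (ltnP #|O| n) => On; first by rewrite (big_pred1 (Ordinal On)) // => k; rewrite eq_sym.
  rewrite big_pred0 // => k; apply/eqP => e; have := ltn_ord k; by rewrite -e ltnNge On.
apply: (@le_trans _ _ (\sum_(k < n) (\sum_(S : {set cube d}) (indep w S)%:R *
    `|(minority S == k)%:R - (ind_size false k S + ind_size true k S)| + P2 * (h false k + h true k)))).
  apply: ler_sum => k _.
  have -> : \sum_(S : {set cube d}) (indep w S)%:R * (minority S == k)%:R -
     P2 * (elsym (side d false) (phi R w) k + elsym (side d true) (phi R w) k) =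
     \sum_(S : {set cube d}) (indep w S)%:R * ((minority S == k)%:R - (ind_size false k S + ind_size true k S))
     - P2 * (h false k + h true k).
    under [X in _ = X - _]eq_bigr => S _ do rewrite mulrBr mulrDr.
    by rewrite sumrB big_split /= !eh; ring.
  apply: (le_trans (ler_normB _ _)); apply: lerD; last first.
    by rewrite ger0_norm // mulr_ge0 ?addr_ge0.
  apply: (le_trans (ler_norm_sum _ _ _)); apply: ler_sum => S _.
  by rewrite normrM ger0_norm.
rewrite big_split /= -mulr_sumr big_split /=; apply: lerD; last first.
  by apply: ler_wpM2l => //; apply: lerD.
rewrite exchange_big mulr_sumr [leRHS]big_mkcond /=; apply: ler_sum => S _.
rewrite -mulr_sumr; apply: (le_trans (ler_wpM2l (ler0n _ _) (minority_ind_size n S))).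
by case: (abnormal S); rewrite ?mulr0 // mulr1 mulrC.
Qed.

Lemma sum_indep_minority n : (2 ^ d < n)%N ->
  \sum_(k < n) \sum_(S : {set cube d}) (indep w S)%:R * (minority S == k)%:R =
  \sum_(S : {set cube d}) (indep w S)%:R :> R.
Proof.
move=> dn; rewrite exchange_big; apply: eq_bigr => S _ /=; rewrite -mulr_sumr.
have mn : (minority S < n)%N.
  apply: leq_ltn_trans dn; rewrite -(card_cube d); apply: leq_trans (geq_minl _ _) _.
  exact: subset_leq_card (finset.subsetT _).
rewrite (bigD1 (Ordinal mn)) //= eqxx big1 ?addr0 ?mulr1 // => k kn.
by have := negPf kn; rewrite -val_eqE /= eq_sym => ->.
Qed.

Lemma defect_sizeE k : defect_size R w k =
  (\sum_(S : {set cube d}) (indep w S)%:R * (minority S == k)%:R) / \sum_(S : {set cube d}) (indep w S)%:R.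
Proof.
rewrite /defect_size Even_side Odd_side; congr (_ / _).
  rewrite -sum1_card natr_sum big_mkcond /=; apply: eq_bigr => S _.
  by rewrite finset.inE /minority -natrM mulnb; case: ifP.
rewrite -sum1_card natr_sum big_mkcond /=; apply: eq_bigr => S _.
by rewrite finset.inE; case: ifP.
Qed.

End Comparison.

Lemma tv_nat_le (R : realType) (P Q : nat -> R) (e : R) :
  (forall n, \sum_(k < n) `|P k - Q k| <= 2 * e) -> (tv_nat P Q <= e%:E)%E.
Proof.
move=> h; rewrite /tv_nat -nneseries_esumT; last by move=> k; rewrite lee_fin; exact: normr_ge0.
have : (\sum_(0 <= k <oo) (`|P k - Q k|)%:E <= (2 * e)%:E)%E.
  apply: lime_le; first by apply: is_cvg_nneseries => k _ _; rewrite lee_fin; exact: normr_ge0.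
  by near=> n; rewrite sumEFin lee_fin big_mkord.
move=> /(lee_wpmul2l (_ : 0 <= (2^-1)%:E)%E); rewrite lee_fin => /(_ ltac:(by [])).
move=> /le_trans; apply; rewrite -EFinM lee_fin mulrA mulVf // mul1r //.
Unshelve. all: by end_near.
Qed.

(** Each side gives a multiple of nearly the same Poisson law, whatever its own normalisation, so
    the sum of the two sides does too. The hypothesis makes the discrepancy small against that
    sum. *)
Lemma defect_tv (R : realType) (K eps : R) : 1 <= K -> 0 < eps -> eps <= 2^-1 ->
  exists m0 : R, forall d (mu : R) (w : {set {set cube d}}), (0 < d)%N -> w \subset Qedges d ->
  m0 <= mu -> (forall b, `|lam R b w - mu| <= K) -> (forall b, lam2 R b w <= K) ->
  3 * \sum_(S : {set cube d} | abnormal S) (indep w S)%:R +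
    2 ^+ (2 ^ d.-1) * (nonscat R false w + nonscat R true w) <=
    2 ^+ (2 ^ d.-1) * (eps * (expR (- (10 * K)) * expR mu)) ->
  (tv_nat (defect_size R w) (Defs.poisson_pmf mu) <= (3 * eps)%:E)%E.
Proof.
move=> K1 eps0 eps1; have [m0 np] := nearly_poisson K1 eps0.
exists (Num.max m0 0) => d mu w d0 wQ; rewrite ge_max => /andP[mum mu0] hl hl2.
pose e b k := elsym (side d b) (phi R w) k.
pose A b := \prod_(u in side d b) (1 + phi R w u).
have [Ab S1] : (forall b, 2^-1 * expR (- (10 * K)) * expR mu <= A b) /\
    (forall b n, \sum_(k < n) `|e b k - A b * Defs.poisson_pmf mu k| <= eps * A b).
  suff h b : 2^-1 * expR (- (10 * K)) * expR mu <= A b /\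
      forall n, \sum_(k < n) `|e b k - A b * Defs.poisson_pmf mu k| <= eps * A b.
    by split=> b; have [] := h b.
  have /ler_normlP[h1 h2] := hl b.
  apply: (np mu (lam R b w) (lam2 R b w)) => //.
  - by move=> k; apply: elsym_ge0 => u; exact: phi_ge0.
  - exact: elsym0.
  - exact: elsym1.
  - by move: h2; lra.
  - by move: h1; lra.
  - by move=> k; apply: elsym_up => u; exact: phi_ge0.
  - by move=> k; apply: elsym_lo => u; exact: phi_ge0.
  - by exists #|side d b|.+1 => n hn; apply: sum_elsym.
set P2 : R := 2 ^+ (2 ^ d.-1); have P20 : 0 < P2 by exact: exprn_gt0.
set Del := 3 * _ + _ => hDel.
pose AA := A false + A true.
have E0 : 0 < expR (- (10 * K)) * expR mu by rewrite mulr_gt0 ?expR_gt0.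
have AAge : expR (- (10 * K)) * expR mu <= AA.
  by have := Ab false; have := Ab true; rewrite /AA -!mulrA; lra.
have AA0 : 0 < AA by exact: lt_le_trans AAge.
have DelA : Del <= P2 * (eps * AA).
  by apply: (le_trans hDel); rewrite ler_pM2l // ler_pM2l.
pose I (k : nat) : R := \sum_(S : {set cube d}) (indep w S)%:R * (minority S == k)%:R.
pose T : R := \sum_(S : {set cube d}) (indep w S)%:R.
have SB n : \sum_(k < n) `|I k - P2 * (e false k + e true k)| <= Del := quenched_compare R wQ d0 n.
have SA n : \sum_(k < n) `|e false k + e true k - AA * Defs.poisson_pmf mu k| <= eps * AA.
  apply: (@le_trans _ _ (\sum_(k < n) (`|e false k - A false * Defs.poisson_pmf mu k| + `|e true k - A true * Defs.poisson_pmf mu k|))).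
    apply: ler_sum => k _; apply: le_trans (ler_normD _ _).
    by rewrite le_eqVlt; apply/orP; left; apply/eqP; congr `| _ |; rewrite /AA; ring.
  rewrite big_split /= /AA mulrDr; apply: lerD; exact: S1.
have TA : `|T - P2 * AA| <= Del.
  pose n := (2 ^ d).+1; have := SB n; apply: le_trans; apply: le_trans (ler_norm_sum _ _ _).
  have cn b : (#|side d b| < n)%N.
    by rewrite ltnS -(card_cube d); apply: subset_leq_card; exact: finset.subsetT.
  rewrite sumrB -mulr_sumr big_split /= /I sum_indep_minority //.
  by rewrite /e !sum_elsym.
(* Uses eps <= 1/2, so that the discrepancy is at most half of P2 AA. *)
have T2 : P2 * AA <= 2 * T.
  move: TA; rewrite ler_norml => /andP[t1 _].
  have : P2 * (eps * AA) <= P2 * (2^-1 * AA) by rewrite ler_pM2l // ler_pM2r.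
  lra.
have T0 : 0 < T by have := mulr_gt0 P20 AA0; lra.
apply: tv_nat_le => n.
have -> : \sum_(k < n) `|defect_size R w k - Defs.poisson_pmf mu k| = T^-1 * \sum_(k < n) `|I k - T * Defs.poisson_pmf mu k|.
  rewrite mulr_sumr; apply: eq_bigr => k _; rewrite defect_sizeE -/T -/(I k).
  rewrite -{2}(ger0_norm (_ : 0 <= T^-1)) ?invr_ge0 ?(ltW T0) // -normrM; congr `| _ |.
  by rewrite mulrBr mulrA mulVf ?gt_eqF // mul1r mulrC.
rewrite ler_pdivrMl //.
apply: (@le_trans _ _ (\sum_(k < n) (`|I k - P2 * (e false k + e true k)| +
   (P2 * `|e false k + e true k - AA * Defs.poisson_pmf mu k| + `|T - P2 * AA| * Defs.poisson_pmf mu k)))).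
  apply: ler_sum => k _.
  have -> : I k - T * Defs.poisson_pmf mu k = (I k - P2 * (e false k + e true k)) +
      (P2 * (e false k + e true k - AA * Defs.poisson_pmf mu k) - (T - P2 * AA) * Defs.poisson_pmf mu k) by ring.
  apply: (le_trans (ler_normD _ _)); rewrite lerD2l; apply: (le_trans (ler_normB _ _)).
  by rewrite [`|P2 * _|]normrM [`|_ * Defs.poisson_pmf mu k|]normrM (ger0_norm (pois_pmf_ge0 k mu0)) (ger0_norm (ltW P20)).
rewrite !big_split /= -!mulr_sumr.
have b1 := ler_wpM2l (ltW P20) (SA n).
have b2 := ler_wpM2l (normr_ge0 (T - P2 * AA)) (sum_poisson_pmf_le1 n mu0); rewrite mulr1 in b2.
have b3 := ler_wpM2l (ltW eps0) T2.
apply: (le_trans (lerD (SB n) (lerD b1 (le_trans b2 TA)))).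
by move: DelA b3; move: (P2) (AA) (T) => p2 a t; clear; lra.
Qed.

(** * Conclusion by Markov's inequality over the percolation *)

Section Final.
Variable R : realType.

Lemma sum_small_subsets (T : finType) (D : {set T}) m :
  \sum_(A in powerset D | (#|A| <= m)%N) 1 <= 8 ^+ m * (9 / 8) ^+ #|D| :> R.
Proof.
rewrite -prodr_const; have -> : 9 / 8 = 1 + 8^-1 :> R by field.
rewrite -(sum_powerset_prod D (fun=> 8^-1 : R)) mulr_sumr big_mkcondr /=; apply: ler_sum => A _.
rewrite prodr_const exprVn; case: ifP => [Am|_]; last by rewrite divr_ge0 ?exprn_ge0.
by rewrite ler_pdivlMr ?exprn_gt0 // mul1r ler_eXn2l // ltr1n.
Qed.

Lemma thin_arith m N : (24 * m <= N)%N -> (8 ^+ m * (9 / 8) ^+ N) ^+ 2 <= (4 / 5) ^+ N * 2 ^+ N :> R.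
Proof.
move=> mN; have h1 : (64 : R) <= (6 / 5) ^+ 24.
  have h2 : (2 : R) <= (6 / 5) ^+ 4 by rewrite !exprS expr0; lra.
  have -> : (64 : R) = 2 ^+ 6 by rewrite -natrX.
  rewrite (exprM _ 4 6); apply: lerXn2r; rewrite ?nnegrE //; apply: exprn_ge0; exact: divr_ge0.
have h3 : (8 ^+ m) ^+ 2 <= (6 / 5) ^+ N :> R.
  rewrite -exprM mulnC exprM (_ : 8 ^+ 2 = 64 :> R); last by rewrite -natrX.
  apply: (@le_trans _ _ ((6 / 5) ^+ 24 ^+ m)).
    by apply: lerXn2r; rewrite ?nnegrE //; apply: exprn_ge0; exact: divr_ge0.
  by rewrite -exprM ler_weXn2l // ler_pdivlMr // mul1r ler_nat.
rewrite exprMn -[leRHS]exprMn; apply: (@le_trans _ _ ((6 / 5) ^+ N * ((9 / 8) ^+ N) ^+ 2)).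
  by apply: ler_wpM2r => //; exact: sqr_ge0.
rewrite exprAC -exprMn; apply: lerXn2r; rewrite ?nnegrE.
- by apply: mulr_ge0; [exact: divr_ge0|exact: sqr_ge0].
- by apply: mulr_ge0 => //; exact: divr_ge0.
by rewrite expr2; lra.
Qed.

(** With both sides of size at most N / d there are at most (8^m (9/8)^N)^2 sets, where m = N / d,
    and d >= 24 brings this below (8/5)^N. *)
Lemma sum_thin d : (24 <= d)%N -> \sum_(S : {set cube d} | thin S) 1 <= (4 / 5) ^+ d * 2 ^+ (2 ^ d.-1) :> R.
Proof.
move=> d24; have d0 : (0 < d)%N by apply: leq_trans d24.
set N := (2 ^ d.-1)%N; pose m := (N %/ d)%N.
have mN : (24 * m <= N)%N by apply: leq_trans (leq_trunc_div N d); rewrite mulnC leq_mul2l d24 orbT.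
have dN : (d <= N)%N by rewrite /N -{1}(prednK d0); exact: ltn_expl.
apply: (@le_trans _ _ ((4 / 5) ^+ N * 2 ^+ N)); last first.
  apply: ler_wpM2r; first exact: exprn_ge0.
  by rewrite ler_wiXn2l // ?divr_ge0 // ler_pdivrMr // mul1r ler_nat.
apply: le_trans (thin_arith mN).
rewrite big_mkcond (big_side _ false) /= expr2.
have sb b := @sum_small_subsets _ (side d b) m.
apply: (@le_trans _ _ ((\sum_(E in powerset (side d false) | (#|E| <= m)%N) 1) *
    \sum_(O in powerset (side d true) | (#|O| <= m)%N) 1)); last first.
  have := sb false; have := sb true; rewrite !card_side // => st sf.
  by apply: ler_pM => //; apply: sumr_ge0.
rewrite big_distrlr /= [leRHS]big_mkcondr; apply: ler_sum => E; rewrite powersetE => Ef.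
have sE (O : {set cube d}) : O \subset side d true -> (E :|: O) :&: side d false = E /\ (E :|: O) :&: side d true = O.
  move=> Ot; have ft : [disjoint side d false & side d true] := side_disj d false.
  rewrite !finset.setIUl (finset.setIidPl Ef) (finset.setIidPl Ot).
  rewrite (disjoint_setI0 (disjointWl Ot _)) 1?disjoint_sym // (disjoint_setI0 (disjointWl Ef ft)).
  by rewrite finset.setU0 finset.set0U.
have thinE (O : {set cube d}) : O \subset side d true -> thin (E :|: O) -> (#|E| <= m)%N && (#|O| <= m)%N.
  by move=> /sE[h1 h2]; rewrite /thin h1 h2 -/N /m !leq_divRL // ![(d * _)%N]mulnC.
case: ifP => Em; last first.
  rewrite big1 // => O; rewrite powersetE => Ot; case: ifP => // /(thinE _ Ot).
  by rewrite Em.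
rewrite [leRHS]big_mkcondr; apply: ler_sum => O; rewrite powersetE => Ot.
case: ifP => [/(thinE _ Ot)/andP[_ ->]|_]; first by rewrite mulr1.
by case: ifP => // _; rewrite mulr1.
Qed.

Lemma esmall_mu_pinfty (x m0 : R) : 0 < x -> exists n0, forall d, (n0 <= d)%N -> m0 <= 2^-1 * (1 + x) ^+ d.
Proof.
move=> x0; have b d : 1 + d%:R * x <= (1 + x) ^+ d.
  elim: d => [|d IH]; first by rewrite mul0r addr0 expr0.
  rewrite exprS; have h : (1 + x) * (1 + d%:R * x) <= (1 + x) * (1 + x) ^+ d.
    by apply: ler_wpM2l => //; rewrite addr_ge0 // ltW.
  apply: le_trans h; rewrite -natr1; have : 0 <= d%:R * (x * x) by rewrite !mulr_ge0 // ltW.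
  lra.
exists (Num.bound (2 * `|m0| / x)) => d hd.
have h1 : 2 * `|m0| <= d%:R * x.
  rewrite -ler_pdivrMr //; apply: (@le_trans _ _ (Num.bound (2 * `|m0| / x))%:R); last by rewrite ler_nat.
  by apply/ltW/archi_boundP; rewrite divr_ge0 ?mulr_ge0 // ltW.
by have := b d; have := ler_norm m0; lra.
Qed.

Section Main.
Variables (p eps : R).
Hypotheses (p_ge : 2 / 3 <= p) (p_lt1 : p < 1) (eps_gt0 : 0 < eps).

Let p_ge0 : 0 <= p. Proof. by move: p_ge; lra. Qed.
Let x_gt0 : 0 < 1 - p. Proof. by rewrite subr_gt0. Qed.
Let x_le : 1 - p <= 3^-1. Proof. by move: p_ge; lra. Qed.
Let muE d : mu_p p d = 2^-1 * (1 + (1 - p)) ^+ d.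
Proof. by rewrite /mu_p; congr (_ * _ ^+ _); ring. Qed.

(** The mean is (2 - 3p/2)^d / 2, bounded in d exactly when p >= 2/3. *)
Lemma PE_lam2_le d b : (0 < d)%N -> PE p (lam2 R (d := d) b) <= 2^-1.
Proof.
move=> d0; rewrite PE_lam2 //.
have -> : 1 - 3 / 4 * p = (2 - 3 / 2 * p) / 2 by field.
rewrite expr_div_n; have -> : (2 : R) ^+ d = 2 * 2 ^+ d.-1 by rewrite -exprS prednK.
have c0 : (2 : R) ^+ d.-1 != 0 by rewrite expf_neq0.
have : (2 - 3 / 2 * p) ^+ d <= 1 by apply: exprn_ile1; move: p_ge p_lt1; lra.
move: ((2 - 3 / 2 * p) ^+ d) (2 ^+ d.-1 : R) c0 => a c c0 a1.
have -> : c * (a / (2 * c)) = a / 2 by field.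
lra.
Qed.

Definition discrepancy d (w : {set {set cube d}}) : R :=
  3 * \sum_(S : {set cube d} | abnormal S) (indep w S)%:R +
    2 ^+ (2 ^ d.-1) * (nonscat R false w + nonscat R true w).

Lemma discrepancy_ge0 d (w : {set {set cube d}}) : 0 <= discrepancy w.
Proof.
have ns b : 0 <= nonscat R b w by apply: sumr_ge0 => O _; apply: prodr_ge0 => u _; exact: phi_ge0.
by apply: addr_ge0; apply: mulr_ge0; rewrite ?exprn_ge0 ?addr_ge0 //; apply: sumr_ge0.
Qed.

Lemma esmall_discrepancy :
  esmall (fun d => PE p (@discrepancy d) / (2 ^+ (2 ^ d.-1) * expR (mu_p p d))).
Proof.
(* Rate of the nonscattered term, from 2^(d-1) occ^2 = r^d / 2; here r <= 8/9 since 1 - p <= 1/3. *)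
pose r : R := (1 + (1 - p)) ^+ 2 / 2.
have r0 : 0 < r by rewrite divr_gt0 // exprn_gt0 // addr_gt0.
have r1 : r < 1 by rewrite /r ltr_pdivrMr // mul1r expr2; move: x_gt0 x_le; nra.
have e1 := annealed_messy x_gt0 x_le.
have e2 := @esmall_expr R (4 / 5) ltac:(lra) ltac:(lra).
have e3 := esmall_natr (esmall_natr (esmall_expr r0 r1)).
have e := esmallD (esmallZ (ler0n R 3) e1) (esmallD (esmallZ (ler0n R 3) e2) e3).
apply: (esmall_le (n0 := 24)) e => d d24.
have d0 : (0 < d)%N by apply: leq_trans d24.
rewrite -muE; set P2 : R := 2 ^+ _; set E := expR _.
have P20 : 0 < P2 by exact: exprn_gt0.
have E1 : 1 <= E.
  by rewrite -[leLHS]expR0 ler_expR muE mulr_ge0 ?invr_ge0 // exprn_ge0 // addr_ge0 // ltW.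
have E0 : 0 < E by exact: lt_le_trans E1.
rewrite ler_pdivrMr ?mulr_gt0 //.
have -> : PE p (@discrepancy d) = 3 * \sum_(S : {set cube d} | abnormal S) wt (1 - p) S +
    P2 * (PE p (nonscat R (d := d) false) + PE p (nonscat R (d := d) true)).
  rewrite /discrepancy PED !PEZ PED PE_sum; congr (3 * _ + _).
  by apply: eq_bigr => S _; rewrite PE_indep.
have w1 (S : {set cube d}) : wt (1 - p) S <= 1.
  by apply: exprn_ile1; move: x_gt0 x_le; lra.
have w0 (S : {set cube d}) : 0 <= wt (1 - p) S by rewrite exprn_ge0 // ltW.
set M := \sum_(S : {set cube d} | messy S) wt (1 - p) S.
have h1 : \sum_(S : {set cube d} | abnormal S) wt (1 - p) S <= M + (4 / 5) ^+ d * P2.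
  apply: le_trans (lerD (lexx _) (sum_thin d24)).
  rewrite /M big_mkcond [X in _ <= X + _]big_mkcond [X in _ <= _ + X]big_mkcond -big_split /=.
  apply: ler_sum => S _; rewrite /abnormal.
  case: (messy S); case: (thin S) => /=; rewrite ?addr0 ?add0r ?lerDl //.
have h2 b : PE p (nonscat R (d := d) b) <= 2^-1 * (d%:R * (d%:R * r ^+ d)) * E.
  apply: (le_trans (PE_nonscat b p_lt1 d0)).
  rewrite le_eqVlt; apply/orP; left; apply/eqP; rewrite -/E /occ /r !expr_div_n exprAC.
  have -> : (2 : R) ^+ d = 2 * 2 ^+ d.-1 by rewrite -exprS prednK.
  have : (2 : R) ^+ d.-1 != 0 by rewrite expf_neq0.
  by move: ((1 + (1 - p)) ^+ d) (2 ^+ d.-1 : R) => a c c0; field.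
have PE0 : P2 * E != 0 by rewrite mulf_neq0 ?gt_eqF.
have -> : (3 * (M / (P2 * E)) + (3 * (4 / 5) ^+ d + d%:R * (d%:R * r ^+ d))) * (P2 * E) =
   3 * M + 3 * ((4 / 5) ^+ d * P2) * E + P2 * (d%:R * (d%:R * r ^+ d) * E) by field; rewrite !gt_eqF.
have h3 := lerD (h2 false) (h2 true).
have h4 : P2 * (PE p (nonscat R (d := d) false) + PE p (nonscat R (d := d) true)) <= P2 * (d%:R * (d%:R * r ^+ d) * E).
  rewrite ler_pM2l //; apply: (le_trans h3); rewrite le_eqVlt; apply/orP; left; apply/eqP.
  by field.
apply: lerD h4; have q0 : 0 <= (4 / 5) ^+ d * P2 by rewrite mulr_ge0 ?exprn_ge0 ?divr_ge0 // ltW.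
have := ler_wpM2l q0 E1; rewrite mulr1 => h5.
by move: h1 h5; move: (\sum_(S : {set cube d} | abnormal S) _) M (_ * P2) => u v y; lra.
Qed.

(** A bad percolation has a large deviation on one of the two sides or a large discrepancy; a single
    function [F], at least 1 on all three events, has small mean. *)
Lemma bad_prob_small (del : R) : 0 < del -> exists n0, forall d, (n0 <= d)%N -> bad_prob p eps d <= del.
Proof.
move=> del0.
pose e1 := Num.min 2^-1 (eps / 3).
have e10 : 0 < e1 by rewrite /e1 lt_min; apply/andP; split; move: eps_gt0; lra.
have e1h : e1 <= 2^-1 by rewrite /e1 ge_min lexx.
have e1e : 3 * e1 <= eps.
  have : e1 <= eps / 3 by rewrite /e1 ge_min lexx orbT.
  lra.
(* Each deviation has mean at most 1 and so contributes at most 1/K <= del / 4. As K does not depend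
   on d, the constant exp(-10 K) is beaten by the exponentially small discrepancy. *)
pose K := Num.max 1 (4 / del).
have K1 : 1 <= K by rewrite /K le_max lexx.
have K0 : 0 < K by exact: lt_le_trans K1.
have Kd : K^-1 <= del / 4.
  rewrite -[_ / 4]invrK lef_pV2 ?posrE //; last by rewrite invr_gt0 divr_gt0.
  by rewrite invf_div /K le_max lexx orbT.
have [m0 tv] := defect_tv K1 e10 e1h.
have [n1 mu1] := @esmall_mu_pinfty (1 - p) m0 x_gt0.
pose a := e1 * expR (- (10 * K)).
have a0 : 0 < a by apply: mulr_gt0 => //; exact: expR_gt0.
have [n2 h2] := esmall_lt esmall_discrepancy (mulr_gt0 (divr_gt0 del0 (ltr0Sn R 1)) a0).
exists (maxn 1 (maxn n1 n2)) => d; rewrite !geq_max => /and3P[d0 dn1 dn2].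
have {}h2 := h2 d dn2; set mu := mu_p p d in h2 *.
have {}mu1 : m0 <= mu by rewrite /mu muE; exact: mu1.
set P2 : R := 2 ^+ _ in h2; have P20 : 0 < P2 by exact: exprn_gt0.
have E0 := expR_gt0 mu.
have c0 : 0 < P2 * (a * expR mu) by apply: mulr_gt0 => //; exact: mulr_gt0.
pose dev b (w : {set {set cube d}}) : R := (lam R b w - mu) ^+ 2 + lam2 R b w.
have dev0 b w : 0 <= dev b w.
  by rewrite addr_ge0 ?sqr_ge0 //; apply: sumr_ge0 => u _; exact: sqr_ge0.
pose F w := K^-1 * dev false w + (K^-1 * dev true w + (P2 * (a * expR mu))^-1 * discrepancy w).
have -> : bad_prob p eps d = PE p (fun w : {set {set cube d}} =>
    ((eps%:E < tv_nat (defect_size R w) (Defs.poisson_pmf mu))%E)%:R).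
  rewrite /bad_prob big_mkcondr; apply: eq_bigr => w _.
  by case: ifP => _; rewrite ?mulr1 ?mulr0.
have Ki0 : 0 <= K^-1 by rewrite invr_ge0 ltW.
have ci0 : 0 <= (P2 * (a * expR mu))^-1 by rewrite invr_ge0 ltW.
have t1 b w : 0 <= K^-1 * dev b w by rewrite mulr_ge0.
have t2 w : 0 <= (P2 * (a * expR mu))^-1 * @discrepancy d w by rewrite mulr_ge0 // discrepancy_ge0.
apply: (@le_trans _ _ (PE p F)).
  apply: PE_le => //; first exact: ltW.
  move=> w wQ; case: (boolP (_ < _)%E) => [bad|_]; last first.
    by rewrite /F !addr_ge0.
  rewrite -[leLHS]/(1 : R).
  have big_dev b : ~~ ((`|lam R b w - mu| <= K) && (lam2 R b w <= K)) -> 1 <= K^-1 * dev b w.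
    rewrite negb_and -!ltNge => h; rewrite mulrC ler_pdivlMr // mul1r.
    have l0 : 0 <= lam2 R b w by apply: sumr_ge0 => u _; exact: sqr_ge0.
    case/orP: h => h; last by rewrite /dev; have := sqr_ge0 (lam R b w - mu); lra.
    have : K ^+ 2 <= (lam R b w - mu) ^+ 2.
      rewrite -[leRHS]real_normK ?num_real //; apply: lerXn2r; rewrite ?nnegrE //; exact: ltW.
    have : K * 1 <= K * K by rewrite ler_pM2l.
    by move: l0; rewrite /dev -expr2; lra.
  case: (boolP ((`|lam R false w - mu| <= K) && (lam2 R false w <= K))) => [/andP[f1 f2]|/big_dev h]; last first.
    by rewrite /F; have := t1 true w; have := t2 w; lra.
  case: (boolP ((`|lam R true w - mu| <= K) && (lam2 R true w <= K))) => [/andP[f3 f4]|/big_dev h]; last first.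
    by rewrite /F; have := t1 false w; have := t2 w; lra.
  suff : 1 <= (P2 * (a * expR mu))^-1 * discrepancy w.
    by rewrite /F; have := t1 false w; have := t1 true w; lra.
  rewrite mulrC ler_pdivlMr // mul1r ltW // ltNge; apply/negP => hD.
  move: bad; rewrite ltNge => /negP; apply.
  apply: le_trans (_ : ((3 * e1)%:E <= eps%:E)%E); last by rewrite lee_fin.
  rewrite /a -[e1 * _ * _]mulrA in hD.
  by apply: tv d0 wQ mu1 _ _ hD; case.
rewrite /F !PED !PEZ.
have dv b : PE p (dev b) <= 1.
  rewrite PED; have := PE_lam2_le b d0; have := PE_lam_var p b d0.
  by rewrite -/mu; lra.
have g1 := ler_wpM2l Ki0 (dv false); have g2 := ler_wpM2l Ki0 (dv true).
have g3 : (P2 * (a * expR mu))^-1 * PE p (@discrepancy d) <= del / 2.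
  rewrite ler_pdivrMl //; move: h2; rewrite ler_pdivrMr ?mulr_gt0 // => h2.
  apply: (le_trans h2); rewrite le_eqVlt; apply/orP; left; apply/eqP.
  by move: (expR mu) => E; ring.
move: g1 g2 g3 Kd; rewrite mulr1; lra.
Qed.

End Main.

End Final.

Local Open Scope classical_set_scope.

Theorem theorem1p2 (R : realType) (p : R) :
  2 / 3 <= p -> p < 1 ->
  forall eps : R, 0 < eps ->
    bad_prob p eps n @[n --> \oo] --> 0.
Proof.
move=> p_ge p_lt1 eps eps_gt0; apply/cvgrPdist_le => e e_gt0.
have [n0 h] := bad_prob_small p_ge p_lt1 eps_gt0 e_gt0.
exists n0 => // d /= n0d; rewrite sub0r normrN ger0_norm; first exact: h.
apply: sumr_ge0 => w _; apply: perc_weight_ge0; last exact: ltW.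
by apply: le_trans p_ge; apply: divr_ge0.
Qed.
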